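(* Let $D=\Delta$ or $D=\mathbb{H}$. For any $\tau>1$ there is an analytic function $f$ on $D$ which satisfies, for all $z\in D$, $$\left|\frac{f''(z)}{f'(z)}\right|\le\frac{\tau}{1-|z|^2}\ \text{ in the case } D=\Delta,\qquad \left|\frac{f''(z)}{f'(z)}\right|\le\frac{\tau}{2\,\Im\{z\}}\ \text{ in the case } D=\mathbb{H},$$ such that all values of $f'$ lie in some annulus $R(m,M)$ with $0<m<M<\infty$, and such that for every $r>0$ and every $z_0\in f(\partial D)$, $\dim(\Delta(z_0,r)\cap\mathcal{I}(f))=1$.
   Context: $\mathbb{H}=\{z\in\mathbb{C}:\Im z>0\}$, $\Delta(a,r)=\{z\in\mathbb{C}:|z-a|<r\}$, $\Delta=\Delta(0,1)$, $R(m,M)=\{z\in\mathbb{C}:m<|z|<M\}$. For $X\subset\mathbb{C}$, $\dim(X)$ is the Hausdorff dimension of $X$. For an analytic function $f$ on a domain $D$, $\mathcal{I}(f)$ is the set of infinite valence values of $f$: the set of $w\in f(D)$ for which $f^{-1}(w)=\{z\in D: f(z)=w\}$ is infinite. $\partial D$ is the boundary of $D$ in $\mathbb{C}$ (so $\partial\mathbb{H}=\mathbb{R}$). Since $f'$ is bounded, $f$ is Lipschitz on the convex domain $D$ and so extends continuously to $\overline{D}$; $f(\partial D)$ is the image of $\partial D$ under this extension. *)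

(* Defs.v *)
From HB Require Import structures.
From mathcomp Require Import all_boot all_order all_algebra.
From mathcomp Require Import complex.
From mathcomp Require Import all_classical all_reals all_analysis.

Set Implicit Arguments.
Unset Strict Implicit.
Unset Printing Implicit Defensive.

Import Order.TTheory GRing.Theory Num.Theory.
Import numFieldNormedType.Exports.

Local Open Scope classical_set_scope.
Local Open Scope ring_scope.
Local Open Scope complex_scope.

(* The complex plane.  Packing R[i] as a numClosedFieldType is what makes the
   norm topology and the normed-module structure over itself available, so that
   [f^`()] below is the complex derivative.  Its order is partial (x <= y iff
   y - x is a nonnegative real), and both `|z| and 'Im z are real elements of
   Cplx R; real numbers are embedded with %:C. *)
Definition Cplx (R : realType) : numClosedFieldType := R[i].

Section Defs.
Variable R : realType.
Local Notation C := (Cplx R).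

Definition disc (a : C) (r : R) : set C := [set z | `|z - a| < r%:C].

Definition unit_disc : set C := disc 0 1.

Definition upper_half_plane : set C := [set z | 0 < 'Im z].

Definition annulus (m M : R) : set C := [set z | m%:C < `|z| < M%:C].

Definition boundary (D : set C) : set C := closure D `\` interior D.

Definition analytic_on (D : set C) (f : C -> C) : Prop :=
  forall z, D z -> derivable f z 1.

Definition infinite_valence (D : set C) (f : C -> C) : set C :=
  [set w | (f @` D) w /\ infinite_set (D `&` f @^-1` [set w])].

(* The extension of f : D -> C by continuity to the closure of D.  The values
   of f outside of D are irrelevant. *)
Definition extend (D : set C) (f : C -> C) (z : C) : C :=
  lim (f @ within D (nbhs z)).

Local Open Scope ereal_scope.

(* The maximum with 0 only matters for the empty set, where the supremum is
   -oo. *)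
Definition diam (A : set C) : \bar R :=
  maxe 0 (ereal_sup [set (complex.Re `|p.1 - p.2|)%:E | p in A `*` A]).

Definition hausdorff_premeasure (s delta : R) (X : set C) : \bar R :=
  ereal_inf [set \sum_(n <oo) diam (U n) `^ s |
    U in [set U : nat -> set C |
          X `<=` \bigcup_n U n /\ forall n, diam (U n) <= delta%:E]].

Definition hausdorff_measure (s : R) (X : set C) : \bar R :=
  ereal_sup [set hausdorff_premeasure s delta X |
    delta in [set delta : R | (0 < delta)%R]].

(* With s > 0, 0 `^ s = 0, so sets of diameter 0 in a covering cost nothing;
   leaving out s = 0 does not change the infimum. *)
Definition hausdorff_dim (X : set C) : \bar R :=
  ereal_inf [set s%:E | s in
    [set s : R | (0 < s)%R /\ hausdorff_measure s X = 0]].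

End Defs.

Arguments unit_disc : clear implicits.
Arguments upper_half_plane : clear implicits.

(* Main.v *)
(** Let [W z] be [1 - |z|^2] on the disc and [2 Im z] on the half-plane, so that the bound to achieve is
    [W |f'' / f'| <= tau].  On the half-plane let [lambda + e^lambda = - 2 i z - 1] with [|Im lambda| < pi].
    For small [k] the map [z - (i/2) (1 + k) lambda z] satisfies the bound with a constant close to 1, and [k]
    can be chosen such that it takes the same value at two points of different heights; cutting off below the
    lower one gives a map which, near a boundary point, takes only values that it takes again at inner points.
    Subtracting a far translate makes the perturbation decay at infinity, and composing it with maps
    [x + s / (x + i)] makes its derivative as little larger (or as little smaller) than 1 as wanted.
    Scaled copies of such perturbations are inserted at the points of finer and finer grids of the boundary:
    large derivatives are met with the copies that hardly increase them, small ones with those that hardly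
    decrease them, so the bounds survive in the limit [f].  A boundary point that lies near a grid point at
    every stage has a value taken infinitely often.  These points contain Cantor sets whose gaps are
    only slightly larger than their cells, and [f] is bilipschitz on the cells up to the scale of the next
    grid; hence the images have dimension arbitrarily close to 1.  Conversely [f] is Lipschitz up to the boundary and
    locally injective inside, so the values of infinite valence lie on the Lipschitz image of the boundary. *)
Require Import Defs.
From HB Require Import structures.
From mathcomp Require Import all_boot all_order all_algebra.
From mathcomp Require Import complex.
From mathcomp Require Import all_classical all_reals all_analysis.
From mathcomp Require Import ring lra.

Import Order.TTheory GRing.Theory Num.Theory.
Import numFieldNormedType.Exports.

Local Open Scope classical_set_scope.
Local Open Scope ring_scope.
Local Open Scope complex_scope.

Set Implicit Arguments.
Unset Strict Implicit.
Unset Printing Implicit Defensive.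

(** * Coordinates, conjugation and modulus in the complex plane *)

Section ComplexNorm.
Variable R : realType.
Local Notation C := (Cplx R).
Implicit Types (z w h : C) (x y : R).

(** With [om = e^lambda] the map [z - (i/2) lambda] is [(i/2) (om + 1)]. It is injective in the
    half-plane, but its extension takes one value at both boundary points [pi/2] and [- pi/2], where
    [om = -1]; moreover [W |f'' / f'| = 4 Im z / |1 + om|^2] is at most 1, with equality where
    [|om| = 1]. A constant 1 still forces injectivity, so a value repeated inside needs a little
    more: [k] moves the coincidence to two inner points near [- pi/2] and [pi/2]. The perturbations
    decay only like [1 / |x|], so the effect of all other copies on one of them is a harmonic sum.
    Copies on a grid of width [2^-n] must therefore be smaller than the width by a factor of order
    [n]. This logarithmic loss is the reason why the gaps exceed the cells, and it is too small to
    lower the dimension. A copy that changes large derivatives upwards by a factor at most [1 + 3 d]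
    may still decrease them by a fixed factor [lo]. It is essential that [lo], and likewise the
    factor [hi] of the other kind, do not depend on [d], because [d] tends to 0 along the stages. *)

Definition re z : R := complex.Re z.
Definition im z : R := complex.Im z.
Definition rc x : C := x%:C.
Definition ii : C := Complex 0 1.
Definition cj z : C := Complex (re z) (- im z).
Definition nrm z : R := Num.sqrt (re z ^+ 2 + im z ^+ 2).

Lemma reimP z w : re z = re w -> im z = im w -> z = w.
Proof. by case: z w => [a b] [c d]; rewrite /re /im /= => -> ->. Qed.

Lemma re_rc x : re (rc x) = x. Proof. by []. Qed.
Lemma im_rc x : im (rc x) = 0. Proof. by []. Qed.
Lemma re_ii : re ii = 0. Proof. by []. Qed.
Lemma im_ii : im ii = 1. Proof. by []. Qed.
Lemma re0 : re 0 = 0. Proof. by []. Qed.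
Lemma im0 : im 0 = 0. Proof. by []. Qed.
Lemma re1 : re 1 = 1. Proof. by []. Qed.
Lemma im1 : im 1 = 0. Proof. by []. Qed.
Lemma reD z w : re (z + w) = re z + re w. Proof. by case: z w => [a b] [c d]. Qed.
Lemma imD z w : im (z + w) = im z + im w. Proof. by case: z w => [a b] [c d]. Qed.
Lemma reN z : re (- z) = - re z. Proof. by case: z => [a b]. Qed.
Lemma imN z : im (- z) = - im z. Proof. by case: z => [a b]. Qed.
Lemma reB z w : re (z - w) = re z - re w. Proof. by rewrite reD reN. Qed.
Lemma imB z w : im (z - w) = im z - im w. Proof. by rewrite imD imN. Qed.
Lemma reM z w : re (z * w) = re z * re w - im z * im w. Proof. by case: z w => [a b] [c d]. Qed.
Lemma imM z w : im (z * w) = re z * im w + im z * re w. Proof. by case: z w => [a b] [c d]. Qed.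
Lemma re_cj z : re (cj z) = re z. Proof. by []. Qed.
Lemma im_cj z : im (cj z) = - im z. Proof. by []. Qed.

Definition reimE := (re_rc, im_rc, re_ii, im_ii, re0, im0, re1, im1, reB, imB, reD, imD, reN, imN, reM, imM, re_cj, im_cj).

Lemma rc0 : rc 0 = 0. Proof. by []. Qed.
Lemma rc1 : rc 1 = 1. Proof. by []. Qed.
Lemma rcD x y : rc (x + y) = rc x + rc y. Proof. by apply: reimP; rewrite !reimE ?addr0. Qed.
Lemma rcM x y : rc (x * y) = rc x * rc y. Proof. by apply: reimP; rewrite !reimE; ring. Qed.
Lemma rcN x : rc (- x) = - rc x. Proof. by apply: reimP; rewrite !reimE; ring. Qed.
Lemma rcB x y : rc (x - y) = rc x - rc y. Proof. by rewrite rcD rcN. Qed.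
Lemma rc_eq0 x : (rc x == 0) = (x == 0).
Proof. by apply/eqP/eqP => [/(congr1 re) | ->]. Qed.
Lemma rcV x : rc x^-1 = (rc x)^-1.
Proof.
have [->|x0] := eqVneq x 0; first by rewrite invr0 rc0 invr0.
apply: (mulfI (x := rc x)); first by rewrite rc_eq0.
by rewrite -rcM !divff ?rc_eq0 // rc1.
Qed.

Lemma rcE x : rc x = x%:C. Proof. by []. Qed.

Lemma ii2 : ii * ii = -1. Proof. by apply: reimP; rewrite !reimE; ring. Qed.
Lemma iiV : ii^-1 = - ii.
Proof.
have i0 : ii != 0 by apply/eqP => /(congr1 im); rewrite !reimE; lra.
by apply: (mulfI i0); rewrite divff // mulrN ii2 opprK.
Qed.

Lemma normE z : `|z| = rc (nrm z).
Proof. exact: normc_def. Qed.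

Lemma nrm_sqr z : nrm z ^+ 2 = re z ^+ 2 + im z ^+ 2.
Proof. by rewrite sqr_sqrtr // addr_ge0 // sqr_ge0. Qed.

Lemma nrm_ge0 z : 0 <= nrm z. Proof. exact: sqrtr_ge0. Qed.
Hint Resolve nrm_ge0 : core.

Lemma rc_inj : injective rc. Proof. exact: complexI. Qed.
Lemma nrmM z w : nrm (z * w) = nrm z * nrm w.
Proof. by apply: rc_inj; rewrite rcM -!normE normrM. Qed.
Lemma nrmN z : nrm (- z) = nrm z.
Proof. by apply: rc_inj; rewrite -!normE normrN. Qed.
Lemma nrmV z : nrm z^-1 = (nrm z)^-1.
Proof. by apply: rc_inj; rewrite rcV -!normE normfV. Qed.
Lemma nrm_div z w : nrm (z / w) = nrm z / nrm w.
Proof. by rewrite nrmM nrmV. Qed.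
Lemma nrmD z w : nrm (z + w) <= nrm z + nrm w.
Proof. by rewrite -lecR -!rcE rcD -!normE ler_normD. Qed.
Lemma nrmB z w : nrm (z - w) = nrm (w - z).
Proof. by rewrite -nrmN opprB. Qed.
Lemma nrm_subD z w : nrm (z - w) <= nrm z + nrm w.
Proof. by rewrite -(nrmN w) nrmD. Qed.
Lemma nrm_tri w z v : nrm (z - v) <= nrm (z - w) + nrm (w - v).
Proof. by apply: le_trans (nrmD _ _); rewrite addrA subrK. Qed.
Lemma nrm_lowD z w : nrm z - nrm w <= nrm (z + w).
Proof. by rewrite lerBlDr; apply: le_trans (nrm_subD _ _); rewrite addrK. Qed.
Lemma nrm_lowB z w : nrm z - nrm w <= nrm (z - w).
Proof. by rewrite -(nrmN w) nrm_lowD. Qed.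
Lemma nrm_rc x : nrm (rc x) = `|x|.
Proof. by rewrite /nrm !reimE expr0n /= addr0 sqrtr_sqr. Qed.
Lemma nrm0 : nrm 0 = 0. Proof. by rewrite -rc0 nrm_rc normr0. Qed.
Lemma nrm1 : nrm 1 = 1. Proof. by rewrite -rc1 nrm_rc normr1. Qed.
Lemma nrm_ii : nrm ii = 1.
Proof. by rewrite /nrm !reimE expr0n /= add0r expr1n sqrtr1. Qed.
Lemma nrm_eq0 z : (nrm z == 0) = (z == 0).
Proof.
apply/eqP/eqP => [h | ->]; last exact: nrm0.
by apply/eqP; rewrite -normr_eq0 normE h.
Qed.
Lemma nrm_gt0 z : (0 < nrm z) = (z != 0).
Proof. by rewrite lt0r nrm_eq0 nrm_ge0 andbT. Qed.
Lemma nrm_cj z : nrm (cj z) = nrm z.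
Proof. by rewrite /nrm re_cj im_cj sqrrN. Qed.
Lemma cj_mul z : z * cj z = rc (nrm z ^+ 2).
Proof. by rewrite nrm_sqr; apply: reimP; rewrite !reimE; ring. Qed.

Lemma re_le z : `|re z| <= nrm z.
Proof.
rewrite -(@ler_pXn2r _ 2) ?nnegrE // nrm_sqr real_normK ?num_real //.
by rewrite lerDl sqr_ge0.
Qed.
Lemma im_le z : `|im z| <= nrm z.
Proof.
rewrite -(@ler_pXn2r _ 2) ?nnegrE // nrm_sqr real_normK ?num_real //.
by rewrite lerDr sqr_ge0.
Qed.
Lemma re_nrm z : re z <= nrm z. Proof. exact: le_trans (ler_norm _) (re_le _). Qed.
Lemma im_nrm z : im z <= nrm z. Proof. exact: le_trans (ler_norm _) (im_le _). Qed.
Lemma nrm_reim z : nrm z <= `|re z| + `|im z|.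
Proof.
have -> : nrm z = nrm (rc (re z) + ii * rc (im z)).
  by congr nrm; apply: reimP; rewrite !reimE; ring.
by apply: le_trans (nrmD _ _) _; rewrite nrmM nrm_ii mul1r !nrm_rc.
Qed.

Lemma nrm_rcM x z : 0 <= x -> nrm (rc x * z) = x * nrm z.
Proof. by move=> x0; rewrite nrmM nrm_rc ger0_norm. Qed.

Lemma nrm_sum (I : Type) (s : seq I) (P : pred I) (F : I -> C) :
  nrm (\sum_(i <- s | P i) F i) <= \sum_(i <- s | P i) nrm (F i).
Proof.
elim/big_rec2: _ => [|i x y _ h]; first by rewrite nrm0.
by apply: le_trans (nrmD _ _) _; rewrite lerD2l.
Qed.

End ComplexNorm.
#[export] Hint Extern 0 (is_true (0 <= nrm _)) => exact: nrm_ge0 : core.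

(** * Complex differentiability by explicit estimates *)

Section ComplexDerivative.
Variable R : realType.
Local Notation C := (Cplx R).
Implicit Types (z w h a b d : C) (x y e : R) (f g : C -> C).

(** Differentiability in remainder form, without quotients: composition, mean values and limits
    become inequalities between moduli. [cd_derive1] leads back to the derivative of the theorem. At
    boundary points all directions are meant, so the inserted functions are differentiable beyond
    the closed domain. *)
Definition cd f z d := forall e, 0 < e -> exists2 r, 0 < r &
  forall h, nrm h < r -> nrm (f (z + h) - f z - d * h) <= e * nrm h.

Lemma cd_const a z : cd (fun=> a) z 0.
Proof.
move=> e e0; exists 1 => // h _.
by rewrite subrr mul0r subrr nrm0 mulr_ge0 // ltW.
Qed.

Lemma cd_id z : cd id z 1.
Proof.
move=> e e0; exists 1 => // h _.
rewrite (_ : _ - _ = 0); last by ring.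
by rewrite nrm0 mulr_ge0 // ltW.
Qed.

Lemma cd_add f g z a b : cd f z a -> cd g z b -> cd (fun u => f u + g u) z (a + b).
Proof.
move=> Hf Hg e e0; have e2 : 0 < e / 2 by rewrite divr_gt0.
have [r r0 hr] := Hf _ e2; have [s s0 hs] := Hg _ e2.
exists (Num.min r s); first by rewrite lt_min r0.
move=> h; rewrite lt_min => /andP[h1 h2].
have -> : f (z + h) + g (z + h) - (f z + g z) - (a + b) * h
   = (f (z + h) - f z - a * h) + (g (z + h) - g z - b * h) by ring.
apply: le_trans (nrmD _ _) _; have := hr _ h1; have := hs _ h2; lra.
Qed.

Let absorb_div (x e y : R) : 0 <= x -> 0 <= e -> 0 <= y ->
  x * (e / (x + 1) * y) <= e * y.
Proof.
move=> x0 e0 y0; have x1 : 0 < x + 1 by rewrite ltr_wpDl.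
rewrite mulrA; apply: ler_wpM2r => //.
by rewrite mulrCA -[leRHS]mulr1 ler_wpM2l // ler_pdivrMr // mul1r lerDl.
Qed.

Lemma cd_scale f z a c : cd f z a -> cd (fun u => c * f u) z (c * a).
Proof.
move=> Hf e e0; have c1 : 0 < nrm c + 1 by rewrite ltr_wpDl.
have [r r0 hr] := Hf (e / (nrm c + 1)) (divr_gt0 e0 c1).
exists r => // h hh.
have -> : c * f (z + h) - c * f z - c * a * h = c * (f (z + h) - f z - a * h) by ring.
rewrite nrmM; apply: le_trans (ler_wpM2l (nrm_ge0 _) (hr _ hh)) _.
by apply: absorb_div => //; rewrite ltW.
Qed.

Lemma cd_ext f g z a b : (forall u, f u = g u) -> a = b -> cd f z a -> cd g z b.
Proof. by move=> /funext -> ->. Qed.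

Lemma cd_bound f z a : cd f z a -> exists2 r, 0 < r &
  forall h, nrm h < r -> nrm (f (z + h) - f z) <= (nrm a + 1) * nrm h.
Proof.
move=> /(_ 1 ltr01)[r r0 hr]; exists r => // h hh.
have := hr _ hh; rewrite mul1r => hb.
have -> : f (z + h) - f z = (f (z + h) - f z - a * h) + a * h by ring.
apply: le_trans (nrmD _ _) _; rewrite nrmM; lra.
Qed.

Lemma cd_cont f z a e : cd f z a -> 0 < e -> exists2 r, 0 < r &
  forall w, nrm (w - z) < r -> nrm (f w - f z) < e.
Proof.
move=> /cd_bound[r r0 hr] e0; have a1 : 0 < nrm a + 1 by rewrite ltr_wpDl.
exists (Num.min r (e / (nrm a + 1))); first by rewrite lt_min r0 divr_gt0.
move=> w; rewrite lt_min => /andP[h1 h2].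
have := hr _ h1; rewrite (_ : z + (w - z) = w); last by ring.
move=> /le_lt_trans; apply.
by rewrite mulrC -ltr_pdivlMr.
Qed.

Lemma cd_comp f g z a b : cd g z b -> cd f (g z) a -> cd (fun u => f (g u)) z (a * b).
Proof.
move=> Hg Hf e e0.
have b1 : 0 < nrm b + 1 by rewrite ltr_wpDl.
have a1 : 0 < nrm a + 1 by rewrite ltr_wpDl.
have [rg rg0 hg] := cd_bound Hg.
have ef : 0 < e / 2 / (nrm b + 1) by rewrite !divr_gt0.
have [rf rf0 hf] := Hf _ ef.
have eg : 0 < e / 2 / (nrm a + 1) by rewrite !divr_gt0.
have [r r0 hr] := Hg _ eg.
have rb : 0 < rf / (nrm b + 1) by rewrite divr_gt0.
exists (Num.min (Num.min rg r) (rf / (nrm b + 1))).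
  by rewrite !lt_min rg0 r0 rb.
move=> h; rewrite !lt_min => /andP[/andP[h1 h2] h3].
set k := g (z + h) - g z.
have kb := hg _ h1; rewrite -/k in kb.
have k1 : nrm k < rf.
  by apply: le_lt_trans kb _; rewrite mulrC -ltr_pdivlMr.
have gk : g z + k = g (z + h) by rewrite /k; ring.
have H1 := hf _ k1; rewrite gk in H1.
have -> : f (g (z + h)) - f (g z) - a * b * h
  = (f (g (z + h)) - f (g z) - a * k) + a * (k - b * h) by ring.
apply: le_trans (nrmD _ _) _.
have H2 : nrm (a * (k - b * h)) <= e / 2 * nrm h.
  rewrite nrmM; apply: le_trans (ler_wpM2l (nrm_ge0 _) (hr _ h2)) _.
  by apply: absorb_div => //; rewrite divr_ge0 // ltW.
have H3 : nrm (f (g (z + h)) - f (g z) - a * k) <= e / 2 * nrm h.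
  apply: le_trans H1 _; apply: le_trans (ler_wpM2l (ltW ef) kb) _.
  by rewrite mulrA divfK // gt_eqF.
lra.
Qed.

Lemma cd_affine a b z : cd (fun u => a * u + b) z a.
Proof.
have := cd_add (cd_scale a (cd_id z)) (cd_const b z).
by rewrite mulr1 addr0.
Qed.

Lemma cd_shift a z : cd (fun u => u + a) z 1.
Proof. by have := cd_affine 1 a z; apply: cd_ext => // u; rewrite mul1r. Qed.

Lemma cd_inv z : z != 0 -> cd (fun u => u^-1) z (- (z^-1 ^+ 2)).
Proof.
move=> z0 e e0; have n0 : 0 < nrm z by rewrite nrm_gt0.
exists (Num.min (nrm z / 2) (e * nrm z ^+ 3 / 2)).
  by rewrite lt_min !divr_gt0 ?mulr_gt0 ?exprn_gt0.
move=> h; rewrite lt_min => /andP[h1 h2].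
have low : nrm z / 2 <= nrm (z + h) by have := nrm_lowD z h; lra.
have zh0 : z + h != 0 by rewrite -nrm_gt0; lra.
have -> : (z + h)^-1 - z^-1 - - (z^-1 ^+ 2) * h = h * (h * ((z + h)^-1 * (z^-1 ^+ 2))).
  by field; rewrite zh0 z0.
rewrite nrmM mulrC; apply: ler_wpM2r => //.
rewrite !nrmM !nrmV.
have A : (nrm (z + h))^-1 <= 2 * (nrm z)^-1.
  have -> : 2 * (nrm z)^-1 = (nrm z / 2)^-1 by field; rewrite gt_eqF.
  by rewrite lef_pV2 ?posrE //; lra.
have B : nrm h * ((nrm (z + h))^-1 * ((nrm z)^-1 * (nrm z)^-1))
  <= (e * nrm z ^+ 3 / 2) * (2 * (nrm z)^-1 * ((nrm z)^-1 * (nrm z)^-1)).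
  apply: ler_pM => //; first by rewrite !mulr_ge0 ?invr_ge0.
    exact: ltW.
  by apply: ler_wpM2r => //; rewrite mulr_ge0 ?invr_ge0.
apply: le_trans B _.
by rewrite le_eqVlt; apply/orP; left; apply/eqP; field; rewrite gt_eqF.
Qed.

Lemma cd_sum (I : Type) (s : seq I) (F : I -> C -> C) (F1 : I -> C) z :
  (forall i, cd (F i) z (F1 i)) ->
  cd (fun u => \sum_(i <- s) F i u) z (\sum_(i <- s) F1 i).
Proof.
move=> H; elim: s => [|i s IH].
  apply: cd_ext (cd_const 0 z); first by move=> u; rewrite big_nil.
  by rewrite big_nil.
apply: cd_ext (cd_add (H i) IH); first by move=> u; rewrite big_cons.
by rewrite big_cons.
Qed.

End ComplexDerivative.

(** * Dyadic scales, geometric convergence and real mean values *)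

Section RealLemmas.
Variable R : realType.
Implicit Types (x y e : R) (phi : R -> R).

Definition hp n : R := (2^-1) ^+ n.

Lemma hp_gt0 n : 0 < hp n. Proof. by rewrite exprn_gt0 // invr_gt0. Qed.
Lemma hpS n : hp n.+1 = hp n / 2. Proof. by rewrite /hp exprS mulrC. Qed.
Lemma hp0 : hp 0 = 1. Proof. exact: expr0. Qed.
Lemma hpD m n : hp (m + n) = hp m * hp n. Proof. exact: exprD. Qed.
Lemma hp_le1 n : hp n <= 1.
Proof. by rewrite exprn_ile1 // ?invr_ge0 // invf_le1 // ler1n. Qed.
Lemma hp_le m n : (m <= n)%N -> hp n <= hp m.
Proof.
move=> /subnKC <-; rewrite hpD -[leRHS]mulr1 ler_wpM2l ?hp_le1 //; exact/ltW/hp_gt0.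
Qed.
Lemma hp_invn n : hp n <= n.+1%:R^-1.
Proof.
rewrite /hp exprVn lef_pV2 ?posrE ?exprn_gt0 // ?ltr0n //.
by rewrite -natrX ler_nat ltn_expl.
Qed.
Lemma hp_small x : 0 < x -> exists n, hp n <= x.
Proof.
move=> x0; exists (Num.bound x^-1); apply: le_trans (hp_invn _) _.
rewrite -[leRHS]invrK lef_pV2 ?posrE ?invr_gt0 ?ltr0n //.
have := archi_boundP (ltW (_ : 0 < x^-1)); rewrite invr_gt0 => /(_ x0) h.
by rewrite -natr1; lra.
Qed.
Lemma hp_lim x y : (forall n, x <= y * hp n) -> x <= 0.
Proof.
move=> h; rewrite leNgt; apply/negP => x0.
have y0 : 0 < y by have := h 0%N; rewrite hp0 mulr1; lra.
have [n hn] := hp_small (divr_gt0 x0 (mulr_gt0 (ltr0n _ 2) y0)).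
have := le_trans (h n) (ler_wpM2l (ltW y0) hn).
have -> : y * (x / (2 * y)) = x / 2 by field; rewrite gt_eqF.
lra.
Qed.

Lemma rlim (u : nat -> R) A : (forall n, `|u n.+1 - u n| <= A * hp n) ->
  exists l, forall n, `|u n - l| <= 2 * A * hp n.
Proof.
(* The intervals [[a n, b n]] are nested, so the supremum of their left ends lies in all of them. *)
move=> H; pose a n := u n - 2 * A * hp n; pose b n := u n + 2 * A * hp n.
have A0 : 0 <= A by have := H 0%N; rewrite hp0 mulr1; apply: le_trans.
have aS n k : a n <= a (n + k)%N.
  elim: k => [|k IH]; first by rewrite addn0.
  rewrite addnS; apply: le_trans IH _; rewrite /a hpS.
  have := H (n + k)%N; rewrite ler_norml => /andP[]; lra.
have bS n k : b (n + k)%N <= b n.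
  elim: k => [|k IH]; first by rewrite addn0.
  rewrite addnS; apply: le_trans IH; rewrite /b hpS.
  have := H (n + k)%N; rewrite ler_norml => /andP[]; lra.
have ab n m : a n <= b m.
  apply: le_trans (aS n m) _; apply: le_trans (bS m n); rewrite addnC /a /b.
  have : 0 <= A * hp (m + n) by rewrite mulr_ge0 // ltW // hp_gt0.
  lra.
pose S : set R := range a.
have S0 : S !=set0 by exists (a 0%N); exists 0%N.
have ubS n : ubound S (b n) by move=> _ [m _ <-].
exists (sup S) => n; rewrite ler_distlC; apply/andP; split.
  by apply: ub_le_sup; [exists (b 0%N) | exists n].
exact: (ge_sup S0 (ubS n)).
Qed.

Definition rd phi t d := forall e, 0 < e -> exists2 r, 0 < r &
  forall h, `|h| < r -> `|phi (t + h) - phi t - d * h| <= e * `|h|.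

Lemma rd_is_derive phi t d : rd phi t d -> is_derive t 1 phi d.
Proof.
move=> H.
have cv : h^-1 *: ((phi \o shift t) (h *: (1 : R)) - phi t) @[h --> (0 : R)^'] --> d.
  apply/cvgrPdist_le => e e0.
  have [r r0 hr] := H _ e0.
  near=> h.
  have h0 : h != 0 by near: h; apply: nbhs_dnbhs_neq.
  have hh : `|h| < r by near: h; apply: dnbhs0_lt.
  have := hr _ hh; rewrite /= [h *: 1]mulr1 (addrC h) => hb.
  have -> : d - h^-1 *: (phi (t + h) - phi t) = - ((phi (t + h) - phi t - d * h) / h).
    by rewrite /GRing.scale /=; field.
  by rewrite normrN normrM normfV ler_pdivrMr // normr_gt0.
split; first by apply/cvg_ex; exists d.
by rewrite /derive; apply: cvg_lim cv.
Unshelve. all: by end_near.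
Qed.

Lemma rd_mvt phi (phi1 : R -> R) a b : a < b ->
  (forall t, a <= t <= b -> rd phi t (phi1 t)) ->
  exists2 c, a < c < b & phi b - phi a = phi1 c * (b - a).
Proof.
move=> ab H.
have D t : t \in `[a, b] -> is_derive t 1 phi (phi1 t).
  by rewrite in_itv /= => h; apply: rd_is_derive; exact: H.
have E : {in `[a, b], forall t, derivable phi t 1} by move=> t /D[].
have [c] := MVT ab (fun t ht => D t (subset_itv_oo_cc ht))
  (derivable_within_continuous E).
by rewrite in_itv /= => hc ->; exists c.
Qed.

Lemma rd_ivt phi (phi1 : R -> R) a b v : a <= b ->
  (forall t, a <= t <= b -> rd phi t (phi1 t)) ->
  phi a <= v <= phi b -> exists2 c, a <= c <= b & phi c = v.
Proof.
move=> ab H /andP[v1 v2].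
have D t : t \in `[a, b] -> is_derive t 1 phi (phi1 t).
  by rewrite in_itv /= => h; apply: rd_is_derive; exact: H.
have E : {in `[a, b], forall t, derivable phi t 1} by move=> t /D[].
have [|c] := IVT (v := v) ab (derivable_within_continuous E).
  by rewrite ge_min v1 le_max v2 orbT.
by rewrite in_itv /= => hc <-; exists c.
Qed.

End RealLemmas.
Arguments hp {R} n.

(** * Mean value inequalities, local inversion and limits of differentiable functions *)

Section MeanValue.
Variable R : realType.
Local Notation C := (Cplx R).
Implicit Types (z w h a b d u : C) (x y e K : R) (f : C -> C).

Definition pt a b (t : R) : C := a + rc t * (b - a).

Lemma pt0 a b : pt a b 0 = a. Proof. by rewrite /pt rc0 mul0r addr0. Qed.
Lemma pt1 a b : pt a b 1 = b. Proof. by rewrite /pt rc1 mul1r addrC subrK. Qed.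

Lemma cd_re_seg u f a b d t : cd f (pt a b t) d ->
  rd (fun s => re (u * f (pt a b s))) t (re (u * d * (b - a))).
Proof.
move=> H e e0.
have c1 : 0 < nrm u * nrm (b - a) + 1 by rewrite ltr_wpDl // mulr_ge0.
have [r r0 hr] := H _ (divr_gt0 e0 c1).
have b1 : 0 < nrm (b - a) + 1 by rewrite ltr_wpDl.
exists (r / (nrm (b - a) + 1)); first by rewrite divr_gt0.
move=> h hh.
have E : pt a b (t + h) = pt a b t + rc h * (b - a) by rewrite /pt rcD; ring.
have nk : nrm (rc h * (b - a)) = `|h| * nrm (b - a) by rewrite nrmM nrm_rc.
have /hr : nrm (rc h * (b - a)) < r.
  rewrite nk; move: hh; rewrite ltr_pdivlMr // => hh; apply: le_lt_trans hh.
  by rewrite ler_wpM2l // lerDl.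
rewrite -E nk => hb.
have -> : re (u * f (pt a b (t + h))) - re (u * f (pt a b t)) - re (u * d * (b - a)) * h
  = re (u * (f (pt a b (t + h)) - f (pt a b t) - d * (rc h * (b - a)))).
  by rewrite !reimE; ring.
apply: le_trans (re_le _) _; rewrite nrmM.
apply: le_trans (ler_wpM2l (nrm_ge0 _) hb) _.
set B := nrm (b - a) in c1 *.
have -> : nrm u * (e / (nrm u * B + 1) * (`|h| * B)) =
   e * `|h| * (nrm u * B / (nrm u * B + 1)) by ring.
rewrite -[leRHS]mulr1 ler_wpM2l ?mulr_ge0 ?(ltW e0) //.
by rewrite ler_pdivrMr // mul1r lerDl.
Qed.

(** The mean value theorem fails for complex values; the factor [u] selects a real component for
    which the real theorem applies. *)
Lemma cd_mvt u f f1 a b :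
  (forall t, 0 <= t <= 1 -> cd f (pt a b t) (f1 (pt a b t))) ->
  exists2 t, 0 < t < 1 & re (u * (f b - f a)) = re (u * f1 (pt a b t) * (b - a)).
Proof.
move=> H.
have [|t ht E] := @rd_mvt R (fun s => re (u * f (pt a b s)))
  (fun t => re (u * f1 (pt a b t) * (b - a))) 0 1 ltr01.
  by move=> t ht; apply: cd_re_seg; exact: H.
exists t => //; move: E; rewrite pt0 pt1 subr0 mulr1 => <-.
by rewrite mulrBr reB.
Qed.

Lemma cd_lip_seg f f1 a b d K :
  (forall t, 0 <= t <= 1 -> cd f (pt a b t) (f1 (pt a b t))) ->
  (forall t, 0 <= t <= 1 -> nrm (f1 (pt a b t) - d) <= K) ->
  nrm (f b - f a - d * (b - a)) <= K * nrm (b - a).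
Proof.
move=> H HK; set w := f b - f a - d * (b - a).
(* Projecting onto the direction of the error [w] itself turns the left side into [nrm w ^+ 2]. *)
have [|t ht E] := @cd_mvt (cj w) (fun z => f z + (- d) * z) (fun z => f1 z + (- d) * 1) a b.
  by move=> t ht; apply: cd_add (H _ ht) (cd_scale _ (cd_id _)).
have {}ht : 0 <= t <= 1 by case/andP: ht => *; rewrite !ltW.
move: E; rewrite (_ : _ - _ = w); last by rewrite /w; ring.
rewrite [cj w * w]mulrC cj_mul re_rc => E.
have [w0|w0] := eqVneq w 0.
  by rewrite w0 nrm0 mulr_ge0 //; apply: le_trans (HK _ ht).
rewrite -(@ler_pM2l _ (nrm w)) ?nrm_gt0 // -expr2 E.
apply: le_trans (re_nrm _) _; rewrite !nrmM nrm_cj -mulrA ler_wpM2l // ler_wpM2r //.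
by have := HK _ ht; rewrite mulr1.
Qed.

Definition cvx (S : set C) := forall a b t, S a -> S b -> 0 <= t <= 1 -> S (pt a b t).

Lemma cvx_ball c r : cvx [set z | nrm (z - c) <= r].
Proof.
move=> a b t /= ha hb /andP[t0 t1].
have -> : pt a b t - c = rc (1 - t) * (a - c) + rc t * (b - c).
  by rewrite /pt rcB rc1; ring.
apply: le_trans (nrmD _ _) _; rewrite !nrm_rcM ?subr_ge0 //.
have := ler_wpM2l t0 hb; have : (1 - t) * nrm (a - c) <= (1 - t) * r.
  by apply: ler_wpM2l => //; lra.
lra.
Qed.

Lemma cvxI S T : cvx S -> cvx T -> cvx (S `&` T).
Proof. by move=> hS hT a b t [? ?] [? ?] ht; split; [apply: hS | apply: hT]. Qed.

Lemma cvx_half x : cvx [set z | x <= im z].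
Proof.
move=> a b t /= ha hb /andP[t0 t1]; rewrite /pt !reimE mul0r addr0.
have := ler_wpM2l t0 hb; have : (1 - t) * x <= (1 - t) * im a.
  by apply: ler_wpM2l => //; lra.
lra.
Qed.

Lemma cd_lip S f f1 d K a b : cvx S ->
  (forall z, S z -> cd f z (f1 z)) -> (forall z, S z -> nrm (f1 z - d) <= K) ->
  S a -> S b -> nrm (f b - f a - d * (b - a)) <= K * nrm (b - a).
Proof.
move=> cS H HK Sa Sb; apply: (@cd_lip_seg f f1) => t ht; [apply: H|apply: HK]; exact: cS.
Qed.

Lemma cd_lip0 S f f1 K a b : cvx S ->
  (forall z, S z -> cd f z (f1 z)) -> (forall z, S z -> nrm (f1 z) <= K) ->
  S a -> S b -> nrm (f b - f a) <= K * nrm (b - a).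
Proof.
move=> cS H HK Sa Sb; have := @cd_lip S f f1 0 K a b cS H _ Sa Sb.
by rewrite mul0r subr0; apply => z Sz; rewrite subr0; exact: HK.
Qed.

(** The linear part [d * (b - a)] dominates the deviation from it, which is at most half as large.
    This gives injectivity on convex sets with an explicit constant. *)
Lemma cd_sep S f f1 d a b : cvx S ->
  (forall z, S z -> cd f z (f1 z)) -> (forall z, S z -> nrm (f1 z - d) <= nrm d / 2) ->
  S a -> S b -> nrm d / 2 * nrm (b - a) <= nrm (f b - f a).
Proof.
move=> cS H HK Sa Sb; have := cd_lip cS H HK Sa Sb.
have := nrm_lowB (d * (b - a)) (d * (b - a) - (f b - f a)).
rewrite (_ : d * (b - a) - (d * (b - a) - (f b - f a)) = f b - f a); last by ring.
rewrite nrmM (nrmB (d * _)); lra.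
Qed.

Lemma clim (u : nat -> C) A : (forall n, nrm (u n.+1 - u n) <= A * hp n) ->
  exists l, forall n, nrm (u n - l) <= 4 * A * hp n.
Proof.
move=> H.
have [|x hx] := @rlim R (fun n => re (u n)) A.
  by move=> n /=; rewrite -reB; apply: le_trans (re_le _) (H n).
have [|y hy] := @rlim R (fun n => im (u n)) A.
  by move=> n /=; rewrite -imB; apply: le_trans (im_le _) (H n).
exists (Complex x y) => n; apply: le_trans (nrm_reim _) _.
rewrite reB imB; have := hx n; have := hy n; rewrite /=.
rewrite /re /im /=; lra.
Qed.

(** Newton's iteration with the fixed slope [d]. The map [T] contracts by 1/2 and its first step is
    at most [rho / 2], so the iterates stay in the disc and converge to a solution. *)
Lemma cd_surj f f1 b d w (rho : R) : 0 < rho -> d != 0 ->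
  (forall z, nrm (z - b) <= rho -> cd f z (f1 z)) ->
  (forall z, nrm (z - b) <= rho -> nrm (f1 z - d) <= nrm d / 2) ->
  nrm (w - f b) <= nrm d * rho / 2 ->
  exists2 z, nrm (z - b) <= rho & f z = w.
Proof.
move=> r0 d0 H HK hw.
have nd : 0 < nrm d by rewrite nrm_gt0.
have lip (x y : C) : nrm (x - b) <= rho -> nrm (y - b) <= rho ->
    nrm (f y - f x - d * (y - x)) <= nrm d / 2 * nrm (y - x).
  exact: (cd_lip (@cvx_ball b rho) H HK).
pose T z := z - (f z - w) / d; pose u n := iter n T b.
have step z : T z - z = (w - f z) / d by rewrite /T; ring.
have Tlip (x y : C) : nrm (x - b) <= rho -> nrm (y - b) <= rho ->
    nrm (T y - T x) <= nrm (y - x) / 2.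
  move=> hx hy.
  have -> : T y - T x = - ((f y - f x - d * (y - x)) / d) by rewrite /T; field.
  rewrite nrmN nrm_div ler_pdivrMr //; apply: le_trans (lip _ _ hx hy) _; lra.
have U n : nrm (u n - b) <= rho * (1 - hp n) /\ nrm (u n.+1 - u n) <= rho / 2 * hp n.
  elim: n => [|n [IH1 IH2]].
    rewrite /u /= subrr nrm0 hp0 subrr mulr0 mulr1; split=> //.
    by rewrite step nrm_div ler_pdivrMr //; lra.
  have I1 : nrm (u n.+1 - b) <= rho * (1 - hp n.+1).
    apply: le_trans (nrm_tri (u n) _ _) _; rewrite hpS; lra.
  split=> //.
  have rr m : rho * (1 - hp m) <= rho.
    by rewrite -[leRHS]mulr1 ler_pM2l // gerBl ltW // hp_gt0.
  have := Tlip _ _ (le_trans IH1 (rr _)) (le_trans I1 (rr _)).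
  rewrite -/(u n.+1) -/(u n.+2) hpS; rewrite -/u => h.
  apply: le_trans h _; lra.
have rr m : rho * (1 - hp m) <= rho.
  by rewrite -[leRHS]mulr1 ler_pM2l // gerBl ltW // hp_gt0.
have [l hl] := clim (fun n => (U n).2).
have lb : nrm (l - b) <= rho.
  rewrite -subr_le0; apply: (@hp_lim R _ rho) => n.
  have := nrm_tri (u n) l b; have [h1 _] := U n; have := hl n; rewrite nrmB; lra.
exists l => //; apply/eqP; rewrite -subr_eq0 -nrm_eq0; apply/eqP/le_anti.
rewrite nrm_ge0 andbT; apply: (@hp_lim R _ (nrm d * rho * 6)) => n.
have ub : nrm (u n - b) <= rho by apply: le_trans (U n).1 (rr n).
have h1 : nrm (f l - f (u n)) <= 2 * nrm d * nrm (l - u n).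
  have := lip _ _ ub lb.
  have := nrm_lowB (f l - f (u n)) (d * (l - u n)); rewrite nrmM.
  have := mulr_ge0 (ltW nd) (nrm_ge0 (l - u n)); lra.
have h2 : nrm (f (u n) - w) <= nrm d * (rho / 2 * hp n).
  have := (U n).2; rewrite [u n.+1]iterS -/(u n) step nrm_div ler_pdivrMr // nrmB; lra.
have h3 : 2 * nrm d * nrm (l - u n) <= 2 * nrm d * (4 * (rho / 2) * hp n).
  by rewrite ler_wpM2l ?mulr_ge0 ?(ltW nd) // nrmB.
have := nrm_tri (f (u n)) (f l) w; have := mulr_gt0 (mulr_gt0 nd r0) (hp_gt0 R n); lra.
Qed.

(** Instead of an integral formula, the mean value inequality is applied to [F m - F n]; letting [m]
    tend to infinity bounds the increments of [f - F n] by [A * hp n] times the length ([key]), and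
    [n] is fixed large enough beforehand. *)
Lemma cd_limit (F F1 : nat -> C -> C) f f1 z r A : 0 < r ->
  (forall n w, nrm (w - z) <= r -> cd (F n) w (F1 n w)) ->
  (forall n w, nrm (w - z) <= r -> nrm (F n w - f w) <= A * hp n) ->
  (forall n w, nrm (w - z) <= r -> nrm (F1 n w - f1 w) <= A * hp n) ->
  cd f z (f1 z).
Proof.
move=> r0 H H0 H1 e e0.
have zz : nrm (z - z) <= r by rewrite subrr nrm0 ltW.
have A0 : 0 <= A by have := H0 0%N z zz; rewrite hp0 mulr1; apply: le_trans.
have [n hn] : exists n, A * hp n <= e / 4.
  have A1 : 0 < 4 * (A + 1) by rewrite mulr_gt0 // ltr_wpDl.
  have [n hn] := hp_small (divr_gt0 e0 A1).
  exists n; apply: le_trans (ler_wpM2l A0 hn) _.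
  have -> : A * (e / (4 * (A + 1))) = e / 4 * (A / (A + 1)).
    by field; rewrite gt_eqF // ltr_wpDl.
  rewrite -[leRHS]mulr1; apply: ler_wpM2l; first by rewrite divr_ge0 // ltW.
  by rewrite ler_pdivrMr ?ltr_wpDl // mul1r lerDl.
have [s s0 hs] := H n z zz _ (divr_gt0 e0 (ltr0n _ 4)).
exists (Num.min r s); first by rewrite lt_min r0.
move=> h; rewrite lt_min => /andP[h1 h2].
have wz : nrm (z + h - z) <= r by rewrite addrC addKr ltW.
have key : nrm ((f (z + h) - F n (z + h)) - (f z - F n z)) <= A * hp n * nrm h.
  rewrite -subr_le0; apply: (@hp_lim R _ (A * nrm h + 2 * A)) => m.
  have L : nrm ((F m (z + h) - F n (z + h)) - (F m z - F n z)) <= (A * hp m + A * hp n) * nrm h.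
    have Hc w : nrm (w - z) <= r ->
        cd (fun w => F m w + (-1) * F n w) w (F1 m w + (-1) * F1 n w).
      by move=> hw; apply: cd_add (H m w hw) (cd_scale _ (H n w hw)).
    have Hb w : nrm (w - z) <= r -> nrm (F1 m w + (-1) * F1 n w) <= A * hp m + A * hp n.
      move=> hw; rewrite mulN1r; apply: le_trans (nrm_tri (f1 w) _ _) _.
      have := H1 m w hw; have := H1 n w hw; rewrite (nrmB (f1 w)); lra.
    have := cd_lip0 (@cvx_ball z r) Hc Hb zz wz.
    by rewrite !mulN1r (_ : z + h - z = h); last by ring.
  have -> : f (z + h) - F n (z + h) - (f z - F n z) =
     (F m (z + h) - F n (z + h) - (F m z - F n z)) + ((F m z - f z) - (F m (z + h) - f (z + h))).
    ring.
  have := nrmD (F m (z + h) - F n (z + h) - (F m z - F n z)) ((F m z - f z) - (F m (z + h) - f (z + h))).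
  have := nrm_subD (F m z - f z) (F m (z + h) - f (z + h)).
  have := H0 m _ zz; have := H0 m _ wz; lra.
have := hs _ h2.
have -> : f (z + h) - f z - f1 z * h = ((f (z + h) - F n (z + h)) - (f z - F n z)) +
   ((F n (z + h) - F n z - F1 n z * h) + (F1 n z - f1 z) * h) by ring.
move=> h3; apply: le_trans (nrmD _ _) _.
have := nrmD (F n (z + h) - F n z - F1 n z * h) ((F1 n z - f1 z) * h); rewrite nrmM.
have := ler_wpM2r (nrm_ge0 h) (H1 n z zz).
have := ler_wpM2r (nrm_ge0 h) hn; have := mulr_ge0 (ltW e0) (nrm_ge0 h); lra.
Qed.

End MeanValue.

(** * The complex exponential *)

Section ComplexExponential.
Variable R : realType.
Local Notation C := (Cplx R).
Implicit Types (z w h : C) (x y t e : R).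

Lemma is_derive_rd (phi : R -> R) t d : is_derive t 1 phi d -> rd phi t d.
Proof.
move=> [H E] e e0.
have cv : h^-1 *: ((phi \o shift t) (h *: (1 : R)) - phi t) @[h --> (0 : R)^'] --> d.
  by rewrite -E; exact: H.
move/cvgrPdist_le: cv => /(_ e e0); rewrite /dnbhs /within /= => /nbhs_ballP[r /= r0 hr].
exists r => // h hh.
have [->|h0] := eqVneq h 0; first by rewrite addr0 subrr mulr0 subrr normr0 mulr0.
have := hr h; rewrite /ball /= sub0r normrN => /(_ hh h0).
rewrite [h *: 1]mulr1 (addrC h) -[X in _ <= X -> _]mulr1 => hb.
have -> : phi (t + h) - phi t - d * h = - ((d - h^-1 *: (phi (t + h) - phi t)) * h).
  by rewrite /GRing.scale /=; field.
by rewrite normrN normrM ler_wpM2r // -[leRHS]mulr1.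
Qed.

Lemma rd_idD (phi : R -> R) c t d : rd phi t d -> rd (fun s => s + c * phi s) t (1 + c * d).
Proof.
move=> H e e0; have c1 : 0 < `|c| + 1 by rewrite ltr_wpDl.
have [r r0 hr] := H _ (divr_gt0 e0 c1); exists r => // h /hr hb.
have -> : t + h + c * phi (t + h) - (t + c * phi t) - (1 + c * d) * h
  = c * (phi (t + h) - phi t - d * h) by ring.
rewrite normrM; apply: le_trans (ler_wpM2l (normr_ge0 _) hb) _.
have -> : `|c| * (e / (`|c| + 1) * `|h|) = e * `|h| * (`|c| / (`|c| + 1)) by ring.
rewrite -[leRHS]mulr1 ler_wpM2l ?mulr_ge0 ?(ltW e0) //.
by rewrite ler_pdivrMr // mul1r lerDl.
Qed.

Lemma rd_exp t : rd expR t (expR t). Proof. by apply: is_derive_rd; exact: is_derive_expR. Qed.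
Lemma rd_sin t : rd sin t (cos t : R). Proof. by apply: is_derive_rd; exact: is_derive_sin. Qed.
Lemma rd_cos t : rd cos t (- sin t : R). Proof. by apply: is_derive_rd; exact: is_derive_cos. Qed.

Lemma sin_le t : 0 <= t -> sin t <= t.
Proof.
rewrite le_eqVlt => /orP[/eqP <-|t0]; first by rewrite sin0.
have [c _] := rd_mvt t0 (fun s _ => rd_sin s).
rewrite sin0 !subr0 => ->; have := cos_le1 c; nra.
Qed.
Lemma cos_ge t : 0 <= t -> 1 - t <= cos t.
Proof.
rewrite le_eqVlt => /orP[/eqP <-|t0]; first by rewrite cos0 subr0.
have [c _] := rd_mvt t0 (fun s _ => rd_cos s).
rewrite cos0 subr0 => h; have := sin_le1 c; nra.
Qed.

Definition cexp z : C := Complex (expR (re z) * cos (im z)) (expR (re z) * sin (im z)).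

Lemma re_cexp z : re (cexp z) = expR (re z) * cos (im z). Proof. by []. Qed.
Lemma im_cexp z : im (cexp z) = expR (re z) * sin (im z). Proof. by []. Qed.

Lemma cexpD z w : cexp (z + w) = cexp z * cexp w.
Proof.
apply: reimP; rewrite !(reimE, re_cexp, im_cexp) expRD ?cosD ?sinD; ring.
Qed.

Lemma nrm_cexp z : nrm (cexp z) = expR (re z).
Proof.
rewrite /nrm re_cexp im_cexp !exprMn -mulrDr cos2Dsin2 mulr1 sqrtr_sqr.
by rewrite ger0_norm // expR_ge0.
Qed.

Lemma cexp0 : cexp 0 = 1.
Proof. by apply: reimP; rewrite ?re_cexp ?im_cexp !reimE expR0 ?cos0 ?sin0 !mul1r. Qed.

Lemma cexp_cj z : cexp (cj z) = cj (cexp z).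
Proof. by apply: reimP; rewrite !(reimE, re_cexp, im_cexp) ?cosN ?sinN ?mulrN. Qed.

Lemma cd_cexp0 : cd cexp 0 1.
Proof.
move=> e e0; pose d := Num.min (e / 16) 1.
have d0 : 0 < d by rewrite lt_min ltr01 divr_gt0.
have d1 : d <= 1 by rewrite ge_min lexx orbT.
have de : d <= e / 16 by rewrite ge_min lexx.
clearbody d.
have [r1 r10 h1] := rd_exp 0 d0; have [r2 r20 h2] := rd_sin 0 d0; have [r3 r30 h3] := rd_cos 0 d0.
exists (Num.min (Num.min r1 r2) (Num.min r3 d)); first by rewrite !lt_min r10 r20 r30 d0.
move=> h; rewrite !lt_min => /andP[/andP[H1 H2] /andP[H3 H4]].
have rh := re_le h; have ih := im_le h.
have := h1 _ (le_lt_trans rh H1); rewrite add0r expR0 mul1r => {}h1.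
have := h2 _ (le_lt_trans ih H2); rewrite add0r sin0 cos0 subr0 mul1r => {}h2.
have := h3 _ (le_lt_trans ih H3); rewrite add0r sin0 cos0 oppr0 mul0r subr0 => {}h3.
rewrite add0r cexp0 mul1r.
set x := re h in rh h1 *; set y := im h in ih h2 h3 *.
have nx := normr_ge0 x; have ny := normr_ge0 y; set n := nrm h in rh ih H4 *.
have dx : d * `|x| <= d * n by rewrite ler_wpM2l // ltW.
have dy : d * `|y| <= d * n by rewrite ler_wpM2l // ltW.
have E3 : expR x <= 3.
  have := ler_norm (expR x - 1 - x); have := ler_norm x.
  have : d * n <= 1 * 1 by apply: ler_pM; rewrite ?nrm_ge0 ?(ltW d0) //; lra.
  lra.
have E1 : `|expR x - 1| <= 2 * n.
  have -> : expR x - 1 = (expR x - 1 - x) + x by ring.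
  apply: le_trans (ler_normD _ _) _.
  have : d * n <= 1 * n by rewrite ler_wpM2r ?nrm_ge0.
  lra.
apply: le_trans (nrm_reim _) _.
rewrite !reimE re_cexp im_cexp -/x -/y subr0.
have -> : expR x * cos y - 1 - x = (expR x - 1 - x) + expR x * (cos y - 1) by ring.
have -> : expR x * sin y - y = expR x * (sin y - y) + (expR x - 1) * y by ring.
have := ler_normD (expR x - 1 - x) (expR x * (cos y - 1)).
have := ler_normD (expR x * (sin y - y)) ((expR x - 1) * y).
rewrite !normrM (ger0_norm (expR_ge0 x)).
have A1 : expR x * `|cos y - 1| <= 3 * (d * n).
  by apply: ler_pM; rewrite ?expR_ge0 //; exact: le_trans h3 dy.
have A2 : expR x * `|sin y - y| <= 3 * (d * n).
  by apply: ler_pM; rewrite ?expR_ge0 //; exact: le_trans h2 dy.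
have A3 : `|expR x - 1| * `|y| <= (2 * n) * d.
  by apply: ler_pM => //; lra.
have : 0 <= d * n by rewrite mulr_ge0 ?nrm_ge0 // ltW.
have : d * n <= e / 16 * n by rewrite ler_wpM2r ?nrm_ge0.
lra.
Qed.

Lemma cd_cexp z : cd cexp z (cexp z).
Proof.
have H : cd (fun u => cexp z * cexp (u + - z)) z (cexp z * (1 * 1)).
  apply/cd_scale/cd_comp; first exact: cd_shift.
  by rewrite subrr; exact: cd_cexp0.
apply: cd_ext H; last by rewrite !mulr1.
by move=> u; rewrite -cexpD addrC subrK.
Qed.

Lemma cexp_ii t : cexp (ii R * rc t) = Complex (cos t) (sin t).
Proof.
have E : ii R * rc t = Complex 0 t.
  by apply: reimP; rewrite !reimE /re /im /=; ring.
by rewrite /cexp E /re /im /= expR0 !mul1r.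
Qed.

End ComplexExponential.

(** * Inversion of [l + e^l] on the strip [|Im l| < pi] *)

Section ImplicitLog.
Variable R : realType.
Local Notation C := (Cplx R).
Implicit Types (z w a b : C) (x y t e : R).

Definition lexp z : C := z + cexp z.

Lemma cd_lexp z : cd lexp z (1 + cexp z).
Proof. exact: cd_add (cd_id z) (cd_cexp z). Qed.

Lemma lexp_cj z : lexp (cj z) = cj (lexp z).
Proof. by rewrite /lexp cexp_cj; apply: reimP; rewrite !reimE ?opprD. Qed.

Lemma im_lexp z : im (lexp z) = im z + expR (re z) * sin (im z).
Proof. by rewrite /lexp !reimE im_cexp. Qed.
Lemma re_lexp z : re (lexp z) = re z + expR (re z) * cos (im z).
Proof. by rewrite /lexp !reimE re_cexp. Qed.

Lemma lexp_real x : exists t, t + expR t = x.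
Proof.
have H t : rd (fun t => t + expR t) t (1 + expR t).
  have := rd_idD 1 (rd_exp t); rewrite mul1r.
  by congr rd; apply/funext => s; rewrite mul1r.
have e0 := expR_gt0 x.
have [||c _ hc] := rd_ivt (a := x - expR x) (b := x) (v := x) _ (fun t _ => H t).
- by lra.
- apply/andP; split; last by lra.
  have : expR (x - expR x) <= expR x by rewrite ler_expR; lra.
  lra.
by exists c.
Qed.

(** For [l = a + i b] the imaginary part of [lexp l] is [b + e^a sin b]. Setting it equal to [eta]
    forces [e^a = (eta - b) / sin b], and [aux eta b] is then the real part of [lexp l]. Solving
    [lexp l = x + i eta] thus becomes a problem in the single variable [b], open to the intermediate
    value theorem. *)
Let aux (eta b : R) : R := ln ((eta - b) / sin b) + (eta - b) / sin b * cos b.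

Let aux_cont (eta b : R) : 0 < b < pi -> b < eta -> {for b, continuous (aux eta)}.
Proof.
move=> hb be; have s0 := sin_gt0_pi hb.
have c1 : (fun b : R => (eta - b) / sin b) x @[x --> b] --> (eta - b) / sin b.
  apply: cvgM; first by apply: cvgB; [exact: cvg_cst | exact: cvg_id].
  by apply: cvgV; [rewrite gt_eqF | exact: continuous_sin].
apply: cvgD; last by apply: cvgM => //; exact: continuous_cos.
apply: (cvg_comp _ _ c1); apply: continuous_ln.
by rewrite divr_gt0 // subr_gt0.
Qed.

Let aux_sol (eta b x : R) : 0 < b < pi -> b < eta -> aux eta b = x ->
  exists l : C, `|im l| < pi /\ lexp l = Complex x eta.
Proof.
move=> hb be H; have s0 := sin_gt0_pi hb; case/andP: (hb) => b0 b1.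
have q0 : 0 < (eta - b) / sin b by rewrite divr_gt0 // subr_gt0.
exists (Complex (ln ((eta - b) / sin b)) b); split; first by rewrite /im /= ger0_norm // ltW.
apply: reimP; rewrite ?im_lexp ?re_lexp /re /im /= lnK ?posrE //.
by field; rewrite gt_eqF.
Qed.

Let aux_ivt (eta p q x : R) : 0 < p < pi -> p < eta -> 0 < q < pi -> q < eta ->
  aux eta q <= x -> x <= aux eta p -> exists l : C, `|im l| < pi /\ lexp l = Complex x eta.
Proof.
move=> hp hpe hq hqe h1 h2.
have key (a b : R) : a <= b -> 0 < a -> b < pi -> b < eta ->
    Num.min (aux eta a) (aux eta b) <= x <= Num.max (aux eta a) (aux eta b) ->
    exists l : C, `|im l| < pi /\ lexp l = Complex x eta.
  move=> ab a0 bpi be hx.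
  have cont : {within `[a, b], continuous (aux eta)}.
    apply: continuous_in_subspaceT => t; rewrite inE /= in_itv /= => /andP[t1 t2].
    by apply: aux_cont; [apply/andP; split|]; lra.
  have [c] := IVT ab cont hx; rewrite in_itv /= => /andP[c1 c2] hc.
  by apply: (@aux_sol eta c) => //; [apply/andP; split|]; lra.
case/andP: hp => p0 p1; case/andP: hq => q0 q1.
have [pq|pq] := leP p q.
  by apply: (key p q pq p0 q1 hqe); rewrite ge_min le_max h1 h2 orbT.
by apply: (key q p (ltW pq) q0 p1 hpe); rewrite ge_min le_max h1 h2 orbT.
Qed.

Lemma ln_leB1 x : 0 < x -> ln x <= x - 1.
Proof. by move=> x0; have := expR_ge1Dx (ln x); rewrite lnK ?posrE //; lra. Qed.

(** For small [p], [aux eta p] is at least [x]. A [q] with [aux eta q <= x] is found in two ways. If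
    [eta < pi], take [a + e^a = x] and solve [q + e^a sin q = eta]; then
    [aux eta q = a + e^a cos q]. Otherwise a [q] just below [pi] serves, and there [x > -1] is
    essential. *)
Let lexp_surj_pos x (eta : R) : -1 < x -> 0 < eta -> exists l : C, `|im l| < pi /\ lexp l = Complex x eta.
Proof.
move=> x1 e0; have pi2 := pi_ge2 R; have e1 := expR_gt0 x.
pose p := Num.min (eta / (1 + expR x)) 1.
have p0 : 0 < p by rewrite lt_min ltr01 divr_gt0 // addr_gt0.
have p1 : p <= 1 by rewrite ge_min lexx orbT.
have pE : p * (1 + expR x) <= eta by rewrite -ler_pdivlMr ?addr_gt0 // ge_min lexx.
have ppi : 0 < p < pi by rewrite p0 /=; lra.
have sp := sin_gt0_pi ppi; have spp := sin_le (ltW p0).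
have pe : p < eta by nra.
have Hp : x <= aux eta p.
  have h : expR x <= (eta - p) / sin p.
    by rewrite ler_pdivlMr //; nra.
  have : x <= ln ((eta - p) / sin p).
    by rewrite -ler_expR lnK // posrE; apply: lt_le_trans h.
  have : 0 <= (eta - p) / sin p * cos p.
    rewrite mulr_ge0 //; first by apply: le_trans h; rewrite ltW.
    by apply: le_trans (cos_ge (ltW p0)); lra.
  by rewrite /aux; lra.
suff [q [hq hqe Hq]] : exists q, [/\ 0 < q < pi, q < eta & aux eta q <= x].
  exact: (@aux_ivt eta p q).
have [epi|epi] := ltP eta pi.
  have [a ha] := lexp_real x.
  have H t := rd_idD (expR a) (rd_sin t).
  have se : 0 < sin eta by apply: sin_gt0_pi; rewrite e0.
  have ea := expR_gt0 a.
  have [||q /andP[q0 q1] hq] := rd_ivt (a := 0) (b := eta) (v := eta) _ (fun t _ => H t).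
  - exact: ltW e0.
  - by rewrite sin0 mulr0 addr0 (ltW e0) /= lerDl mulr_ge0 // ltW.
  have qpos : 0 < q.
    by rewrite lt_neqAle q0 andbT; apply/eqP => q00; move: hq; rewrite -q00 sin0; lra.
  have qe : q < eta.
    rewrite lt_neqAle q1 andbT; apply/eqP => qq; move: hq; rewrite qq.
    by have := mulr_gt0 ea se; lra.
  have qpi : 0 < q < pi by rewrite qpos; lra.
  exists q; split=> //.
  have -> : eta = q + expR a * sin q by [].
  rewrite /aux addrAC subrr add0r mulfK ?gt_eqF ?sin_gt0_pi //.
  by rewrite expRK -ha lerD2l ler_piMr ?cos_le1 // ltW.
(* With [h] as below, [aux] is at most [ln h - h (1 - c)]. For [h <= 4] this is at most
   [4 c - 1 <= x]; for larger [h], [ln h <= h / 2] and [c <= 1 / 4] make it at most [- h / 4]. *)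
pose c := Num.min (1 / 4) ((x + 1) / 4).
have c0 : 0 < c by rewrite lt_min; apply/andP; split; lra.
have c1 : c <= 1 / 4 by rewrite ge_min lexx.
have c2 : c <= (x + 1) / 4 by rewrite ge_min lexx orbT.
have cc : 0 < c < pi by rewrite c0; lra.
have sc := sin_gt0_pi cc; have sc2 := sin_le (ltW c0).
have kc := cos_ge (ltW c0).
exists (pi - c); split; [by apply/andP; split; lra | lra |].
have cE : cos (pi - c) = - cos c by rewrite addrC cosDpi cosN.
have sE : sin (pi - c) = sin c by rewrite addrC sinDpi sinN opprK.
rewrite /aux cE sE; set h := (eta - (pi - c)) / sin c.
have h1 : 1 <= h by rewrite ler_pdivlMr //; lra.
have hl : ln h <= h - 1 by apply: ln_leB1; lra.
have hc : h * (1 - c) <= h * cos c by rewrite ler_wpM2l //; lra.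
have [h4|h4] := leP h 4.
  have : h * c <= 4 * c by rewrite ler_wpM2r // ltW.
  lra.
have hl2 : ln h <= h / 2.
  have -> : h = h / 2 * 2 by field.
  rewrite lnM ?posrE //; last by lra.
  have := @ln_leB1 (h / 2); have := @ln_leB1 2; lra.
have : h * c <= h * (1 / 4) by apply: ler_wpM2l; lra.
lra.
Qed.

Lemma lexp_surj z : -1 < re z -> exists l : C, `|im l| < pi /\ lexp l = z.
Proof.
have eta w : w = Complex (re w) (im w) by case: w.
move=> x1; have [e|e|e] := ltgtP 0 (im z).
- by have [l [h1 h2]] := lexp_surj_pos x1 e; exists l; rewrite [z]eta.
- have ne : 0 < - im z by rewrite oppr_gt0.
  have [l [h1 h2]] := lexp_surj_pos x1 ne.
  exists (cj l); rewrite im_cj normrN; split=> //.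
  by rewrite lexp_cj h2 [RHS]eta /cj /re /im /= opprK.
- have [t ht] := lexp_real (re z).
  exists (rc t); rewrite im_rc normr0; split; first exact: pi_gt0.
  by apply: reimP; rewrite ?re_lexp ?im_lexp !reimE ?cos0 ?sin0 ?mulr0 ?mulr1 ?addr0.
Qed.

(** Equal values at two points would make a chosen component of the derivative [1 + e^l] vanish at a
    point between them. But its imaginary part is positive for [0 < Im l < pi], and its real part
    exceeds 1 on the real axis. *)
Let lexp_inj_pos a b : 0 <= im a < pi -> 0 <= im b < pi -> lexp a = lexp b -> a = b.
Proof.
move=> /andP[a0 a1] /andP[b0 b1] E; apply/eqP; rewrite eq_sym -subr_eq0; apply/negP => /negP n0.
have [nr|r0] := boolP ((im a == 0) && (im b == 0)).
  case/andP: nr => /eqP ia /eqP ib.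
  have [t _] := @cd_mvt R (b - a)^-1 lexp (fun z => 1 + cexp z) a b (fun t _ => cd_lexp _).
  have i0 : im (pt a b t) = 0 by rewrite /pt !reimE ia ib; ring.
  rewrite E subrr mulr0 mulrC mulrA divff // mul1r !reimE re_cexp i0 cos0 mulr1.
  by have := expR_gt0 (re (pt a b t)); lra.
have [t /andP[t0 t1]] := @cd_mvt R (- ii R / (b - a)) lexp (fun z => 1 + cexp z) a b (fun t _ => cd_lexp _).
have ip : 0 < im (pt a b t) < pi.
  rewrite /pt !reimE mul0r addr0.
  have -> : im a + t * (im b - im a) = (1 - t) * im a + t * im b by ring.
  have : (1 - t) * im a <= (1 - t) * pi by rewrite ler_wpM2l // ?ltW //; lra.
  have T : t * im b < t * pi by rewrite ltr_pM2l.
  move: r0; rewrite negb_and => /orP[r0|r0].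
    have : 0 < (1 - t) * im a by rewrite mulr_gt0 ?subr_gt0 // lt_neqAle eq_sym r0.
    have : 0 <= t * im b by rewrite mulr_ge0 // ltW.
    lra.
  have : 0 < t * im b by rewrite mulr_gt0 // lt_neqAle eq_sym r0.
  have : 0 <= (1 - t) * im a by rewrite mulr_ge0 // subr_ge0 ltW.
  lra.
rewrite E subrr mulr0 mulrC mulrA (mulrC (b - a)) divfK // !reimE im_cexp.
have := sin_gt0_pi ip; have := expR_gt0 (re (pt a b t)) => e1 s1.
by have := mulr_gt0 e1 s1; lra.
Qed.

Let im_lexp_ge0 a : `|im a| < pi -> (0 <= im (lexp a)) = (0 <= im a).
Proof.
rewrite ltr_norml => /andP[a0 a1]; rewrite im_lexp.
have e1 := expR_gt0 (re a).
have [i0|i0|i0] := ltgtP 0 (im a).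
- by rewrite addr_ge0 ?(ltW i0) // mulr_ge0 ?(ltW e1) // ltW // sin_gt0_pi // i0.
- apply/negbTE; rewrite -ltNge.
  have : 0 < sin (- im a) by apply: sin_gt0_pi; apply/andP; split; lra.
  by rewrite sinN => s0; have := mulr_gt0 e1 s0; lra.
- by rewrite -i0 sin0 mulr0 addr0 lexx.
Qed.

Lemma lexp_inj a b : `|im a| < pi -> `|im b| < pi -> lexp a = lexp b -> a = b.
Proof.
move=> ha hb E; have := im_lexp_ge0 ha; rewrite E im_lexp_ge0 // => Es.
move: (ha) (hb); rewrite !ltr_norml => /andP[a1 a2] /andP[b1 b2].
have [a0|a0] := leP 0 (im a).
  by apply: lexp_inj_pos => //; rewrite ?a0 //= Es a0.
have b0 : im b < 0 by rewrite ltNge Es -ltNge.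
have : cj a = cj b.
  apply: lexp_inj_pos; rewrite ?im_cj.
  - by apply/andP; split; lra.
  - by apply/andP; split; lra.
  - by rewrite !lexp_cj E.
by move/(congr1 (@cj R)); rewrite /cj /re /im /= !opprK; case: (a) (b) => [? ?] [? ?].
Qed.

End ImplicitLog.

(** * The function [lambda] on the half-plane and its derivatives *)

Section Fringe.
Variable R : realType.
Local Notation C := (Cplx R).
Implicit Types (z w l a b : C) (x y t e : R).

Definition zeta z : C := - (rc 2 * ii R * z) - 1.

Lemma re_zeta z : re (zeta z) = 2 * im z - 1. Proof. by rewrite /zeta !reimE; ring. Qed.

Definition Lm z : C := xget 0 [set l | `|im l| < pi /\ lexp l = zeta z].
Definition om z : C := cexp (Lm z).
Definition l1 z : C := - (rc 2 * ii R) * (1 + om z)^-1.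
Definition l2 z : C := rc 4 * om z * (1 + om z)^-1 ^+ 3.

Lemma Lm_unique z l : `|im l| < pi -> lexp l = zeta z -> Lm z = l.
Proof.
move=> h1 h2; rewrite /Lm; have [|g1 g2] := @xgetPex _ 0 [set l | `|im l| < pi /\ lexp l = zeta z].
  by exists l.
by apply: lexp_inj => //; rewrite g2.
Qed.

Lemma Lm_spec z : 0 < im z -> `|im (Lm z)| < pi /\ lexp (Lm z) = zeta z.
Proof.
move=> z0; have [|l hl] := @lexp_surj R (zeta z); first by rewrite re_zeta; lra.
by rewrite (Lm_unique hl.1 hl.2).
Qed.

Lemma Lm_om z : 0 < im z -> Lm z + om z = zeta z.
Proof. by move=> /Lm_spec[]. Qed.

Lemma nrm_om z : nrm (om z) = expR (re (Lm z)). Proof. exact: nrm_cexp. Qed.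

Lemma re_Lm_gt z : 0 < im z -> - 2 < re (Lm z).
Proof.
move=> z0; have /(congr1 (@re R)) := Lm_om z0.
rewrite re_zeta !reimE re_cexp => h; rewrite ltNge; apply/negP => h2.
have e1 : expR (re (Lm z)) <= 1 by rewrite expR_le1; lra.
have := cos_le1 (im (Lm z)); have := expR_gt0 (re (Lm z)); nra.
Qed.

Lemma om_ge z : 0 < im z -> expR (- 2) <= nrm (om z).
Proof. by move=> /re_Lm_gt h; rewrite nrm_om ler_expR ltW. Qed.

(** With [a = Re (Lm z)] the difference of the two sides is [e^(2a) - 1 - 2a]. This inequality is
    the source of the constant 1 in the bound for [W |f'' / f'|]. *)
Lemma om1_ge z : 0 < im z -> 4 * im z <= nrm (1 + om z) ^+ 2.
Proof.
move=> z0; have /(congr1 (@re R)) := Lm_om z0.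
rewrite re_zeta nrm_sqr !reimE re_cexp im_cexp.
set a := re _; set c := cos _; set s := sin _ => h.
have cs : c ^+ 2 + s ^+ 2 = 1 by rewrite cos2Dsin2.
have := expR_ge1Dx (a * 2); rewrite (_ : a * 2 = a + a); last by ring.
rewrite expRD => h2.
have -> : (1 + expR a * c) ^+ 2 + (0 + expR a * s) ^+ 2
  = 1 + 2 * (expR a * c) + expR a * expR a * (c ^+ 2 + s ^+ 2) by ring.
by rewrite cs; lra.
Qed.

Lemma om1_neq0 z : 0 < im z -> 1 + om z != 0.
Proof.
move=> z0; rewrite -nrm_gt0 lt0r nrm_ge0 andbT; apply/eqP => h.
by have := om1_ge z0; rewrite h expr0n /=; lra.
Qed.

(** An inverse function argument: [cd_surj] yields a solution near [l0], uniqueness in the strip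
    identifies it with [Lm (z + h)], and [cd_sep] bounds its distance from [l0]. The derivative is
    then read off from the remainder of [lexp] at [l0]. *)
Lemma cd_Lm z : 0 < im z -> cd Lm z (l1 z).
Proof.
move=> z0; have [p0 E0] := Lm_spec z0; have d0 := om1_neq0 z0.
rewrite /l1; set l0 := Lm z in p0 E0 *; set d := 1 + om z in d0 *.
have nd : 0 < nrm d by rewrite nrm_gt0.
have nd2 : 0 < nrm d / 2 by rewrite divr_gt0.
have [r0 r00 hr0] := cd_cont (cd_cexp l0) nd2.
pose r := Num.min (r0 / 2) ((pi - `|im l0|) / 2).
have rp : 0 < r by rewrite lt_min !divr_gt0 // subr_gt0.
have r1 : r <= r0 / 2 by rewrite ge_min lexx.
have r2 : r <= (pi - `|im l0|) / 2 by rewrite ge_min lexx orbT.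
clearbody r.
have HK l : nrm (l - l0) <= r -> nrm (1 + cexp l - d) <= nrm d / 2.
  move=> hl; rewrite (_ : _ - d = cexp l - cexp l0); last by rewrite /d /om -/l0; ring.
  by apply/ltW/hr0; lra.
have near h : nrm h < nrm d * r / 4 ->
    nrm (Lm (z + h) - l0) * nrm d <= 4 * nrm h /\ lexp (Lm (z + h)) = zeta (z + h).
  move=> hh; have Ez : zeta (z + h) - lexp l0 = - (rc 2 * ii R) * h by rewrite E0 /zeta; ring.
  have nz : nrm (zeta (z + h) - lexp l0) = 2 * nrm h.
    by rewrite Ez nrmM nrmN nrmM nrm_ii nrm_rc mulr1 ger0_norm.
  have [|l hl El] := cd_surj (w := zeta (z + h)) rp d0 (fun l _ => cd_lexp l) HK.
    by rewrite nz; lra.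
  have il : `|im l| < pi.
    have := im_le (l - l0); rewrite imB.
    have := ler_normD (im l - im l0) (im l0); rewrite subrK; lra.
  rewrite (Lm_unique il El); split=> //.
  have l00 : nrm (l0 - l0) <= r by rewrite subrr nrm0 ltW.
  have := cd_sep (@cvx_ball _ l0 r) (fun l _ => cd_lexp l) HK l00 hl.
  by rewrite El nz; lra.
move=> e e0.
have e1 : 0 < e * nrm d * nrm d / 4 by rewrite divr_gt0 // !mulr_gt0.
have [s s0 hs] := cd_lexp l0 e1.
exists (Num.min (nrm d * r / 4) (s * nrm d / 4)); first by rewrite lt_min !divr_gt0 ?mulr_gt0.
move=> h; rewrite lt_min => /andP[h1 h2]; have [n1 n2] := near h h1.
set k := Lm (z + h) - l0 in n1 *.
have Ek : l0 + k = Lm (z + h) by rewrite /k; ring.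
have ks : nrm k < s by rewrite -(ltr_pM2r nd); lra.
have := hs k ks; rewrite Ek n2 E0 -/d => H.
have -> : k - - (rc 2 * ii R) * d^-1 * h = - ((zeta (z + h) - zeta z - d * k) / d).
  by rewrite /zeta; field.
rewrite nrmN nrm_div ler_pdivrMr //; apply: le_trans H _.
have : e * nrm d / 4 * (nrm k * nrm d) <= e * nrm d / 4 * (4 * nrm h).
  by rewrite ler_wpM2l // divr_ge0 // mulr_ge0 // ltW.
lra.
Qed.

Lemma cd_om z : 0 < im z -> cd om z (om z * l1 z).
Proof. by move=> z0; apply: cd_comp (cd_Lm z0) _; exact: cd_cexp. Qed.

Lemma cd_l1 z : 0 < im z -> cd l1 z (l2 z).
Proof.
move=> z0; have d0 := om1_neq0 z0.
have H1 : cd (fun z => 1 + om z) z (om z * l1 z).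
  by have := cd_add (cd_const 1 z) (cd_om z0); rewrite add0r.
have := cd_scale (- (rc 2 * ii R)) (cd_comp (f := fun u => u^-1) H1 (cd_inv d0)).
apply: cd_ext => //; rewrite /l2 /l1.
have E : rc 4 = - (rc 2 * ii R) * (rc 2 * ii R).
  by apply: reimP; rewrite !reimE; ring.
by rewrite E; ring.
Qed.

Lemma pi_le4 : pi <= 4 :> R.
Proof. by have [/andP[_]] := pihalf_02_cos_pihalf R; lra. Qed.

(** Since [|lambda|] is at most [|om| + 6], at least half of [zeta = lambda + om] is, up to a
    constant, carried by [om], and [|zeta|] is at least [2 |z| - 1]. *)
Lemma om1_far z : 0 < im z -> nrm z - 5 <= nrm (1 + om z).
Proof.
move=> z0; have [p0 _] := Lm_spec z0; have E := Lm_om z0.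
have n1 : nrm (zeta z) >= 2 * nrm z - 1.
  have := nrm_lowB (- (rc 2 * ii R * z)) 1.
  by rewrite nrmN !nrmM nrm_ii nrm_rc nrm1 mulr1 ger0_norm.
have n2 : nrm (Lm z) <= nrm (om z) + 2 + 4.
  apply: le_trans (nrm_reim _) _.
  have a1 : `|re (Lm z)| <= nrm (om z) + 2.
    have := re_Lm_gt z0; have := expR_ge1Dx (re (Lm z)); rewrite -nrm_om ler_norml.
    move=> h1 h2; apply/andP; split; have := nrm_ge0 (om z); lra.
  have := pi_le4; lra.
have := nrmD (Lm z) (om z); rewrite E => n3.
have := nrm_lowD (om z) 1; rewrite nrm1 addrC (addrC (om z)); lra.
Qed.

Lemma om1_lower h0 : 0 < h0 -> exists2 c, 0 < c <= 1 &
  forall z, h0 <= im z -> c * (1 + nrm z) <= nrm (1 + om z).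
Proof.
move=> h00; pose m := Num.min 1 (4 * h0).
have m0 : 0 < m by rewrite lt_min ltr01 mulr_gt0.
have m1 : m <= 1 by rewrite ge_min lexx.
have m2 : m <= 4 * h0 by rewrite ge_min lexx orbT.
clearbody m.
exists (m / 12); first by apply/andP; split; lra.
move=> z hz; have z0 : 0 < im z by lra.
have [far|near] := leP 10 (nrm z).
  have : m / 12 * (1 + nrm z) <= 1 / 12 * (1 + nrm z) by apply: ler_wpM2r; lra.
  by have := om1_far z0; lra.
have : m / 12 * (1 + nrm z) <= m / 12 * 12 by apply: ler_wpM2l; lra.
suff : m <= nrm (1 + om z) by lra.
rewrite leNgt; apply/negP => hm.
have := om1_ge z0; have := nrm_ge0 (1 + om z); nra.
Qed.

Lemma nrm_l1 z : nrm (l1 z) = 2 / nrm (1 + om z).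
Proof. by rewrite /l1 nrmM nrmN nrmM nrm_ii nrm_rc nrmV mulr1 ger0_norm. Qed.

Lemma nrm_l2 z : nrm (l2 z) = 4 * nrm (om z) / nrm (1 + om z) ^+ 3.
Proof.
rewrite /l2 !nrmM nrm_rc ger0_norm // !nrmV; congr (_ * _).
by rewrite -exprVn !exprS expr0 mulr1.
Qed.

End Fringe.

(** * Profiles: decaying perturbations of the identity *)

Section Profile.
Variable R : realType.
Local Notation C := (Cplx R).

(* A function with its first two derivatives. As a profile, [P] stands for the perturbation
   [x + pv P x] of the identity; the functions built from profiles are [pv F] itself. *)
Record prf := Prf { pv : C -> C; pv1 : C -> C; pv2 : C -> C }.
Implicit Types (P Q : prf) (x z : C) (A T lo hi : R).

(** The second derivative is later multiplied by the height, which costs one power of [1 + nrm x];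
    hence the square. What remains to be summed over a grid is harmonic in each case. *)
Definition is_prof A P := forall x, 0 <= im x ->
  [/\ cd (pv P) x (pv1 P x), cd (pv1 P) x (pv2 P x),
      nrm (pv P x) <= A / (1 + nrm x), nrm (pv1 P x) <= A / (1 + nrm x)
    & nrm (pv2 P x) <= A / (1 + nrm x) ^+ 2].

Definition pbound T lo hi P := forall x, 0 <= im x ->
  [/\ lo <= nrm (1 + pv1 P x), nrm (1 + pv1 P x) <= hi
    & 2 * im x * nrm (pv2 P x) <= T * nrm (1 + pv1 P x)].

(* The values of [x + pv P x] near the inner point [b] cover those near the boundary point 0. *)
Definition overlap P := exists b d : C, exists rho eta : R,
  [/\ [/\ 0 < rho, rho < im b, d != 0 & 0 <= eta < 1 / 4],
      forall x, nrm (x - b) <= rho -> nrm (1 + pv1 P x - d) <= eta * nrm d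
    & nrm (b + pv P b - pv P 0) <= eta * nrm d * rho / 2].

End Profile.

(** * The pattern: [lambda] minus a far translate *)

Section Pattern.
Variable R : realType.
Local Notation C := (Cplx R).
Implicit Types (x z w : C).

Lemma l_bounds (h0 : R) : 0 < h0 -> exists2 B, 0 < B & forall z, h0 <= im z ->
  nrm (l1 z) <= B / (1 + nrm z) /\ nrm (l2 z) <= B / (1 + nrm z) ^+ 2.
Proof.
move=> h00; have [c /andP[c0 c1] hc] := om1_lower h00.
have i0 : 0 < c^-1 by rewrite invr_gt0.
have i1 : 1 <= c^-1 by rewrite invr_ge1 // unitfE gt_eqF.
exists (2 * c^-1 + 8 * c^-1 ^+ 3); first by rewrite addr_gt0 // mulr_gt0 // exprn_gt0.
move=> z hz; have z0 : 0 < im z by lra.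
have s0 := hc z hz; rewrite nrm_l1 nrm_l2.
have t0 : 0 < 1 + nrm z by rewrite ltr_pwDl.
set t := 1 + nrm z in s0 t0 *; have t1 : 1 <= t by rewrite lerDl.
set s := nrm (1 + om z) in s0 *.
have sp : 0 < s by apply: lt_le_trans s0; rewrite mulr_gt0.
have sc : c <= s by apply: le_trans s0; rewrite ler_peMr // ltW.
have si : s^-1 <= c^-1 / t.
  by rewrite -invfM lef_pV2 ?posrE // ?mulr_gt0 // mulrC.
have ti : 0 < t^-1 by rewrite invr_gt0.
have c3 : 0 < c^-1 ^+ 3 by rewrite exprn_gt0.
have s1 : 0 < s^-1 by rewrite invr_gt0.
split.
  have := mulr_gt0 c3 ti; lra.
have os : nrm (om z) <= s + 1.
  by have := nrm_lowD (om z) 1; rewrite nrm1 addrC (addrC (om z)) -/s; lra.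
have s1c : s + 1 <= s * (2 * c^-1).
  have := ler_wpM2r (ltW i0) sc; rewrite divff ?gt_eqF // => h.
  have := ler_wpM2l (ltW sp) i1; lra.
have -> : 4 * nrm (om z) / s ^+ 3 = 4 * (nrm (om z) * s^-1) * (s^-1 * s^-1).
  by field; rewrite gt_eqF.
have q1 : nrm (om z) * s^-1 <= 2 * c^-1.
  by rewrite ler_pdivrMr // mulrC; apply: le_trans os _.
have q2 : s^-1 * s^-1 <= c^-1 / t * (c^-1 / t) by apply: ler_pM => //; exact: ltW.
have q3 : nrm (om z) * s^-1 * (s^-1 * s^-1) <= 2 * c^-1 * (c^-1 / t * (c^-1 / t)).
  by apply: ler_pM => //; rewrite ?mulr_ge0 ?(ltW s1).
have -> : (2 * c^-1 + 8 * c^-1 ^+ 3) / t ^+ 2 =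
   2 * (c^-1 * (t^-1 * t^-1)) + 4 * (2 * c^-1 * (c^-1 / t * (c^-1 / t))).
  by field; rewrite !gt_eqF.
have := mulr_gt0 i0 (mulr_gt0 ti ti); lra.
Qed.

Lemma nrm_shift_up z (s : R) : 0 <= im z -> 0 <= s -> nrm z <= nrm (z + ii R * rc s).
Proof.
move=> z0 s0; rewrite -(@ler_pXn2r _ 2) ?nnegrE // !nrm_sqr !reimE; nra.
Qed.

Variables (kap z1 : C) (L : R).
Hypotheses (z10 : 0 < im z1) (L0 : 0 <= L) (kap1 : nrm kap <= 1).

Local Ltac slra := have := z10; have := L0; have := kap1; lra.

Let iL : C := ii R * rc L.

Definition pattern : prf R := Prf
  (fun x => kap * (Lm (x + z1) - Lm (x + (z1 + iL))))
  (fun x => kap * (l1 (x + z1) - l1 (x + (z1 + iL))))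
  (fun x => kap * (l2 (x + z1) - l2 (x + (z1 + iL)))).

Let im_x1 x : 0 <= im x -> im z1 <= im (x + z1).
Proof. by move=> h; rewrite imD lerDr. Qed.
Let im_x2 x : 0 <= im x -> im z1 <= im (x + (z1 + iL)).
Proof. by move=> h; rewrite /iL !reimE; slra. Qed.

Let cd_sh (F F1 : C -> C) a x : cd F (x + a) (F1 (x + a)) ->
  cd (fun x => F (x + a)) x (F1 (x + a)).
Proof. by move=> H; have := cd_comp (f := F) (cd_shift a x) H; rewrite mulr1. Qed.

Let cd_diff (F F1 : C -> C) x :
  cd F (x + z1) (F1 (x + z1)) -> cd F (x + (z1 + iL)) (F1 (x + (z1 + iL))) ->
  cd (fun x => kap * (F (x + z1) - F (x + (z1 + iL)))) x (kap * (F1 (x + z1) - F1 (x + (z1 + iL)))).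
Proof.
move=> H1 H2; apply: cd_scale.
have := cd_add (cd_sh H1) (cd_scale (-1) (cd_sh H2)).
by apply: cd_ext => [u|]; rewrite !mulN1r.
Qed.

(** [Lm] grows logarithmically, but the pattern is its increment along a vertical segment of length
    [L], and so inherits the decay of the derivative [l1]. *)
Lemma pattern_prof : exists2 A, 0 < A & is_prof A pattern.
Proof.
have [B B0 HB] := l_bounds z10.
pose D := 1 + nrm z1; have D1 : 1 <= D by rewrite lerDl.
have D0 : 0 < D by slra.
exists (B * D ^+ 2 * (L + 2)).
  by rewrite !mulr_gt0 ?exprn_gt0 //; slra.
move=> x x0; have t0 : 0 < 1 + nrm x by rewrite ltr_pwDl.
have grow s : 0 <= s -> 1 + nrm x <= D * (1 + nrm (x + z1 + ii R * rc s)).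
  move=> s0; have xz0 : 0 <= im (x + z1) by have := im_x1 x0; slra.
  have h1 := nrm_shift_up xz0 s0; have h2 := nrm_lowD x z1.
  have h3 := mulr_ge0 (nrm_ge0 z1) (nrm_ge0 (x + z1 + ii R * rc s)).
  rewrite /D; slra.
have inv s : 0 <= s -> (1 + nrm (x + z1 + ii R * rc s))^-1 <= D / (1 + nrm x).
  move=> s0; have q0 : 0 < 1 + nrm (x + z1 + ii R * rc s) by rewrite ltr_pwDl.
  by rewrite -[leLHS]mul1r ler_pdivrMr // mulrAC ler_pdivlMr // mul1r grow.
have h0s s : 0 <= s -> im z1 <= im (x + z1 + ii R * rc s).
  by move=> s0; rewrite !reimE; slra.
have b1 s : 0 <= s -> nrm (l1 (x + z1 + ii R * rc s)) <= B * D / (1 + nrm x).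
  move=> s0; apply: le_trans (HB _ (h0s _ s0)).1 _.
  by rewrite -mulrA ler_wpM2l ?(ltW B0) // inv.
have b2 s : 0 <= s -> nrm (l2 (x + z1 + ii R * rc s)) <= B * D ^+ 2 / (1 + nrm x) ^+ 2.
  move=> s0; apply: le_trans (HB _ (h0s _ s0)).2 _.
  rewrite -mulrA ler_wpM2l ?(ltW B0) // -exprVn -expr_div_n.
  by rewrite ler_pXn2r ?nnegrE ?inv // ?invr_ge0 ?divr_ge0 ?addr_ge0 // ltW.
have e0 : x + z1 = x + z1 + ii R * rc 0 by rewrite rc0 mulr0 addr0.
have eL : x + (z1 + iL) = x + z1 + ii R * rc L by rewrite /iL; ring.
have y1 : 0 < im (x + z1) by apply: lt_le_trans (im_x1 x0).
have y2 : 0 < im (x + (z1 + iL)) by apply: lt_le_trans (im_x2 x0).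
have kM z (M : R) : nrm z <= M -> nrm (kap * z) <= M.
  by move=> h; rewrite nrmM; have := ler_wpM2r (nrm_ge0 z) kap1; lra.
have i0 : 0 < (1 + nrm x)^-1 by rewrite invr_gt0.
have DD : D <= D ^+ 2 by rewrite expr2 ler_peMr // ltW.
have M1 : B * D / (1 + nrm x) <= B * D ^+ 2 / (1 + nrm x).
  by apply: ler_wpM2r; [exact: ltW|]; rewrite ler_wpM2l // ltW.
have M0 : 0 <= B * D ^+ 2 / (1 + nrm x) by rewrite !mulr_ge0 ?exprn_ge0 // ltW.
have LM0 : 0 <= L * (B * D ^+ 2 / (1 + nrm x)) by rewrite mulr_ge0.
split.
- by apply: cd_diff; exact: cd_Lm.
- by apply: cd_diff; exact: cd_l1.
- apply: kM.
  have H t : 0 <= t <= 1 -> cd (@Lm R) (pt (x + z1) (x + (z1 + iL)) t) (l1 (pt (x + z1) (x + (z1 + iL)) t)).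
    move=> /andP[t0' t1]; apply: cd_Lm; rewrite /pt /iL !reimE.
    have := mulr_ge0 t0' L0; slra.
  have HK t : 0 <= t <= 1 -> nrm (l1 (pt (x + z1) (x + (z1 + iL)) t) - 0) <= B * D / (1 + nrm x).
    move=> /andP[t0' t1]; rewrite subr0.
    have -> : pt (x + z1) (x + (z1 + iL)) t = x + z1 + ii R * rc (t * L).
      by rewrite /pt /iL rcM; ring.
    by apply: b1; rewrite mulr_ge0.
  have := cd_lip_seg H HK; rewrite mul0r subr0 nrmB.
  have -> : x + (z1 + iL) - (x + z1) = iL by ring.
  rewrite /iL nrmM nrm_ii nrm_rc mul1r ger0_norm // => h.
  apply: le_trans h _.
  have := ler_wpM2r L0 M1; slra.
- apply: kM; apply: le_trans (nrm_subD _ _) _.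
  have h1 : nrm (l1 (x + z1)) <= B * D / (1 + nrm x) by rewrite e0 b1.
  have h2 : nrm (l1 (x + (z1 + iL))) <= B * D / (1 + nrm x) by rewrite eL b1.
  slra.
- apply: kM; apply: le_trans (nrm_subD _ _) _.
  have h1 : nrm (l2 (x + z1)) <= B * D ^+ 2 / (1 + nrm x) ^+ 2 by rewrite e0 b2.
  have h2 : nrm (l2 (x + (z1 + iL))) <= B * D ^+ 2 / (1 + nrm x) ^+ 2 by rewrite eL b2.
  have : 0 <= L * (B * D ^+ 2 / (1 + nrm x) ^+ 2).
    by rewrite !mulr_ge0 ?invr_ge0 ?exprn_ge0 ?(ltW t0) // ltW.
  slra.
Qed.

End Pattern.

(** * A pattern that repeats a value, with constant close to 1 *)

Section PatternExists.
Variable R : realType.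
Local Notation C := (Cplx R).
Implicit Types (x z w : C).

(** The points [la] and [lb] below lie on the imaginary axis at the distances [b] and [2 b] from
    [i pi] and [- i pi]; the different distances give the two heights. The modulus of [kk] is at
    most [2 b = s e^-2], and [e^-2] bounds [|om|] from below, so [kk] is at most the fraction [s] of
    [om]. This leads to the constant [(1 + s) / (1 - s)]. *)
Variables (s b : R).
Hypotheses (s0 : 0 < s) (s4 : s <= 1 / 4) (bE : b = s * expR (- 2) / 2).

Let e2 : R := expR (- 2).
Let e20 : 0 < e2. Proof. exact: expR_gt0. Qed.
Let e21 : e2 <= 1. Proof. by rewrite expR_le1; lra. Qed.
Let b0 : 0 < b. Proof. by rewrite bE divr_gt0 // mulr_gt0. Qed.
Let b8 : b <= 1 / 8. Proof. by rewrite bE -/e2; have := ler_pM (ltW s0) (ltW e20) s4 e21; have := s0; lra. Qed.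
Let pi2 := pi_ge2 R.

Local Ltac slra := have := s0; have := s4; have := e20; have := e21; have := b0; have := b8; have := pi2; lra.

(* [kk] makes [z + kap * Lm z] take the same value at [za] and at [zb], where [Lm] is [la] and [lb];
   [za] is the lower of the two points. *)
Let la : C := ii R * rc (pi - b).
Let lb : C := ii R * rc (2 * b - pi).
Let za : C := ii R / rc 2 * (lexp la + 1).
Let zb : C := ii R / rc 2 * (lexp lb + 1).
Let kk : C := (cexp la - cexp lb) / (la - lb).
Let kap : C := - (ii R / rc 2) * (1 + kk).

Let la_lb : la - lb = ii R * rc (2 * pi - 3 * b).
Proof. by rewrite /la /lb -mulrBr -rcB; congr (_ * rc _); ring. Qed.

Let p3 : 3 <= 2 * pi - 3 * b. Proof. by slra. Qed.
Let la_lb0 : la - lb != 0.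
Proof. by rewrite -nrm_gt0 la_lb nrmM nrm_ii nrm_rc mul1r ger0_norm; slra. Qed.

Let rc20 : rc 2 != 0 :> C. Proof. by rewrite rc_eq0 pnatr_eq0. Qed.

Let zetaK w : zeta (ii R / rc 2 * (w + 1)) = w.
Proof.
rewrite /zeta; have -> : rc 2 * ii R * (ii R / rc 2 * (w + 1)) = (ii R * ii R) * (w + 1).
  by field.
by rewrite ii2; ring.
Qed.

Let im_lexp_z (w : C) : im (ii R / rc 2 * (w + 1)) = (re w + 1) / 2.
Proof. by rewrite -rcV !reimE; field. Qed.

Let im_la : `|im la| < pi.
Proof. by rewrite /la !reimE ger0_norm; slra. Qed.
Let im_lb : `|im lb| < pi.
Proof. by rewrite /lb !reimE ltr_norml; apply/andP; split; slra. Qed.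

Let Lza : Lm za = la. Proof. by apply: Lm_unique; rewrite // /za zetaK. Qed.
Let Lzb : Lm zb = lb. Proof. by apply: Lm_unique; rewrite // /zb zetaK. Qed.

Let im_za : im za = (1 - cos b) / 2.
Proof.
have [r0 i0] : re la = 0 /\ im la = pi - b by rewrite /la !reimE; split; ring.
rewrite /za im_lexp_z re_lexp r0 i0 add0r expR0 mul1r.
by rewrite [pi - b]addrC cosDpi cosN; ring.
Qed.
Let im_zb : im zb = (1 - cos (2 * b)) / 2.
Proof.
have [r0 i0] : re lb = 0 /\ im lb = 2 * b - pi by rewrite /lb !reimE; split; ring.
rewrite /zb im_lexp_z re_lexp r0 i0 add0r expR0 mul1r.
by rewrite -cosN opprB [pi - _]addrC cosDpi cosN; ring.
Qed.

Let cos_dec (x y : R) : 0 < x -> x < y -> y < pi -> cos y < cos x.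
Proof.
move=> x0 xy yp; have [c /andP[c1 c2] E] := rd_mvt xy (fun t _ => rd_cos t).
have : 0 < sin c by apply: sin_gt0_pi; apply/andP; split; slra.
move=> sc; have : 0 < sin c * (y - x) by rewrite mulr_gt0 // subr_gt0.
by move: E; lra.
Qed.

Let za0 : 0 < im za.
Proof.
rewrite im_za divr_gt0 // subr_gt0.
have h1 : cos b < cos (b / 2) by apply: cos_dec; slra.
by apply: lt_le_trans h1 (cos_le1 _).
Qed.
Let zazb : im za < im zb.
Proof.
rewrite im_za im_zb; have : cos (2 * b) < cos b by apply: cos_dec; slra.
lra.
Qed.

Let kk_le : nrm kk <= 2 * b.
Proof.
rewrite /kk nrm_div la_lb nrmM nrm_ii nrm_rc mul1r ger0_norm; last by slra.
rewrite ler_pdivrMr; last by slra.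
have h : nrm (cexp la - cexp lb) <= 5 * b.
  have cl (t : R) : cexp (ii R * rc t) = cos t +i* sin t by exact: cexp_ii.
  apply: le_trans (nrm_reim _) _; rewrite /la /lb !cl /re /im /=.
  have -> : cos (pi - b) = - cos b by rewrite addrC cosDpi cosN.
  have -> : sin (pi - b) = sin b by rewrite addrC sinDpi sinN opprK.
  have -> : cos (2 * b - pi) = - cos (2 * b) by rewrite -cosN opprB [pi - _]addrC cosDpi cosN.
  have -> : sin (2 * b - pi) = - sin (2 * b).
    have -> : 2 * b - pi = - (pi - 2 * b) by ring.
    by rewrite sinN [pi - _]addrC sinDpi sinN opprK.
  have c1 := cos_ge (ltW b0); have c2 := cos_le1 b.
  have b20 : 0 <= 2 * b by slra.
  have c3 := cos_ge b20; have c4 := cos_le1 (2 * b).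
  have s1 := sin_le (ltW b0); have s2 := sin_le b20.
  have s3 : 0 < sin b by apply: sin_gt0_pi; apply/andP; split; slra.
  have s5 : 0 < sin (2 * b) by apply: sin_gt0_pi; apply/andP; split; slra.
  have u1 : `|- cos b - - cos (2 * b)| <= 2 * b by rewrite ler_norml; apply/andP; split; slra.
  have u2 : `|sin b - - sin (2 * b)| <= 3 * b by rewrite ler_norml; apply/andP; split; slra.
  by apply: le_trans (lerD u1 u2) _; slra.
have := ler_wpM2l (ltW b0) p3; slra.
Qed.

Let kk_s : nrm kk <= s * e2.
Proof. by apply: le_trans kk_le _; rewrite bE -/e2; slra. Qed.

Let kap1 : nrm kap <= 1.
Proof.
rewrite /kap nrmM nrmN nrm_div nrm_ii nrm_rc ger0_norm //.
have := nrmD 1 kk; rewrite nrm1; have := kk_le; slra.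
Qed.

Let f z := z + kap * Lm z.
Let f1 z := 1 + kap * l1 z.

Let f_eq : f za = f zb.
Proof.
rewrite /f Lza Lzb /za /zb /kap /lexp.
have -> : ii R / rc 2 * (la + cexp la + 1) + - (ii R / rc 2) * (1 + kk) * la
  = ii R / rc 2 * (cexp la + 1 - kk * la) by ring.
have -> : ii R / rc 2 * (lb + cexp lb + 1) + - (ii R / rc 2) * (1 + kk) * lb
  = ii R / rc 2 * (cexp lb + 1 - kk * lb) by ring.
congr (_ * _).
have : kk * (la - lb) = cexp la - cexp lb by rewrite /kk divfK.
move=> h; apply/eqP; rewrite -subr_eq0; apply/eqP.
have -> : cexp la + 1 - kk * la - (cexp lb + 1 - kk * lb) = cexp la - cexp lb - kk * (la - lb) by ring.
by rewrite h subrr.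
Qed.

Let f1E z : 0 < im z -> f1 z = (om z - kk) / (1 + om z).
Proof.
move=> z0; have d0 := om1_neq0 z0; rewrite /f1 /kap /l1.
have -> : - (ii R / rc 2) * (1 + kk) * (- (rc 2 * ii R) * (1 + om z)^-1)
  = (ii R * ii R) * (1 + kk) / (1 + om z).
  by have t0 := rc20; move: (rc 2) t0 => t t0; field; rewrite ?t0 ?d0.
by rewrite ii2; field.
Qed.

Let om_kk z : 0 < im z -> (1 - s) * nrm (om z) <= nrm (om z - kk).
Proof.
move=> z0; have := nrm_lowB (om z) kk; have := kk_s; have := om_ge z0; rewrite -/e2 => h1.
have := ler_wpM2l (ltW s0) h1; slra.
Qed.

Let f1_low z : 0 < im z -> e2 / 4 <= nrm (f1 z).
Proof.
move=> z0; have d0 := om1_neq0 z0; rewrite f1E // nrm_div ler_pdivlMr ?nrm_gt0 //.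
apply: le_trans (om_kk z0).
have h1 := om_ge z0; rewrite -/e2 in h1.
have h2 := nrmD 1 (om z); rewrite nrm1 in h2.
have o0 := nrm_ge0 (om z).
have h3 : e2 / 4 * nrm (1 + om z) <= e2 / 4 * (1 + nrm (om z)).
  by apply: ler_wpM2l => //; rewrite divr_ge0 // ltW.
have h4 : e2 * nrm (om z) <= 1 * nrm (om z) by apply: ler_wpM2r.
have h5 : s * nrm (om z) <= 1 / 4 * nrm (om z) by apply: ler_wpM2r.
lra.
Qed.

(** Three factors: [nrm kap] is at most [(1 + s) / 2], [4 Im z / |1 + om|^2] is at most 1, and
    replacing [om] by [om - kk] costs [1 - s]. *)
Let f2_bound z : 0 < im z ->
  (1 - s) * (2 * im z * nrm (kap * l2 z)) <= (1 + s) * nrm (f1 z).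
Proof.
move=> z0; have d0 := om1_neq0 z0; rewrite f1E // nrm_div nrmM nrm_l2.
have h1 := om1_ge z0; have h2 := om_kk z0.
have nk : nrm kap <= (1 + s) / 2.
  rewrite /kap nrmM nrmN nrm_div nrm_ii nrm_rc ger0_norm //.
  have := nrmD 1 kk; rewrite nrm1; have := kk_s.
  have : s * e2 <= s * 1 by apply: ler_wpM2l => //; exact: ltW.
  slra.
have q0 : 0 < nrm (1 + om z) by rewrite nrm_gt0.
set q := nrm (1 + om z) in h1 q0 *; set o := nrm (om z) in h2 *.
have o0 : 0 <= o by exact: nrm_ge0.
have -> : 2 * im z * (nrm kap * (4 * o / q ^+ 3)) =
  2 * nrm kap * (4 * im z / q ^+ 2) * (o / q) by field; rewrite gt_eqF.
have h3 : 4 * im z / q ^+ 2 <= 1 by rewrite ler_pdivrMr ?exprn_gt0 // mul1r.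
have oq : 0 <= o / q by rewrite divr_ge0 // ltW.
have h4 : 2 * nrm kap * (4 * im z / q ^+ 2) <= (1 + s) * 1.
  apply: ler_pM => //; first by rewrite mulr_ge0.
    by rewrite divr_ge0 ?exprn_ge0 ?mulr_ge0 // ltW.
  slra.
have h5 : (1 - s) * (o / q) <= nrm (om z - kk) / q.
  by rewrite mulrA ler_pM2r // invr_gt0.
have h6 : 2 * nrm kap * (4 * im z / q ^+ 2) * (o / q) <= (1 + s) * (o / q).
  by have := ler_wpM2r oq h4; rewrite mulr1.
have s1 : 0 <= 1 - s by slra.
have := ler_wpM2l s1 h6; have s2 : 0 <= 1 + s by slra.
have := ler_wpM2l s2 h5; slra.
Qed.

Lemma pattern_exists_s (T : R) : (1 + s) / (1 - s) < T ->
  exists (P : prf R) (A lo hi : R), [/\ 0 < A, 0 < lo, is_prof A P, pbound T lo hi P & overlap P].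
Proof.
move=> hT; have T0 : 0 < T by apply: lt_trans hT; rewrite divr_gt0; slra.
set T' := (1 + s) / (1 - s) in hT.
have T'0 : 0 < T' by rewrite divr_gt0; slra.
pose d := f1 zb.
have zb0 : 0 < im zb by apply: lt_trans zazb.
have d0 : 0 < nrm d by apply: lt_le_trans (f1_low zb0); rewrite divr_gt0.
have [r0 r00 hr0] : exists2 r, 0 < r & forall w, nrm (w - zb) < r -> nrm (f1 w - f1 zb) < nrm d / 16.
  apply: (@cd_cont _ f1 zb (kap * l2 zb)); last by rewrite divr_gt0.
  by have := cd_add (cd_const 1 zb) (cd_scale kap (cd_l1 zb0)); rewrite add0r.
pose rho := Num.min (r0 / 2) ((im zb - im za) / 2).
have rho0 : 0 < rho by rewrite lt_min !divr_gt0 // subr_gt0.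
have rho1 : rho <= r0 / 2 by rewrite ge_min lexx.
have rho2 : rho <= (im zb - im za) / 2 by rewrite ge_min lexx orbT.
clearbody rho.
(* All the errors caused by the far shift by [i L] are at most [e]. *)
pose e := Num.min (Num.min (nrm d / 16) (nrm d * rho / 16 / (1 + nrm (zb - za))))
                  (Num.min (e2 / 8) ((T - T') * (e2 / 8) / (32 + T'))).
have zz0 : 0 < 1 + nrm (zb - za) by rewrite ltr_pwDl.
have e0 : 0 < e by rewrite !lt_min !divr_gt0 ?mulr_gt0 ?subr_gt0 ?divr_gt0 //; slra.
have ea : e <= nrm d / 16 by rewrite !ge_min lexx.
have eb : e * (1 + nrm (zb - za)) <= nrm d * rho / 16.
  by rewrite -ler_pdivlMr // !ge_min lexx orbT.
have ec : e <= e2 / 8 by rewrite !ge_min lexx !orbT.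
have ed : e * (32 + T') <= (T - T') * (e2 / 8).
  by rewrite -ler_pdivlMr ?addr_gt0 // !ge_min lexx !orbT.
clearbody e.
(* At heights above [L = N ^+ 2] the lemma [om1_ge] gives [|1 + om| >= 2 N], so the derivative of
   the far translate is at most [1 / N <= e]. *)
pose N := 1 + e^-1; have N1 : 1 <= N by rewrite lerDl invr_ge0 ltW.
have Ne : N^-1 <= e.
  by rewrite -[leRHS]invrK lef_pV2 ?posrE ?invr_gt0 // ?ltr_pwDl ?invr_ge0 ?(ltW e0) // lerDr.
clearbody N.
pose L := N ^+ 2; have L0 : 0 <= L by exact: sqr_ge0.
pose iL : C := ii R * rc L.
have far (x : C) : im za <= im x -> [/\ 0 < im (x + iL), nrm (l1 (x + iL)) <= e
    & im x * nrm (l2 (x + iL)) <= 16 * e].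
  move=> hx; have ix : im (x + iL) = im x + L by rewrite /iL !reimE; ring.
  have y0 : 0 < im (x + iL) by rewrite ix; have := za0; slra.
  have h1 := om1_ge y0; have h2 := om1_far y0.
  have yn := im_nrm (x + iL).
  have q2 : 2 * N <= nrm (1 + om (x + iL)).
    rewrite -(@ler_pXn2r _ 2) ?nnegrE //; last by slra.
    by apply: le_trans h1; rewrite ix exprMn -/L; have := za0; slra.
  have os : nrm (om (x + iL)) <= nrm (1 + om (x + iL)) + 1.
    by have := nrm_lowD (om (x + iL)) 1; rewrite nrm1 addrC (addrC (om _)); slra.
  rewrite nrm_l1 nrm_l2; set q := nrm (1 + om (x + iL)) in h1 h2 q2 os *.
  have q0 : 0 < q by slra.
  have qN : q^-1 <= e / 2.
    apply: le_trans (_ : (2 * N)^-1 <= _); first by rewrite lef_pV2 ?posrE //; slra.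
    by rewrite invfM mulrC; slra.
  split=> //; first by slra.
  have i1 : im x <= 4 * q by rewrite ix in yn; slra.
  have o1 : nrm (om (x + iL)) <= 2 * q by slra.
  have -> : im x * (4 * nrm (om (x + iL)) / q ^+ 3) =
      4 * (im x * nrm (om (x + iL))) / q ^+ 2 * q^-1 by field; rewrite gt_eqF.
  have h3 : 4 * (im x * nrm (om (x + iL))) / q ^+ 2 <= 32.
    rewrite ler_pdivrMr ?exprn_gt0 //.
    have ix0 : 0 <= im x by have := za0; slra.
    by have := ler_pM ix0 (nrm_ge0 _) i1 o1; slra.
  have : 4 * (im x * nrm (om (x + iL))) / q ^+ 2 * q^-1 <= 32 * (e / 2).
    apply: ler_pM => //; last by rewrite invr_ge0 ltW.
    rewrite divr_ge0 ?exprn_ge0 ?(ltW q0) // mulr_ge0 // mulr_ge0 //.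
    by have := za0; slra.
  slra.
have kM z (M : R) : nrm z <= M -> nrm (kap * z) <= M.
  by move=> h; rewrite nrmM; have := ler_wpM2r (nrm_ge0 z) kap1; lra.
have [A A0 HA] := pattern_prof za0 L0 kap1.
set P := pattern kap za L in HA.
have v1E x : 1 + pv1 P x = f1 (x + za) - kap * l1 (x + za + iL).
  by rewrite /P /= /f1 addrA /iL; ring.
have imx x : 0 <= im x -> im za <= im (x + za) by move=> h; rewrite imD lerDr.
have close x : 0 <= im x -> nrm (1 + pv1 P x - f1 (x + za)) <= e.
  move=> x0; have [_ h _] := far _ (imx x x0).
  have -> : 1 + pv1 P x - f1 (x + za) = - (kap * l1 (x + za + iL)) by rewrite v1E; ring.
  by rewrite nrmN; exact: kM.
exists P, A, (e2 / 8), (1 + A); split => //.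
- by rewrite divr_gt0.
- move=> x x0; have [_ _ _ hA _] := HA x x0.
  have y0 : 0 < im (x + za) by apply: lt_le_trans za0 (imx _ x0).
  have cl := close x x0.
  have lo1 : nrm (f1 (x + za)) - e <= nrm (1 + pv1 P x).
    by have := nrm_lowD (f1 (x + za)) (1 + pv1 P x - f1 (x + za)); rewrite [f1 _ + _]addrC subrK; slra.
  have lo2 := f1_low y0.
  split; first by slra.
    apply: le_trans (nrmD _ _) _; rewrite nrm1 lerD2l; apply: le_trans hA _.
    by rewrite ler_pdivrMr ?ltr_pwDl // ler_peMr ?(ltW A0) // lerDl.
  have [_ _ fr] := far _ (imx x x0).
  have h2 : 2 * im x * nrm (pv2 P x) <= 2 * im (x + za) * nrm (kap * l2 (x + za)) + 2 * (16 * e).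
    have : nrm (pv2 P x) <= nrm (kap * l2 (x + za)) + nrm (l2 (x + za + iL)).
      rewrite /P /= mulrBr addrA; apply: le_trans (nrm_subD _ _) _.
      by rewrite lerD2l; exact: kM.
    have := imx x x0 => h1 h.
    have h3 : im x * nrm (pv2 P x) <= im x * (nrm (kap * l2 (x + za)) + nrm (l2 (x + za + iL))).
      exact: ler_wpM2l.
    have i1 : im x <= im (x + za) by rewrite imD; have := za0; slra.
    have h4 := ler_wpM2r (nrm_ge0 (kap * l2 (x + za))) i1.
    have h5 := ler_wpM2r (nrm_ge0 (l2 (x + za + iL))) i1.
    slra.
  have h3 : 2 * im (x + za) * nrm (kap * l2 (x + za)) <= T' * nrm (f1 (x + za)).
    have s1 : 0 < 1 - s by slra.
    by rewrite /T' [leRHS]mulrAC ler_pdivlMr // mulrC; exact: f2_bound.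
  have up : nrm (f1 (x + za)) <= nrm (1 + pv1 P x) + e.
    have := nrm_lowB (f1 (x + za)) (f1 (x + za) - (1 + pv1 P x)).
    rewrite nrmB in cl; have := cl.
    by rewrite opprB addrCA subrr addr0; slra.
  have h4 := ler_wpM2l (ltW T'0) up.
  have h5 : (T - T') * (e2 / 8) <= (T - T') * nrm (1 + pv1 P x).
    by rewrite ler_wpM2l //; slra.
  slra.
- have im0 : im (zb - za) > rho by rewrite imB; have := zazb; slra.
  (* The pattern is shifted by [za]: the boundary point 0 stands for [za] and the inner point for
     [zb]. Their values cancel by [f_eq], so only the increment of the far translate is left. *)
  exists (zb - za), d, rho, (1 / 8); split.
  + by split; [| |rewrite -nrm_gt0|apply/andP; split; slra].
  + move=> x hx; have x0 : 0 <= im x.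
      have := im_le (x - (zb - za)); rewrite imB ler_norml => /andP[]; slra.
    have cl := close x x0.
    have : nrm (f1 (x + za) - f1 zb) < nrm d / 16.
      by apply: hr0; rewrite (_ : x + za - zb = x - (zb - za)); [slra|ring].
    have := nrm_tri (f1 (x + za)) (1 + pv1 P x) d; rewrite -/d; slra.
  + have ha : zb - za + za = zb by ring.
    have -> : zb - za + pv P (zb - za) - pv P 0 = f zb - f za - kap * (Lm (zb + iL) - Lm (za + iL)).
      by rewrite /P /= /f !addrA ha add0r /iL; ring.
    rewrite f_eq subrr sub0r nrmN.
    apply: le_trans (_ : nrm (Lm (zb + iL) - Lm (za + iL)) <= _); first exact: kM.
    have cS := @cvx_half R (im za + L).
    have E z : z = (z - iL) + iL by ring.
    have iE z : im (z - iL) = im z - L by rewrite /iL !reimE; ring.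
    have H1 z : [set z | im za + L <= im z] z -> cd (@Lm R) z (l1 z).
      by move=> hz; apply: cd_Lm; apply: lt_le_trans hz; have := za0; slra.
    have H2 z : [set z | im za + L <= im z] z -> nrm (l1 z) <= e.
      by move=> hz; rewrite [z]E; have [] := far (z - iL) _ => //; rewrite iE lerBrDr.
    have iD w : im (w + iL) = im w + L by rewrite /iL !reimE; ring.
    have Sa : [set z | im za + L <= im z] (za + iL) by rewrite /mkset iD lexx.
    have Sb : [set z | im za + L <= im z] (zb + iL).
      by rewrite /mkset iD lerD2r ltW // zazb.
    have := cd_lip0 cS H1 H2 Sa Sb.
    have -> : zb + iL - (za + iL) = zb - za by ring.
    move=> h; apply: le_trans h _.
    have : e * nrm (zb - za) <= e * (1 + nrm (zb - za)) by rewrite ler_wpM2l ?(ltW e0) // lerDr.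
    lra.
Qed.

End PatternExists.

Lemma pattern_exists (R : realType) (T : R) : 1 < T ->
  exists (P : prf R) (A lo hi : R), [/\ 0 < A, 0 < lo, is_prof A P, pbound T lo hi P & overlap P].
Proof.
move=> T1; pose s := Num.min (1 / 4) ((T - 1) / 8).
have s0 : 0 < s by rewrite lt_min !divr_gt0 // subr_gt0.
have s1 : s <= 1 / 4 by rewrite ge_min lexx.
have s2 : s <= (T - 1) / 8 by rewrite ge_min lexx orbT.
apply: (pattern_exists_s s0 s1 erefl).
by rewrite ltr_pdivrMr; nra.
Qed.

(** * Insertion of scaled copies at boundary points *)

Section Insertion.
Variable R : realType.
Local Notation C := (Cplx R).
Implicit Types (z w x : C).

(* [W > 0] is the domain, and its closure [W >= 0] is parametrised at the boundary by [gam], with unit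
   tangent [tau]. Up to second order, [W] is twice the distance to each tangent line. *)
Record geom := Geom {
  W : C -> R; gam : R -> C; tau : R -> C;
  W_cvx : cvx [set z | 0 <= W z];
  tau1 : forall t, nrm (tau t) = 1;
  W_le : forall t z, W z <= 2 * im ((z - gam t) / tau t);
  W_ge : forall t z, 2 * im ((z - gam t) / tau t) - nrm (z - gam t) ^+ 2 <= W z;
  W_gam : forall t, W (gam t) = 0;
  W_cont : forall z (e : R), 0 < e -> exists2 r : R, 0 < r &
    forall w, nrm (w - z) <= r -> `|W w - W z| <= e;
  gam_sep : forall T : R, exists2 c : R, 0 < c <= 1 &
    forall s t : R, `|s| <= T -> `|t| <= T -> c * `|s - t| <= nrm (gam s - gam t);
  gam_lip : forall s t : R, nrm (gam s - gam t) <= 2 * `|s - t|;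
  gam_dense : forall p (e : R), W p = 0 -> 0 < e -> exists t, nrm (gam t - p) < e;
  gam_cover : forall r : R, exists2 T : R, 0 <= T &
    forall p, W p = 0 -> nrm p <= r -> exists2 t : R, `|t| <= T & p = gam t \/ p = - gam t;
  W_gamN : forall t, W (- gam t) = 0
}.

Arguments W_cvx : clear implicits.

Variable G : geom.

Definition cl z : Prop := 0 <= W G z.

Definition zt (t e : R) z : C := (z - gam G t) / (tau G t * rc e).

Lemma tau_neq0 t : tau G t != 0. Proof. by rewrite -nrm_gt0 tau1. Qed.

Lemma ztE (t e : R) z : 0 < e -> zt t e z = rc e^-1 * ((z - gam G t) / tau G t).
Proof.
move=> e0; rewrite /zt rcV; have := tau_neq0 t; have : rc e != 0 :> C by rewrite rc_eq0 gt_eqF.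
by move=> h1 h2; field; rewrite h1 h2.
Qed.

Lemma W_zt (t e : R) z : 0 < e -> W G z <= 2 * e * im (zt t e z).
Proof.
move=> e0; apply: le_trans (W_le G t z) _; rewrite ztE //.
rewrite [X in 2 * e * X]imM re_rc im_rc mul0r addr0.
by rewrite mulrA -[2 * e * _]mulrA mulfV ?gt_eqF // mulr1.
Qed.

(** The closed domain lies on one side of each tangent, so in the local coordinate [zt] it falls
    into the closed half-plane, where profiles are controlled. *)
Lemma im_zt (t e : R) z : 0 < e -> cl z -> 0 <= im (zt t e z).
Proof.
move=> e0 h; have := W_zt t z e0; rewrite /cl in h => h2.
have : 0 <= 2 * e * im (zt t e z) by apply: le_trans h h2.
by rewrite pmulr_rge0 // mulr_gt0.
Qed.

Lemma nrm_zt (t e : R) z : 0 < e -> nrm (zt t e z) = nrm (z - gam G t) / e.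
Proof. by move=> e0; rewrite /zt nrm_div nrmM tau1 nrm_rc mul1r ger0_norm // ltW. Qed.

Lemma cd_zt (t e : R) z : cd (zt t e) z (tau G t * rc e)^-1.
Proof.
have := cd_affine (tau G t * rc e)^-1 (- (gam G t / (tau G t * rc e))) z.
by apply: cd_ext => // u; rewrite /zt; ring.
Qed.

Lemma zt_gam (t e : R) : zt t e (gam G t) = 0. Proof. by rewrite /zt subrr mul0r. Qed.

Section Batch.
Variables (F : prf R) (e : R) (tt : nat -> R) (PP : nat -> prf R).

(** Scaling a copy by the derivative of [F] at its base point makes derivatives multiply: nearby,
    the new derivative is [cc i * (1 + pv1 (PP i) _)] up to small errors. The factor [tau * rc e] in
    [tv] undoes the slope of [zt]. *)
Definition cc i : C := pv1 F (gam G (tt i)).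
Definition tv i z : C := cc i * (tau G (tt i) * rc e) * pv (PP i) (zt (tt i) e z).
Definition tv1 i z : C := cc i * pv1 (PP i) (zt (tt i) e z).
Definition tv2 i z : C := cc i * (tau G (tt i) * rc e)^-1 * pv2 (PP i) (zt (tt i) e z).
Definition wt i z : R := (1 + nrm (zt (tt i) e z))^-1.

Definition ins (s : seq nat) : prf R := Prf
  (fun z => pv F z + \sum_(i <- s) tv i z)
  (fun z => pv1 F z + \sum_(i <- s) tv1 i z)
  (fun z => pv2 F z + \sum_(i <- s) tv2 i z).

Definition smooth (H : prf R) := forall z, cl z -> cd (pv H) z (pv1 H z) /\ cd (pv1 H) z (pv2 H z).

Variables (hi A B : R).
Hypotheses (e0 : 0 < e) (hi0 : 0 <= hi) (A0 : 0 <= A) (B0 : 0 <= B) (SF : smooth F).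
Hypothesis F1hi : forall z, cl z -> nrm (pv1 F z) <= hi.
Hypothesis F2B : forall z, cl z -> nrm (pv2 F z) <= B.
Hypothesis PA : forall i, is_prof A (PP i).

Let cl_gam t : cl (gam G t). Proof. by rewrite /cl W_gam. Qed.
Let cc_le i : nrm (cc i) <= hi. Proof. exact: F1hi. Qed.
Let rce0 : rc e != 0 :> C. Proof. by rewrite rc_eq0 gt_eqF. Qed.
Let te0 i : tau G (tt i) * rc e != 0. Proof. by rewrite mulf_neq0 ?tau_neq0. Qed.
Let nrm_te i : nrm (tau G (tt i) * rc e) = e.
Proof. by rewrite nrmM tau1 nrm_rc mul1r ger0_norm // ltW. Qed.

Lemma wt_gt0 i z : 0 < wt i z. Proof. by rewrite invr_gt0 ltr_pwDl. Qed.
Lemma wt_le1 i z : wt i z <= 1. Proof. by rewrite invf_le1 ?lerDl // ltr_pwDl. Qed.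

Lemma wt_far i z (r : R) : 0 < r -> r <= nrm (z - gam G (tt i)) -> wt i z <= e / r.
Proof.
move=> r0 h; rewrite /wt nrm_zt // -[leRHS]invrK invf_div lef_pV2 ?posrE ?divr_gt0 //.
  by apply: le_trans (_ : nrm (z - gam G (tt i)) / e <= _); rewrite ?ler_pM2r ?invr_gt0 // lerDr.
by rewrite ltr_pwDl // divr_ge0 // ltW.
Qed.

Lemma cd_tv i z : cl z -> cd (tv i) z (tv1 i z).
Proof.
move=> hz; have [H _ _ _ _] := PA i (im_zt (tt i) e0 hz).
have := cd_scale (cc i * (tau G (tt i) * rc e)) (cd_comp (f := pv (PP i)) (cd_zt (tt i) e z) H).
apply: cd_ext => //; rewrite /tv1 -mulrA; congr (_ * _).
by rewrite mulrCA divff // mulr1.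
Qed.

Lemma cd_tv1 i z : cl z -> cd (tv1 i) z (tv2 i z).
Proof.
move=> hz; have [_ H _ _ _] := PA i (im_zt (tt i) e0 hz).
have := cd_scale (cc i) (cd_comp (f := pv1 (PP i)) (cd_zt (tt i) e z) H).
by apply: cd_ext => //; rewrite /tv2 mulrAC mulrA.
Qed.

Lemma tv_le i z : cl z -> nrm (tv i z) <= hi * A * e * wt i z.
Proof.
move=> hz; have [_ _ H _ _] := PA i (im_zt (tt i) e0 hz).
rewrite /tv !nrmM tau1 nrm_rc mul1r (ger0_norm (ltW e0)).
have -> : hi * A * e * wt i z = hi * e * (A * wt i z) by ring.
by apply: ler_pM => //; rewrite ?mulr_ge0 ?(ltW e0) // ler_wpM2r // ltW.
Qed.

Lemma tv1_le i z : cl z -> nrm (tv1 i z) <= hi * A * wt i z.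
Proof.
move=> hz; have [_ _ _ H _] := PA i (im_zt (tt i) e0 hz).
by rewrite /tv1 nrmM -mulrA; apply: ler_pM.
Qed.

Lemma tv2_le i z : cl z -> nrm (tv2 i z) <= hi * A / e * wt i z ^+ 2.
Proof.
move=> hz; have [_ _ _ _ H] := PA i (im_zt (tt i) e0 hz).
rewrite /tv2 !nrmM nrmV nrm_te.
have -> : hi * A / e * wt i z ^+ 2 = hi * e^-1 * (A * wt i z ^+ 2) by ring.
apply: ler_pM; rewrite ?mulr_ge0 ?invr_ge0 ?(ltW e0) //.
  by rewrite ler_wpM2r ?invr_ge0 ?(ltW e0).
by apply: le_trans H _; rewrite /wt exprVn.
Qed.

(** [W] is at most [2 e] times the height in the local coordinate. This height absorbs one of the
    two powers of [wt], and [e] cancels [1 / e]; the result is independent of the scale and sums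
    like the first derivative. *)
Lemma Wtv2_le i z : cl z -> W G z * nrm (tv2 i z) <= 2 * hi * A * wt i z.
Proof.
move=> hz; have h1 := tv2_le i hz; have h2 := W_zt (tt i) z e0.
have w0 := wt_gt0 i z; have n0 := nrm_ge0 (zt (tt i) e z).
have h3 : im (zt (tt i) e z) * wt i z <= 1.
  by rewrite ler_pdivrMr ?ltr_pwDl // mul1r; apply: le_trans (im_nrm _) _; rewrite lerDr.
have iz := im_zt (tt i) e0 hz.
apply: le_trans (_ : 2 * e * im (zt (tt i) e z) * (hi * A / e * wt i z ^+ 2) <= _).
  by apply: ler_pM.
have -> : 2 * e * im (zt (tt i) e z) * (hi * A / e * wt i z ^+ 2)
  = 2 * hi * A * wt i z * (im (zt (tt i) e z) * wt i z) by field; rewrite gt_eqF.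
by rewrite -[leRHS]mulr1 ler_wpM2l // !mulr_ge0 // ltW.
Qed.

Lemma ins_smooth s : smooth (ins s).
Proof.
move=> z hz; have [h1 h2] := SF hz; split; apply: cd_add => //; rewrite /=.
  by apply: cd_sum => i; exact: cd_tv.
by apply: cd_sum => i; exact: cd_tv1.
Qed.

Lemma ins2_bound s : exists2 B', 0 <= B' & forall z, cl z -> nrm (pv2 (ins s) z) <= B'.
Proof.
exists (B + \sum_(i <- s) hi * A / e).
  by rewrite addr_ge0 // sumr_ge0 // => i _; rewrite divr_ge0 ?mulr_ge0 // ltW.
move=> z hz; apply: le_trans (nrmD _ _) _; apply: lerD; first exact: F2B.
apply: le_trans (nrm_sum _ _ _) _; apply: ler_sum => i _.
apply: le_trans (tv2_le i hz) _; rewrite -[leRHS]mulr1 ler_wpM2l //.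
  by rewrite divr_ge0 ?mulr_ge0 // ltW.
by rewrite exprn_ile1 ?wt_le1 // ltW // wt_gt0.
Qed.

Section At.
Variables (s : seq nat) (j : nat) (z : C) (q : R).
Hypotheses (us : uniq s) (js : j \in s) (hz : cl z).
Hypothesis spread : \sum_(i <- s | i != j) wt i z <= q.

Let sum_le (h : nat -> C) K : 0 <= K -> (forall i, nrm (h i) <= K * wt i z) ->
  nrm (\sum_(i <- s) h i - h j) <= K * q.
Proof.
move=> K0 hh; rewrite (bigD1_seq j) //= addrAC subrr add0r.
apply: le_trans (nrm_sum _ _ _) _; apply: le_trans (ler_sum _ (fun i _ => hh i)) _.
by rewrite -mulr_sumr ler_wpM2l.
Qed.

Lemma ins_at0 : nrm (pv (ins s) z - pv F z - tv j z) <= hi * A * e * q.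
Proof.
rewrite /= [pv F z + _]addrC addrK.
by apply: sum_le => [|i]; [rewrite !mulr_ge0 // ltW | exact: tv_le].
Qed.

Lemma ins_at1 : nrm (pv1 (ins s) z - pv1 F z - tv1 j z) <= hi * A * q.
Proof.
rewrite /= [pv1 F z + _]addrC addrK.
by apply: sum_le => [|i]; [rewrite !mulr_ge0 | exact: tv1_le].
Qed.

Lemma ins_at2 : W G z * nrm (pv2 (ins s) z - pv2 F z - tv2 j z) <= 2 * hi * A * q.
Proof.
rewrite /= [pv2 F z + _]addrC addrK.
have W0 : 0 <= W G z by [].
have -> : W G z * nrm (\sum_(i <- s) tv2 i z - tv2 j z) =
   nrm (\sum_(i <- s) rc (W G z) * tv2 i z - rc (W G z) * tv2 j z).
  by rewrite -mulr_sumr -mulrBr nrm_rcM.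
apply: (sum_le (h := fun i => rc (W G z) * tv2 i z)) => [|i]; first by rewrite !mulr_ge0.
by rewrite nrm_rcM //; exact: Wtv2_le.
Qed.

Lemma F1_lip x y : cl x -> cl y -> nrm (pv1 F x - pv1 F y) <= B * nrm (x - y).
Proof.
move=> hx hy.
have H2 w : [set z | 0 <= W G z] w -> cd (pv1 F) w (pv2 F w) by case/SF.
exact: (cd_lip0 (W_cvx G) H2 F2B hy hx).
Qed.

Variable r : R.
Hypothesis r0 : 0 < r.

(** Within distance [r] of the base point, [pv1 F] is replaced by its value [cc j] at the cost
    [B * r]; the other copies cost [hi * A * q]. *)
Lemma ins_near1 : nrm (z - gam G (tt j)) <= r ->
  nrm (pv1 (ins s) z - cc j * (1 + pv1 (PP j) (zt (tt j) e z))) <= B * r + hi * A * q.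
Proof.
move=> hr; have h1 := ins_at1.
have h2 : nrm (pv1 F z - cc j) <= B * r.
  by apply: le_trans (F1_lip hz (cl_gam _)) _; rewrite ler_wpM2l.
have -> : pv1 (ins s) z - cc j * (1 + pv1 (PP j) (zt (tt j) e z)) =
  (pv1 F z - cc j) + (pv1 (ins s) z - pv1 F z - tv1 j z) by rewrite /tv1; ring.
by apply: le_trans (nrmD _ _) (lerD h2 h1).
Qed.

Lemma ins_near2 : nrm (z - gam G (tt j)) <= r ->
  W G z * nrm (pv2 (ins s) z) <=
  nrm (cc j) * (2 * im (zt (tt j) e z) * nrm (pv2 (PP j) (zt (tt j) e z))) + 2 * (B * r + hi * A * q).
Proof.
move=> hr; have h1 := ins_at2; have W0 : 0 <= W G z by [].
have Wr : W G z <= 2 * r.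
  apply: le_trans (W_zt (tt j) z e0) _.
  apply: le_trans (_ : 2 * e * nrm (zt (tt j) e z) <= _).
    by rewrite ler_wpM2l ?im_nrm // mulr_ge0 // ltW.
  rewrite nrm_zt //.
  have -> : 2 * e * (nrm (z - gam G (tt j)) / e) = 2 * nrm (z - gam G (tt j)) by field; rewrite gt_eqF.
  by rewrite ler_wpM2l.
have h2 : W G z * nrm (pv2 F z) <= 2 * r * B by apply: ler_pM => //; exact: F2B.
have h3 : W G z * nrm (tv2 j z) <=
    nrm (cc j) * (2 * im (zt (tt j) e z) * nrm (pv2 (PP j) (zt (tt j) e z))).
  rewrite /tv2 !nrmM nrmV nrm_te.
  have := ler_wpM2r (_ : 0 <= nrm (cc j) / e * nrm (pv2 (PP j) (zt (tt j) e z))) (W_zt (tt j) z e0).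
  move=> h; apply: le_trans (h _) _; first by rewrite !mulr_ge0 ?invr_ge0 // ltW.
  by rewrite le_eqVlt; apply/orP; left; apply/eqP; field; rewrite gt_eqF.
have h4 : nrm (pv2 (ins s) z) <= nrm (pv2 F z) + nrm (tv2 j z) + nrm (pv2 (ins s) z - pv2 F z - tv2 j z).
  have -> : pv2 (ins s) z = pv2 F z + tv2 j z + (pv2 (ins s) z - pv2 F z - tv2 j z) by ring.
  apply: le_trans (nrmD _ _) _.
  have -> : pv2 F z + tv2 j z + (pv2 (ins s) z - pv2 F z - tv2 j z) - pv2 F z - tv2 j z
     = pv2 (ins s) z - pv2 F z - tv2 j z by ring.
  by rewrite lerD2r nrmD.
have := ler_wpM2l W0 h4; lra.
Qed.

(** Beyond distance [r] the copy [j] has weight at most [e / r] and counts as an error like the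
    others. *)
Lemma ins_far1 : r <= nrm (z - gam G (tt j)) ->
  nrm (pv1 (ins s) z - pv1 F z) <= hi * A * (e / r + q).
Proof.
move=> hr; have h1 := ins_at1; have h2 := tv1_le j hz; have h3 := wt_far r0 hr.
have -> : pv1 (ins s) z - pv1 F z = tv1 j z + (pv1 (ins s) z - pv1 F z - tv1 j z) by ring.
apply: le_trans (nrmD _ _) _; rewrite mulrDr; apply: lerD => //.
by apply: le_trans h2 _; rewrite ler_wpM2l ?mulr_ge0.
Qed.

Lemma ins_far2 : r <= nrm (z - gam G (tt j)) ->
  W G z * nrm (pv2 (ins s) z - pv2 F z) <= 2 * hi * A * (e / r + q).
Proof.
move=> hr; have h1 := ins_at2; have h2 := Wtv2_le j hz; have h3 := wt_far r0 hr.
have -> : pv2 (ins s) z - pv2 F z = tv2 j z + (pv2 (ins s) z - pv2 F z - tv2 j z) by ring.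
apply: le_trans (_ : W G z * (nrm (tv2 j z) + nrm (pv2 (ins s) z - pv2 F z - tv2 j z)) <= _).
  by rewrite ler_wpM2l ?nrmD //.
rewrite mulrDr mulrDr; apply: lerD => //.
by apply: le_trans h2 _; rewrite ler_wpM2l ?mulr_ge0.
Qed.

Lemma ins_diff : nrm (pv (ins s) z - pv F z) <= hi * A * e * (1 + q).
Proof.
have h1 := ins_at0; have h2 := tv_le j hz.
have -> : pv (ins s) z - pv F z = tv j z + (pv (ins s) z - pv F z - tv j z) by ring.
apply: le_trans (nrmD _ _) _; rewrite mulrDr mulr1; apply: lerD => //.
by apply: le_trans h2 _; rewrite -[leRHS]mulr1 ler_wpM2l ?wt_le1 // !mulr_ge0 // ltW.
Qed.

End At.
End Batch.

(** [pv F] is compared with [c] times the rescaled map [x + pv P x]. The derivative of the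
    difference [H] is at most [dl], so the overlap of [P] survives with [eta'] in place of [eta].
    The bound on [(nrm b + rho) ^+ 2 * e] lets the curvature of the boundary take at most half of
    the height. *)
Lemma overlap_local (F P : prf R) (t e dl : R) (c b d : C) (rho eta eta' : R) :
  0 < e -> 0 <= dl -> smooth F -> 0 < rho -> rho < im b -> c * d != 0 -> eta <= eta' ->
  (forall z, cl z -> nrm (z - gam G t) <= (nrm b + rho) * e ->
     nrm (pv1 F z - c * (1 + pv1 P (zt t e z))) <= dl) ->
  (forall z, 0 <= im z -> cd (pv P) z (pv1 P z)) ->
  (forall x, nrm (x - b) <= rho -> nrm (1 + pv1 P x - d) <= eta * nrm d) ->
  nrm (b + pv P b - pv P 0) <= eta * nrm d * rho / 2 ->
  dl <= (eta' - eta) * nrm (c * d) -> dl * nrm b <= (eta' - eta) * nrm (c * d) * rho / 2 ->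
  (nrm b + rho) ^+ 2 * e <= im b - rho ->
  let z0 := gam G t + tau G t * rc e * b in
  (forall x, nrm (x - z0) <= e * rho ->
     e * (im b - rho) <= W G x /\ nrm (pv1 F x - c * d) <= eta' * nrm (c * d)) /\
  nrm (pv F z0 - pv F (gam G t)) <= eta' * nrm (c * d) * (e * rho) / 2.
Proof.
move=> e0 dl0 SF rho0 rhob cd0 eta01 HL HP H1 H2 D1 D2 ebound z0.
have te0 : tau G t * rc e != 0 by rewrite mulf_neq0 ?tau_neq0 // rc_eq0 gt_eqF.
have nte : nrm (tau G t * rc e) = e by rewrite nrmM tau1 nrm_rc mul1r ger0_norm // ltW.
have ztb x : nrm (x - z0) <= e * rho -> nrm (zt t e x - b) <= rho.
  move=> hx; have -> : zt t e x - b = (x - z0) / (tau G t * rc e).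
    by rewrite /zt /z0; move: (tau G t * rc e) te0 => u u0; field.
  by rewrite nrm_div nte ler_pdivrMr // mulrC.
have gb x : nrm (x - z0) <= e * rho -> nrm (x - gam G t) <= (nrm b + rho) * e.
  move=> hx; have -> : x - gam G t = (x - z0) + tau G t * rc e * b by rewrite /z0; ring.
  apply: le_trans (nrmD _ _) _; rewrite nrmM nte; lra.
have Wx x : nrm (x - z0) <= e * rho -> e * (im b - rho) <= W G x.
  move=> hx; have := W_ge G t x.
  have -> : (x - gam G t) / tau G t = rc e * zt t e x.
    rewrite /zt; have := tau_neq0 t; have : rc e != 0 :> C by rewrite rc_eq0 gt_eqF.
    by move: (tau G t) (rc e) => u v v0 u0; field; rewrite u0 v0.
  rewrite imM re_rc im_rc mul0r addr0 => h; apply: le_trans h.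
  have h1 := ztb _ hx; have := im_le (zt t e x - b); rewrite imB ler_norml => /andP[h2 _].
  have h3 := gb _ hx.
  have h4 : nrm (x - gam G t) ^+ 2 <= ((nrm b + rho) * e) ^+ 2.
    by rewrite ler_pXn2r ?nnegrE // mulr_ge0 ?addr_ge0 // ltW.
  have h5 : (nrm b + rho) ^+ 2 * e * e <= (im b - rho) * e by rewrite ler_pM2r.
  have h6 : e * (im b - rho) <= e * im (zt t e x) by rewrite ler_wpM2l ?(ltW e0) //; lra.
  rewrite exprMn in h4; lra.
have clx x : nrm (x - z0) <= e * rho -> cl x.
  by move=> /Wx; apply: le_trans; rewrite mulr_ge0 ?(ltW e0) // subr_ge0 ltW.
have main x : nrm (x - z0) <= e * rho -> nrm (pv1 F x - c * d) <= eta' * nrm (c * d).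
  move=> hx; have h1 := HL x (clx _ hx) (gb _ hx); have h2 := H1 _ (ztb _ hx).
  have -> : pv1 F x - c * d = (pv1 F x - c * (1 + pv1 P (zt t e x))) + c * (1 + pv1 P (zt t e x) - d).
    by ring.
  apply: le_trans (nrmD _ _) _; rewrite nrmM in D1 *.
  have := ler_wpM2l (nrm_ge0 c) h2; rewrite nrmM; lra.
split; first by move=> x hx; split; [exact: Wx | exact: main].
pose H x := pv F x + (- (c * (tau G t * rc e))) * (zt t e x + pv P (zt t e x)).
pose Hd x := pv1 F x + (- (c * (tau G t * rc e))) * ((tau G t * rc e)^-1 + pv1 P (zt t e x) * (tau G t * rc e)^-1).
have cS := cvxI (W_cvx G) (@cvx_ball R (gam G t) ((nrm b + rho) * e)).
have cH x : ([set z | 0 <= W G z] `&` [set z | nrm (z - gam G t) <= (nrm b + rho) * e]) x -> cd H x (Hd x).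
  move=> [hx _]; apply: cd_add; first by have [] := SF x hx.
  apply: cd_scale; apply: cd_add; first exact: cd_zt.
  by apply: cd_comp; [exact: cd_zt | apply: HP; exact: im_zt].
have bH x : ([set z | 0 <= W G z] `&` [set z | nrm (z - gam G t) <= (nrm b + rho) * e]) x -> nrm (Hd x) <= dl.
  move=> [hx hx2]; have := HL x hx hx2.
  suff -> : Hd x = pv1 F x - c * (1 + pv1 P (zt t e x)) by [].
  by rewrite /Hd; move: (tau G t * rc e) te0 => u u0; field.
have z00 : nrm (z0 - z0) <= e * rho by rewrite subrr nrm0 mulr_ge0 // ltW.
have Sz : ([set z | 0 <= W G z] `&` [set z | nrm (z - gam G t) <= (nrm b + rho) * e]) z0.
  by split; [exact: clx | exact: gb].
have Sg : ([set z | 0 <= W G z] `&` [set z | nrm (z - gam G t) <= (nrm b + rho) * e]) (gam G t).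
  by split; rewrite /= ?W_gam // subrr nrm0 mulr_ge0 ?addr_ge0 // ltW.
have := cd_lip0 cS cH bH Sg Sz.
have zz : zt t e z0 = b.
  apply/eqP; rewrite -subr_eq0 -nrm_eq0; have := ztb z0 z00.
  by rewrite /zt /z0 (addrC (gam G t)) addrK mulrC mulKf // subrr nrm0.
rewrite /H zz zt_gam => h.
have -> : pv F z0 - pv F (gam G t) =
  (pv F z0 + - (c * (tau G t * rc e)) * (b + pv P b)
    - (pv F (gam G t) + - (c * (tau G t * rc e)) * (0 + pv P 0)))
  + c * (tau G t * rc e) * (b + pv P b - pv P 0) by ring.
apply: le_trans (nrmD _ _) _; apply: le_trans (lerD h (lexx _)) _.
have -> : z0 - gam G t = tau G t * rc e * b by rewrite /z0; ring.
rewrite !nrmM tau1 nrm_rc mul1r (ger0_norm (ltW e0)); rewrite nrmM in D1 D2 *.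
have h3 := ler_wpM2l (mulr_ge0 (nrm_ge0 c) (ltW e0)) H2.
have h4 := ler_wpM2r (ltW e0) D2.
lra.
Qed.

End Insertion.
Arguments W_cvx {R} g.

(** * The half-plane and the disc *)

Section Geometries.
Variable R : realType.
Local Notation C := (Cplx R).
Implicit Types (z w p : C) (s t T r e : R).

Lemma half_geom_exists : exists G : geom R,
  (forall z, W G z = 2 * im z) /\ (forall t, gam G t = rc t) /\ (forall t, tau G t = 1).
Proof.
have sub1 z t : 2 * im ((z - rc t) / 1) = 2 * im z by rewrite divr1 !reimE subr0.
have H1 : cvx [set z : C | 0 <= 2 * im z].
  move=> a b t; rewrite /= !pmulr_rge0 // => ha hb ht.
  exact: (cvx_half ha hb ht).
have H3 t z : 2 * im z <= 2 * im ((z - rc t) / 1) by rewrite sub1.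
have H4 t z : 2 * im ((z - rc t) / 1) - nrm (z - rc t) ^+ 2 <= 2 * im z.
  by rewrite sub1 lerBlDr lerDl sqr_ge0.
have H5 t : 2 * im (rc t : C) = 0 by rewrite im_rc mulr0.
have H6 z e : 0 < e -> exists2 r : R, 0 < r & forall w, nrm (w - z) <= r -> `|2 * im w - 2 * im z| <= e.
  move=> e0; exists (e / 2); first by rewrite divr_gt0.
  move=> w hw; rewrite -mulrBr -imB normrM ger0_norm //.
  by have := im_le (w - z); lra.
have nn s t : nrm (rc s - rc t : C) = `|s - t| by rewrite -rcB nrm_rc.
have H7 T : exists2 c : R, 0 < c <= 1 &
    forall s t : R, `|s| <= T -> `|t| <= T -> c * `|s - t| <= nrm (rc s - rc t : C).
  by exists 1; [rewrite ltr01 lexx | move=> s t _ _; rewrite nn mul1r].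
have H8 s t : nrm (rc s - rc t : C) <= 2 * `|s - t|.
  by rewrite nn; have := normr_ge0 (s - t); lra.
have real p : 2 * im p = 0 -> p = rc (re p).
  by move=> h; apply: reimP; rewrite ?re_rc ?im_rc //; lra.
have H9 p e : 2 * im p = 0 -> 0 < e -> exists t, nrm (rc t - p) < e.
  by move=> /real h e0; exists (re p); rewrite -h subrr nrm0.
have H10 r : exists2 T : R, 0 <= T &
    forall p, 2 * im p = 0 -> nrm p <= r -> exists2 t : R, `|t| <= T & p = rc t \/ p = - rc t.
  exists `|r| => // p /real h hr; exists (re p); last by left.
  by apply: le_trans (re_le p) (le_trans hr (ler_norm _)).
have H11 t : 2 * im (- rc t : C) = 0 by rewrite imN im_rc oppr0 mulr0.
have H2 (t : R) : nrm (1 : C) = 1 by exact: nrm1.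
by exists (Geom H1 H2 H3 H4 H5 H6 H7 H8 H9 H10 H11).
Qed.

(** The rational parametrisation of the circle, which omits [-1]. Parameters with [|t| <= 1] give
    the right half, and the left half is its image under negation; this is why [gam_cover] admits
    [- gam t]. *)
Definition circ t : C := Complex ((1 - t ^+ 2) / (1 + t ^+ 2)) (2 * t / (1 + t ^+ 2)).

Let q0 t : 0 < 1 + t ^+ 2. Proof. by rewrite ltr_pwDl // sqr_ge0. Qed.

Lemma nrm_circ t : nrm (circ t) = 1.
Proof.
have q := q0 t; apply/eqP; rewrite -(@eqrXn2 _ 2) //; apply/eqP.
by rewrite nrm_sqr /circ /re /im /=; field; rewrite gt_eqF.
Qed.

Lemma circ_sub s t : nrm (circ s - circ t) ^+ 2 = 4 * (s - t) ^+ 2 / ((1 + s ^+ 2) * (1 + t ^+ 2)).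
Proof.
have q1 := q0 s; have q2 := q0 t.
by rewrite nrm_sqr !reimE /circ /re /im /=; field; rewrite !gt_eqF.
Qed.

Lemma circ_onto p : nrm p = 1 -> 1 + re p != 0 -> p = circ (im p / (1 + re p)).
Proof.
move=> h n0; have := nrm_sqr p; rewrite h expr1n.
have -> : p = Complex (re p) (im p) by case: p {h n0}.
rewrite /re in n0; rewrite /circ /re /im /=; move: (complex.Re p) (complex.Im p) n0 => x y n0 hn.
 have y2 : y ^+ 2 = 1 - x ^+ 2 by lra.
have e1 : 1 + (y / (1 + x)) ^+ 2 = 2 / (1 + x).
  by rewrite expr_div_n y2; field.
have x1 : (2 : R) != 0 by [].
rewrite e1; congr (Complex _ _).
  by rewrite expr_div_n y2; field.
by field.
Qed.

Lemma disc_geom_exists : exists G : geom R, forall z, W G z = 1 - nrm z ^+ 2.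
Proof.
have cN0 t : circ t != 0 by rewrite -nrm_gt0 nrm_circ.
have le1 z : (0 <= 1 - nrm z ^+ 2) = (nrm z <= 1).
  by rewrite subr_ge0 -[X in _ <= X](expr1n _ 2) ler_pXn2r ?nnegrE.
(* On the circle, twice the distance to the tangent exceeds [W] by exactly [nrm (z - circ t) ^+ 2];
   both [W_le] and [W_ge] follow. *)
have tang t z : 2 * im ((z - circ t) / (ii R * circ t)) = nrm (z - circ t) ^+ 2 + (1 - nrm z ^+ 2).
  have hc := cj_mul (circ t); rewrite nrm_circ expr1n rc1 in hc.
  have i0 : ii R != 0 by rewrite -nrm_gt0 nrm_ii.
  have -> : (ii R * circ t)^-1 = - ii R * cj (circ t).
    apply: (mulfI (x := ii R * circ t)); first by rewrite mulf_neq0.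
    rewrite divff ?mulf_neq0 //.
    have -> : ii R * circ t * (- ii R * cj (circ t)) = - (ii R * ii R) * (circ t * cj (circ t)) by ring.
    by rewrite ii2 hc; ring.
  have := nrm_sqr (circ t); rewrite nrm_circ expr1n.
  by rewrite !nrm_sqr !reimE; move: (re z) (im z) (re (circ t)) (im (circ t)) => a b c d h; lra.
have H1 : cvx [set z : C | 0 <= 1 - nrm z ^+ 2].
  move=> a b t; rewrite /= !le1 => ha hb ht.
  have := @cvx_ball R 0 1 a b t; rewrite /= !subr0; exact.
have H2 (t : R) : nrm (ii R * circ t) = 1 by rewrite nrmM nrm_ii nrm_circ mulr1.
have H3 t z : 1 - nrm z ^+ 2 <= 2 * im ((z - circ t) / (ii R * circ t)).
  by rewrite tang lerDr sqr_ge0.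
have H4 t z : 2 * im ((z - circ t) / (ii R * circ t)) - nrm (z - circ t) ^+ 2 <= 1 - nrm z ^+ 2.
  by rewrite tang addrAC subrr add0r.
have H5 t : 1 - nrm (circ t) ^+ 2 = 0 by rewrite nrm_circ expr1n subrr.
have H6 z e : 0 < e -> exists2 r : R, 0 < r &
    forall w, nrm (w - z) <= r -> `|1 - nrm w ^+ 2 - (1 - nrm z ^+ 2)| <= e.
  move=> e0; have k0 : 0 < 2 * nrm z + 1 by rewrite ltr_wpDl // mulr_ge0.
  pose r := Num.min 1 (e / (2 * nrm z + 1)).
  have r0 : 0 < r by rewrite lt_min ltr01 divr_gt0.
  have r1 : r <= 1 by rewrite ge_min lexx.
  have r2 : r * (2 * nrm z + 1) <= e by rewrite -ler_pdivlMr // ge_min lexx orbT.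
  clearbody r; exists r => // w hw.
  have h1 := nrm_lowB w z; have h2 := nrm_lowB z w; rewrite (nrmB z w) in h2.
  have d1 : `|nrm w - nrm z| <= r by rewrite ler_norml; apply/andP; split; lra.
  have -> : 1 - nrm w ^+ 2 - (1 - nrm z ^+ 2) = - ((nrm w - nrm z) * (nrm w + nrm z)) by ring.
  rewrite normrN normrM; apply: le_trans r2; apply: ler_pM => //.
  rewrite ger0_norm ?addr_ge0 //; lra.
have H7 T : exists2 c : R, 0 < c <= 1 &
    forall s t : R, `|s| <= T -> `|t| <= T -> c * `|s - t| <= nrm (circ s - circ t).
  have qT := q0 T.
  exists ((1 + T ^+ 2)^-1).
    by rewrite invr_gt0 qT invf_le1 // lerDl sqr_ge0.
  move=> s t hs ht; rewrite -(@ler_pXn2r _ 2) ?nnegrE ?mulr_ge0 ?invr_ge0 ?(ltW qT) //.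
  rewrite circ_sub exprMn real_normK ?num_real //.
  have T0 : 0 <= T by apply: le_trans hs.
  have a1 : s ^+ 2 <= T ^+ 2 by rewrite -real_normK ?num_real // ler_pXn2r ?nnegrE.
  have a2 : t ^+ 2 <= T ^+ 2 by rewrite -real_normK ?num_real // ler_pXn2r ?nnegrE.
  have b1 : (1 + s ^+ 2) * (1 + t ^+ 2) <= (1 + T ^+ 2) * (1 + T ^+ 2).
    by apply: ler_pM; rewrite ?(ltW (q0 _)) // lerD2l.
  have d0 := sqr_ge0 (s - t).
  have p1 : 0 < (1 + s ^+ 2) * (1 + t ^+ 2) by rewrite mulr_gt0.
  rewrite ler_pdivlMr //.
  have -> : (1 + T ^+ 2)^-1 ^+ 2 * (s - t) ^+ 2 * ((1 + s ^+ 2) * (1 + t ^+ 2))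
     = (s - t) ^+ 2 * (((1 + s ^+ 2) * (1 + t ^+ 2)) / ((1 + T ^+ 2) * (1 + T ^+ 2))).
    by field; rewrite gt_eqF.
  apply: le_trans (_ : (s - t) ^+ 2 * 1 <= _); last by lra.
  by rewrite ler_wpM2l // ler_pdivrMr ?mulr_gt0 // mul1r.
have H8 s t : nrm (circ s - circ t) <= 2 * `|s - t|.
  rewrite -(@ler_pXn2r _ 2) ?nnegrE ?mulr_ge0 // circ_sub exprMn real_normK ?num_real //.
  have p1 : 0 < (1 + s ^+ 2) * (1 + t ^+ 2) by rewrite mulr_gt0.
  rewrite ler_pdivrMr // [2 ^+ 2](_ : _ = 4); last by ring.
  apply: ler_peMr; first by rewrite mulr_ge0 ?sqr_ge0.
  rewrite mulrDl mul1r mulrDr mulr1.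
  have := sqr_ge0 s; have := sqr_ge0 t; have := mulr_ge0 (sqr_ge0 s) (sqr_ge0 t); lra.
have unit p : 1 - nrm p ^+ 2 = 0 -> nrm p = 1.
  move=> h; apply/eqP; rewrite -(@eqrXn2 _ 2) // expr1n; apply/eqP; lra.
have H9 p e : 1 - nrm p ^+ 2 = 0 -> 0 < e -> exists t, nrm (circ t - p) < e.
  move=> /unit h e0; have [n0|n0] := eqVneq (1 + re p) 0; last first.
    by exists (im p / (1 + re p)); rewrite -circ_onto // subrr nrm0.
  have rp : re p = -1 by lra.
  have ip : im p = 0.
    have := nrm_sqr p; rewrite h rp expr1n sqrrN expr1n => h2.
    by apply/eqP; rewrite -sqrf_eq0; apply/eqP; lra.
  (* The omitted point [-1] is approached for large parameters [u], at the distance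
     [2 / sqrt (1 + u^2)]. *)
  exists (2 / e); rewrite -(@ltr_pXn2r _ 2) ?nnegrE ?(ltW e0) //.
  have q := q0 (2 / e).
  rewrite nrm_sqr !reimE rp ip /circ /re /im /=.
  have A (u : R) : ((1 - u ^+ 2) / (1 + u ^+ 2) - -1) ^+ 2 + (2 * u / (1 + u ^+ 2) - 0) ^+ 2
    = 4 / (1 + u ^+ 2) by have qu := q0 u; field; rewrite gt_eqF.
  rewrite A.
  rewrite ltr_pdivrMr // mulrDr mulr1 expr_div_n.
  have -> : e ^+ 2 * (2 ^+ 2 / e ^+ 2) = 4 by field; rewrite gt_eqF.
  by rewrite ltrDr exprn_gt0.
have H10 r : exists2 T : R, 0 <= T & forall p, 1 - nrm p ^+ 2 = 0 -> nrm p <= r ->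
    exists2 t : R, `|t| <= T & p = circ t \/ p = - circ t.
  exists 1 => // p /unit h _.
  have pos w : nrm w = 1 -> 0 <= re w -> exists2 t : R, `|t| <= 1 & w = circ t.
    move=> hw w0; have d0 : 0 < 1 + re w by rewrite ltr_pwDl.
    exists (im w / (1 + re w)); last by apply: circ_onto; rewrite // gt_eqF.
    rewrite normrM normfV (gtr0_norm d0) ler_pdivrMr // mul1r.
    by have := im_le w; rewrite hw; lra.
  have [p0|p0] := leP 0 (re p).
    by have [t ht E] := pos p h p0; exists t => //; left.
  have [||t ht E] := pos (- p); rewrite ?nrmN // ?reN; first by lra.
  by exists t => //; right; rewrite -E opprK.
have H11 t : 1 - nrm (- circ t) ^+ 2 = 0 by rewrite nrmN.
by exists (Geom H1 H2 H3 H4 H5 H6 H7 H8 H9 H10 H11).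
Qed.

End Geometries.

(** * Bounds after an insertion *)

Section InsertionInvariant.
Variable R : realType.
Local Notation C := (Cplx R).
Implicit Types (z w x : C).

(** A point within [r] of its slot [j] has a derivative close to the product of [cc j] with that of
    the profile; beyond [r] the derivative is close to [pv1 F]. In both cases the modulus [v] of the
    model lies in [[L, H]] and the errors are at most [dl]. Passing from [T] to [T'] pays for the
    errors in both derivatives. *)
Lemma ins_inv (G : geom R) (F : prf R) (e : R) (tt : nat -> R) (PP : nat -> prf R) (s : seq nat)
    (L H T T' A B q r dl : R) :
  0 < e -> 0 <= A -> 0 <= B -> 0 <= H -> smooth G F ->
  (forall z, cl G z -> [/\ L <= nrm (pv1 F z), nrm (pv1 F z) <= H
     & W G z * nrm (pv2 F z) <= T * nrm (pv1 F z)]) ->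
  (forall z, cl G z -> nrm (pv2 F z) <= B) ->
  (forall i, is_prof A (PP i)) ->
  (forall i x, 0 <= im x -> [/\ L <= nrm (cc G F tt i) * nrm (1 + pv1 (PP i) x),
     nrm (cc G F tt i) * nrm (1 + pv1 (PP i) x) <= H
     & 2 * im x * nrm (pv2 (PP i) x) <= T * nrm (1 + pv1 (PP i) x)]) ->
  uniq s ->
  (forall z, cl G z -> exists2 j, j \in s & \sum_(i <- s | i != j) wt G e tt i z <= q) ->
  0 < r -> B * r + H * A * q <= dl -> H * A * (e / r + q) <= dl ->
  0 <= T -> T * dl + 2 * dl <= (T' - T) * (L - dl) -> T <= T' ->
  forall z, cl G z -> [/\ L - dl <= nrm (pv1 (ins G F e tt PP s) z),
     nrm (pv1 (ins G F e tt PP s) z) <= H + dl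
     & W G z * nrm (pv2 (ins G F e tt PP s) z) <= T' * nrm (pv1 (ins G F e tt PP s) z)].
Proof.
move=> e0 A0 B0 H0 SF F1 F2B PA PB us spread r0 near far T0 gap TT z hz.
have F1hi w : cl G w -> nrm (pv1 F w) <= H by case/F1.
have [j js hj] := spread z hz.
suff [v [V1 V2 V3 V4]] : exists v : R, [/\ L <= v, v <= H,
    `|nrm (pv1 (ins G F e tt PP s) z) - v| <= dl
    & W G z * nrm (pv2 (ins G F e tt PP s) z) <= T * v + 2 * dl].
  move: V3; rewrite ler_norml => /andP[V3 V5].
  split; [lra|lra|apply: le_trans V4 _].
  set u := nrm (pv1 (ins G F e tt PP s) z) in V3 V5 *.
  have h1 : T * v <= T * (u + dl) by rewrite ler_wpM2l //; lra.
  have h2 : (T' - T) * (L - dl) <= (T' - T) * u by rewrite ler_wpM2l //; lra.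
  lra.
have [hr|/ltW hr] := leP (nrm (z - gam G (tt j))) r.
  have n1 := ins_near1 e0 H0 A0 B0 SF F1hi F2B PA us js hz hj hr.
  have n2 := ins_near2 e0 H0 A0 F1hi F2B PA us js hz hj hr.
  have iz := im_zt (tt j) e0 hz.
  have [b1 b2 b3] := PB j _ iz.
  exists (nrm (cc G F tt j) * nrm (1 + pv1 (PP j) (zt G (tt j) e z))); split => //.
    rewrite -nrmM; apply: le_trans near; apply: le_trans n1.
    rewrite ler_norml; apply/andP; split; last exact: nrm_lowB.
    have := nrm_lowB (cc G F tt j * (1 + pv1 (PP j) (zt G (tt j) e z))) (pv1 (ins G F e tt PP s) z).
    by rewrite (nrmB (cc _ _ _ _ * _)); lra.
  apply: le_trans n2 _; have := ler_wpM2l (nrm_ge0 (cc G F tt j)) b3; lra.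
have f1 := ins_far1 e0 H0 A0 F1hi PA us js hz hj r0 hr.
have f2 := ins_far2 e0 H0 A0 F1hi PA us js hz hj r0 hr.
have [b1 b2 b3] := F1 z hz.
exists (nrm (pv1 F z)); split => //.
  apply: le_trans far; apply: le_trans f1.
  rewrite ler_norml; apply/andP; split; last exact: nrm_lowB.
  by have := nrm_lowB (pv1 F z) (pv1 (ins G F e tt PP s) z); rewrite (nrmB (pv1 F z)); lra.
have W0 : 0 <= W G z by [].
have : W G z * nrm (pv2 (ins G F e tt PP s) z) <=
    W G z * (nrm (pv2 F z) + nrm (pv2 (ins G F e tt PP s) z - pv2 F z)).
  rewrite ler_wpM2l //; apply: le_trans (nrmD _ _).
  by rewrite addrC subrK.
rewrite mulrDr; lra.
Qed.

(** Serves to choose one scale that meets a finite list of conditions [k * e <= d], each given as a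
    pair. *)
Lemma small_all (s : seq (R * R)) : all (fun p => 0 < p.2) s ->
  exists2 e, 0 < e <= 1 & forall e', 0 < e' <= e -> all (fun p => p.1 * e' <= p.2) s.
Proof.
elim: s => [|[k d] s IH] /=; first by exists 1; rewrite ?ltr01 ?lexx.
move=> /andP[d0 /IH[e /andP[e0 e1] he]].
have k1 : 0 < `|k| + 1 by rewrite ltr_wpDl.
exists (Num.min e (d / (`|k| + 1))).
  by rewrite lt_min e0 divr_gt0 //= ge_min e1.
move=> e' /andP[e'0]; rewrite le_min => /andP[h1 h2]; rewrite he ?e'0 // andbT.
move: h2; rewrite ler_pdivlMr // => h2; apply: le_trans h2.
by rewrite mulrC ler_wpM2l ?(ltW e'0) //; have := ler_norm k; lra.
Qed.

End InsertionInvariant.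

(** * Composition of profiles *)

Section Composition.
Variable R : realType.
Local Notation C := (Cplx R).
Implicit Types (z w x : C) (P Q : prf R).

Variable G : geom R.
Hypotheses (WG : forall z, W G z = 2 * im z) (gamG : forall t, gam G t = rc t)
  (tauG : forall t, tau G t = 1).

Definition idD P : prf R := Prf (fun x => x + pv P x) (fun x => 1 + pv1 P x) (pv2 P).
Let I P (e : R) Q := ins G (idD P) e (fun=> 0) (fun=> Q) [:: 0%N].
Let cmp P (e : R) Q : prf R := Prf (fun x => pv (I P e Q) x - x) (fun x => pv1 (I P e Q) x - 1) (pv2 (I P e Q)).

Let clG z : cl G z <-> 0 <= im z.
Proof. by rewrite /cl WG pmulr_rge0. Qed.

Let zt0 (e : R) z : zt G 0 e z = z / rc e.
Proof. by rewrite /zt gamG tauG rc0 subr0 mul1r. Qed.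

Let smooth_idD A P : is_prof A P -> smooth G (idD P).
Proof.
move=> H z /clG /H[h1 h2 _ _ _]; split => /=; first exact: cd_add (cd_id z) h1.
by have := cd_add (cd_const 1 z) h2; rewrite add0r.
Qed.

Let prof_bounds A P : 0 <= A -> is_prof A P -> forall z, cl G z ->
  nrm (pv1 (idD P) z) <= 1 + A /\ nrm (pv2 (idD P) z) <= A.
Proof.
move=> A0 H z /clG /H[_ _ _ h1 h2]; have w0 : 0 < 1 + nrm z by rewrite ltr_pwDl.
have w1 : 1 <= 1 + nrm z by rewrite lerDl.
split => /=.
  apply: le_trans (nrmD _ _) _; rewrite nrm1 lerD2l; apply: le_trans h1 _.
  by rewrite ler_pdivrMr // ler_peMr.
apply: le_trans h2 _; rewrite ler_pdivrMr ?exprn_gt0 // ler_peMr //.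
by rewrite exprn_ege1.
Qed.

(** A single copy of [Q] is inserted at 0 into [x + pv P x] on the half-plane. Away from 0 the
    bounds of [P] persist, near 0 the derivative is about [1 + pv1 P 0] times that of [x + pv Q x],
    and the overlap of [Q] is inherited. The strict inequalities leave room for the errors. *)
Lemma comp_exists P Q (A A' T T' l h l' h' L H : R) :
  0 <= A -> 0 <= A' -> is_prof A P -> is_prof A' Q -> pbound T l h P -> pbound T l' h' Q ->
  overlap Q -> 0 <= T -> T < T' -> 0 < L -> L < l -> h < H ->
  L < nrm (1 + pv1 P 0) * l' -> nrm (1 + pv1 P 0) * h' < H ->
  exists Q' : prf R, exists2 A'' : R, 0 < A'' & [/\ is_prof A'' Q', pbound T' L H Q' & overlap Q'].
Proof.
move=> A0 A'0 HP HQ BP BQ OQ T0 TT L0 Ll hH Ll' hH'.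
set c := 1 + pv1 P 0 in Ll' hH' *.
have z0 : 0 <= im (0 : C) by rewrite im0.
have n0 : 0 < nrm c by have [] := BP 0 z0; rewrite -/c; lra.
case: OQ => b [d] [rho] [eta] [[rho0 rhob d0 /andP[eta0 eta4]] O1 O2].
(* [overlap] asks only for a constant below 1/4, so the midpoint leaves room for the insertion. *)
pose eta' := (eta + 1 / 4) / 2.
have cd0 : c * d != 0 by rewrite mulf_neq0 // -nrm_gt0.
have ncd : 0 < nrm (c * d) by rewrite nrm_gt0.
pose H1 := Num.max h (nrm c * h'); pose L1 := Num.min l (nrm c * l').
have H1H : H1 < H by rewrite gt_max hH hH'.
have L1L : L < L1 by rewrite lt_min Ll Ll'.
have [H1a H1b] : h <= H1 /\ nrm c * h' <= H1 by rewrite !le_max !lexx orbT.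
have [L1a L1b] : L1 <= l /\ L1 <= nrm c * l' by rewrite !ge_min !lexx orbT.
clearbody H1 L1.
have H10 : 0 <= H1.
  by have [p1 p2 _] := BP 0 z0; apply: le_trans H1a; apply: le_trans p2.
pose dl := Num.min (Num.min (L1 - L) (H - H1)) ((T' - T) * L / (T + 2)).
have T2 : 0 < T + 2 by lra.
have dl0 : 0 < dl by rewrite !lt_min !subr_gt0 L1L H1H divr_gt0 // mulr_gt0 // subr_gt0.
have dl1 : dl <= L1 - L by rewrite !ge_min lexx.
have dl2 : dl <= H - H1 by rewrite !ge_min lexx orbT.
have dl3 : dl * (T + 2) <= (T' - T) * L by rewrite -ler_pdivlMr // !ge_min lexx !orbT.
clearbody dl.
pose r := dl / (A + 1); have r0 : 0 < r by rewrite divr_gt0 // ltr_wpDl.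
have Ar : A * r <= dl.
  by rewrite /r mulrCA ler_piMr ?(ltW dl0) // ler_pdivrMr ?ltr_wpDl // mul1r lerDl.
pose g := (eta' - eta) * nrm (c * d).
have g0 : 0 < g by rewrite mulr_gt0 // /eta'; lra.
have [|e /andP[e0 e1] /(_ e)] := @small_all R [:: (H1 * A' / r, dl); (A * (nrm b + rho), g);
   (A * (nrm b + rho) * nrm b, g * rho / 2); ((nrm b + rho) ^+ 2, im b - rho)].
  by rewrite /= dl0 g0 subr_gt0 rhob divr_gt0 // mulr_gt0.
rewrite e0 lexx => /(_ isT) /and5P[/= E1 E2 E3 E4 _].
have ia z : 0 <= im z -> cl G z by move/clG.
pose Q' := cmp P e Q.
have SF := smooth_idD HP.
have F1hi z : cl G z -> nrm (pv1 (idD P) z) <= 1 + A by case/(prof_bounds A0 HP).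
have F2B z : cl G z -> nrm (pv2 (idD P) z) <= A by case/(prof_bounds A0 HP).
have PA (i : nat) : is_prof A' ((fun=> Q) i) by [].
have A10 : 0 <= 1 + A by lra.
have SI : smooth G (I P e Q) := ins_smooth (fun=> 0) e0 SF PA [:: 0%N].
have sp z : \sum_(i <- [:: 0%N] | i != 0%N) wt G e (fun=> 0) i z <= 0.
  by rewrite big_cons big_nil.
have us : uniq [:: 0%N] by [].
have js : 0%N \in [:: 0%N] by [].
have ccE i : cc G (idD P) (fun=> 0) i = c by rewrite /cc /= gamG rc0.
have inv := @ins_inv R G (idD P) e (fun=> 0) (fun=> Q) [:: 0%N] L1 H1 T T' A' A 0 r dl
  e0 A'0 A0 H10 SF _ F2B PA _ us _ r0 _ _ T0 _ (ltW TT).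
have {}inv z : 0 <= im z -> [/\ L <= nrm (pv1 (I P e Q) z), nrm (pv1 (I P e Q) z) <= H
     & 2 * im z * nrm (pv2 (I P e Q) z) <= T' * nrm (pv1 (I P e Q) z)].
  move=> hz; have [||||||i1 i2 i3] := inv _ _ _ _ _ _ z (ia z hz).
  - by move=> w /clG hw; rewrite WG; have [b1 b2 b3] := BP w hw; split=> //=; lra.
  - move=> i x hx; rewrite ccE; have [b1 b2 b3] := BQ x hx; split=> //.
      by apply: le_trans L1b _; rewrite ler_wpM2l.
    by apply: le_trans H1b; rewrite ler_wpM2l.
  - by move=> w _; exists 0%N => //; exact: sp.
  - by rewrite mulr0 addr0.
  - by rewrite addr0; move: E1; rewrite mulrAC -mulrA.
  - have : (T' - T) * L <= (T' - T) * (L1 - dl) by rewrite ler_wpM2l //; lra.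
    lra.
  by rewrite WG in i3; split=> //; lra.
have wt_le z : wt G e (fun=> 0) 0%N z <= (1 + nrm z)^-1.
  have w0 : 0 < 1 + nrm z by rewrite ltr_pwDl.
  rewrite /wt zt0 lef_pV2 ?posrE // ?ltr_pwDl // lerD2l nrm_div nrm_rc gtr0_norm //.
  by rewrite ler_pdivlMr // ler_piMr.
have one z : I P e Q = I P e Q -> [/\ pv (I P e Q) z = z + pv P z + tv G (idD P) e (fun=> 0) (fun=> Q) 0%N z,
   pv1 (I P e Q) z = 1 + pv1 P z + tv1 G (idD P) e (fun=> 0) (fun=> Q) 0%N z
   & pv2 (I P e Q) z = pv2 P z + tv2 G (idD P) e (fun=> 0) (fun=> Q) 0%N z].
  by rewrite /I /= !big_cons !big_nil !addr0.
pose K := (1 + A) * A'; have K0 : 0 <= K by rewrite mulr_ge0.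
exists Q', (A + K + K / e + 1).
  by rewrite ltr_wpDl // !addr_ge0 // divr_ge0 // ltW.
have Ke0 : 0 <= K / e by rewrite divr_ge0 // ltW.
split.
- move=> x hx; have [s1 s2] := SI x (ia x hx); have [q1 q2 q3] := one x erefl.
  have [p1 p2 p3 p4 p5] := HP x hx.
  have w0 : 0 < (1 + nrm x)^-1 by rewrite invr_gt0 ltr_pwDl.
  have wl := wt_le x; have wp := wt_gt0 G e (fun=> 0) 0%N x.
  have t0 := tv_le (fun=> 0) e0 F1hi PA 0%N (ia x hx).
  have t1 := tv1_le (fun=> 0) e0 F1hi PA 0%N (ia x hx).
  have t2 := tv2_le (fun=> 0) e0 F1hi PA 0%N (ia x hx).
  rewrite -/K in t0 t1 t2.
  have kw := mulr_ge0 K0 (ltW w0); have kew := mulr_ge0 Ke0 (ltW w0).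
  have Kw := ler_wpM2l K0 wl.
  split.
  + by apply: cd_ext (cd_add s1 (cd_scale (-1) (cd_id x))) => [u|]; rewrite ?mulN1r ?mulr1.
  + by apply: cd_ext (cd_add s2 (cd_const (-1) x)); rewrite ?addr0.
  + have -> : pv Q' x = pv P x + tv G (idD P) e (fun=> 0) (fun=> Q) 0%N x.
      by rewrite [LHS](_ : _ = pv (I P e Q) x - x) // q1; ring.
    apply: le_trans (nrmD _ _) _.
    have : K * e * wt G e (fun=> 0) 0%N x <= K * wt G e (fun=> 0) 0%N x.
      by rewrite ler_wpM2r ?(ltW wp) // ler_piMr.
    lra.
  + have -> : pv1 Q' x = pv1 P x + tv1 G (idD P) e (fun=> 0) (fun=> Q) 0%N x.
      by rewrite [LHS](_ : _ = pv1 (I P e Q) x - 1) // q2; ring.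
    apply: le_trans (nrmD _ _) _; lra.
  + rewrite [pv2 Q' x](_ : _ = pv2 (I P e Q) x) // q3; apply: le_trans (nrmD _ _) _.
    have w2 : wt G e (fun=> 0) 0%N x ^+ 2 <= ((1 + nrm x) ^+ 2)^-1.
      by rewrite -exprVn ler_pXn2r ?nnegrE // ltW.
    have := ler_wpM2l Ke0 w2.
    have w20 : 0 < ((1 + nrm x) ^+ 2)^-1 by rewrite invr_gt0 exprn_gt0 // ltr_pwDl.
    have := mulr_ge0 K0 (ltW w20); lra.
- move=> x hx; have [i1 i2 i3] := inv x hx.
  have -> : 1 + pv1 Q' x = pv1 (I P e Q) x.
    by rewrite [pv1 Q' x](_ : _ = pv1 (I P e Q) x - 1) //; ring.
  by split.
- have near z : cl G z -> nrm (z - gam G 0) <= (nrm b + rho) * e ->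
      nrm (pv1 (I P e Q) z - c * (1 + pv1 Q (zt G 0 e z))) <= A * ((nrm b + rho) * e).
    move=> hz hr; have r'0 : 0 < (nrm b + rho) * e by rewrite mulr_gt0 // ltr_wpDl.
    have := ins_near1 (tt := fun=> 0) e0 A10 A'0 A0 SF F1hi F2B PA us js hz (sp z) hr.
    by rewrite mulr0 addr0 ccE.
  have [|||||u1 u2] := @overlap_local R G (I P e Q) Q 0 e (A * ((nrm b + rho) * e)) c b d rho eta eta'
    e0 _ SI rho0 rhob cd0 _ near (fun z hz => let: And5 h _ _ _ _ := HQ z hz in h) O1 O2 _ _ _.
  + by rewrite !mulr_ge0 ?addr_ge0 ?(ltW rho0) // ltW.
  + by rewrite /eta'; lra.
  + by rewrite mulrA.
  + by move: E3; rewrite /g; lra.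
  + by [].
  have zE : gam G 0 + tau G 0 * rc e * b = rc e * b by rewrite gamG tauG rc0 add0r mul1r.
  rewrite zE gamG rc0 in u1 u2.
  exists (rc e * b), (c * d), (e * rho), eta'; split.
  + split; [by rewrite mulr_gt0 | | by [] | by apply/andP; rewrite /eta'; split; lra].
    by rewrite imM re_rc im_rc mul0r addr0 ltr_pM2l.
  + move=> x hx; have [_ u3] := u1 x hx.
    have E : 1 + pv1 Q' x = pv1 (I P e Q) x.
      by rewrite [pv1 Q' x](_ : _ = pv1 (I P e Q) x - 1) //; ring.
    by rewrite E.
  + rewrite (_ : rc e * b + pv Q' (rc e * b) - pv Q' 0 = pv (I P e Q) (rc e * b) - pv (I P e Q) 0) //.
    have E x : pv Q' x = pv (I P e Q) x - x by [].
    by rewrite !E; ring.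
Qed.

End Composition.

(** * Profiles that hardly increase or hardly decrease the derivative *)

Section Profiles.
Variable R : realType.
Local Notation C := (Cplx R).
Implicit Types (z w x : C) (P Q : prf R) (s d l h T L H A : R).

Lemma cd_sqr z : cd (fun u : C => u * u) z (2 * z).
Proof.
move=> e e0; exists e => // h hh.
rewrite (_ : _ - _ = h * h); last by ring.
by rewrite nrmM ler_wpM2r // ltW.
Qed.

Let u0 x : C := (x + ii R)^-1.

(* [x + s / (x + i)], whose derivative is [1 + s] at 0 and has modulus in the interval from [1 - |s|] to [1 + |s|]. *)
Definition dip s : prf R := Prf (fun x => rc s * u0 x) (fun x => - rc s * (u0 x * u0 x))
  (fun x => rc (2 * s) * (u0 x * u0 x * u0 x)).

Let nrm_xi x : 0 <= im x -> [/\ 1 <= nrm (x + ii R), nrm x <= nrm (x + ii R) & im x <= nrm (x + ii R)].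
Proof.
move=> hx; have i1 : im (x + ii R) = im x + 1 by rewrite imD im_ii.
have h1 := im_nrm (x + ii R); rewrite i1 in h1; split; [lra| |lra].
by have := nrm_shift_up hx ler01; rewrite rc1 mulr1.
Qed.

Let nrm_u0 x : 0 <= im x -> [/\ nrm (u0 x) <= 1, nrm (u0 x) <= 2 / (1 + nrm x) & im x * nrm (u0 x) <= 1].
Proof.
move=> /nrm_xi[h1 h2 h3]; rewrite /u0 nrmV.
have p0 : 0 < nrm (x + ii R) by lra.
split; first by rewrite invf_le1.
  rewrite ler_pdivlMr ?ltr_pwDl // mulrC ler_pdivrMr //; lra.
by rewrite ler_pdivrMr // mul1r.
Qed.

Lemma dip_prof s : `|s| <= 1 -> is_prof 16 (dip s).
Proof.
move=> s1 x hx; have [n1 n2 n3] := nrm_u0 hx.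
have [h1 _ _] := nrm_xi hx.
have xi0 : x + ii R != 0 by rewrite -nrm_gt0; lra.
have D1 : cd u0 x (- (u0 x * u0 x)).
  have := cd_comp (f := fun u => u^-1) (cd_shift (ii R) x) (cd_inv xi0).
  by apply: cd_ext => //; rewrite /u0 mulr1 expr2.
have t0 : 0 < (1 + nrm x)^-1 by rewrite invr_gt0 ltr_pwDl.
have n0 : 0 <= nrm (u0 x) by [].
set t := (1 + nrm x)^-1 in n2 t0 *.
have b2 : nrm (u0 x) * nrm (u0 x) <= 2 * t * (2 * t) by apply: ler_pM.
have b3 : nrm (u0 x) * nrm (u0 x) <= 1 * (2 * t) by apply: ler_pM.
have sM (y : R) : 0 <= y -> `|s| * y <= y by move=> y0; rewrite ler_piMl.
split => /=.
- by apply: cd_ext (cd_scale (rc s) D1) => //; rewrite mulrN mulNr.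
- have := cd_scale (- rc s) (cd_comp (f := fun u => u * u) D1 (cd_sqr (u0 x))).
  by apply: cd_ext => //; rewrite rcM (_ : rc 2 = 2 :> C); [ring | rewrite -[2]/(1 + 1) rcD rc1].
- rewrite nrmM nrm_rc; apply: le_trans (sM _ n0) _; rewrite -/t; lra.
- rewrite nrmM nrmN nrm_rc nrmM; apply: le_trans (sM _ (mulr_ge0 n0 n0)) _; rewrite -/t; lra.
- rewrite nrmM nrm_rc normrM !nrmM ger0_norm //.
  have q0 : 0 <= nrm (u0 x) * nrm (u0 x) * nrm (u0 x) by rewrite !mulr_ge0.
  have := sM _ q0; rewrite -exprVn -/t.
  have : nrm (u0 x) * nrm (u0 x) * nrm (u0 x) <= 2 * t * (2 * t) * 1.
    by apply: ler_pM => //; rewrite mulr_ge0.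
  have := mulr_ge0 (ltW t0) (ltW t0); rewrite expr2; lra.
Qed.

Lemma dip_bound s T : `|s| <= 1 / 5 -> 1 <= T -> pbound T (1 - `|s|) (1 + `|s|) (dip s).
Proof.
move=> s1 T1 x hx; have [n1 n2 n3] := nrm_u0 hx; rewrite /dip /=.
have n0 : 0 <= nrm (u0 x) by [].
have q1 : nrm (u0 x) * nrm (u0 x) <= 1 * 1 by apply: ler_pM.
have q2 : nrm (- rc s * (u0 x * u0 x)) <= `|s|.
  by rewrite nrmM nrmN nrm_rc nrmM ler_piMr //; lra.
have h1 := nrmD 1 (- rc s * (u0 x * u0 x)); have h2 := nrm_lowD 1 (- rc s * (u0 x * u0 x)).
rewrite nrm1 in h1 h2; split; [lra|lra|].
rewrite nrmM nrm_rc normrM ger0_norm // !nrmM.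
have q3 : im x * nrm (u0 x) * (nrm (u0 x) * nrm (u0 x)) <= 1 * 1.
  by apply: ler_pM => //; rewrite ?mulr_ge0 //; lra.
have q4 : `|s| * (im x * nrm (u0 x) * (nrm (u0 x) * nrm (u0 x))) <= `|s| * 1.
  by rewrite ler_wpM2l //; lra.
set v := nrm (1 + _) in h1 h2 *.
have : 1 * v <= T * v by rewrite ler_wpM2r //; lra.
lra.
Qed.

Lemma dip_at0 s : 1 + pv1 (dip s) 0 = rc (1 + s).
Proof.
rewrite /dip /= /u0 add0r iiV mulrNN ii2 rcD rc1; ring.
Qed.

(** Each composition raises [T] a little. Asking for all [T > T0] at once lets compositions be
    repeated any number of times with the same [T0]. *)
Definition good T0 l h := forall T, T0 < T -> exists Q, exists2 A, 0 < A &
  [/\ is_prof A Q, pbound T l h Q & overlap Q].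

(* Inserting a small copy of [Q] into [dip s] at 0 multiplies the derivative of [x + pv Q x] by [1 + s]. *)
Lemma good_step T0 s l h L H : 1 <= T0 -> `|s| <= 1 / 5 -> good T0 l h ->
  0 < L -> L < 1 - `|s| -> 1 + `|s| < H -> L < (1 + s) * l -> (1 + s) * h < H -> good T0 L H.
Proof.
move=> T01 s1 Gl L0 L1 H1 L2 H2 T TT.
have [G [W1 [W2 W3]]] := half_geom_exists R.
have [|Q [A A0 [HQ BQ OQ]]] := Gl ((T0 + T) / 2); first by lra.
have T2 : 1 <= (T0 + T) / 2 by lra.
have sp : 0 <= 1 + s by move: s1; rewrite ler_norml => /andP[]; lra.
have n0 : nrm (1 + pv1 (dip s) 0) = 1 + s by rewrite dip_at0 nrm_rc ger0_norm.
have s2 : `|s| <= 1 by lra.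
apply: (comp_exists W1 W2 W3 _ (ltW A0) (dip_prof s2) HQ (dip_bound s1 T2) BQ OQ) => //; rewrite ?n0 //; lra.
Qed.

Lemma good_mono T0 l h L H : L <= l -> h <= H -> good T0 l h -> good T0 L H.
Proof.
move=> Ll hH Gl T /Gl[Q [A A0 [q1 q2 q3]]]; exists Q, A => //; split => // x /q2[b1 b2 b3].
split => //; lra.
Qed.

Lemma pow_small (q x : R) : 0 < q < 1 -> 0 < x -> exists n, q ^+ n <= x.
Proof.
move=> /andP[q0 q1] x0.
have bern n : 1 + n%:R * (q^-1 - 1) <= q^-1 ^+ n.
  have y0 : 0 <= q^-1 - 1 by rewrite subr_ge0 invr_ge1 // ?unitfE ?gt_eqF // ltW.
  elim: n => [|n IH]; first by rewrite mul0r addr0 expr0.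
  rewrite exprS; have i0 : 0 <= q^-1 by rewrite invr_ge0 ltW.
  apply: le_trans (ler_wpM2l i0 IH).
  have := mulr_ge0 (mulr_ge0 y0 y0) (ler0n R n); rewrite -natr1; lra.
have y0 : 0 < q^-1 - 1 by rewrite subr_gt0 invf_gt1.
have := archi_boundP (_ : 0 <= (x * (q^-1 - 1))^-1); set N := Num.bound _.
rewrite invr_ge0 mulr_ge0 ?(ltW x0) ?(ltW y0) // => /(_ isT) hN; exists N.
have h := bern N.
have : x^-1 <= q^-1 ^+ N.
  apply: le_trans h; move: hN; rewrite invfM -(ltr_pM2r y0) divfK ?gt_eqF //; lra.
by rewrite exprVn lef_pV2 ?posrE // exprn_gt0.
Qed.

Lemma least_pow (q h : R) : 0 < q < 1 -> 1 <= h -> exists K, q ^+ K * h <= 1 /\ q <= q ^+ K * h.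
Proof.
move=> hq h1; have h0 : 0 < h by lra.
case/andP: (hq) => q0 q1.
have ex : exists n, (fun n => q ^+ n * h <= 1) n.
  have hi0 : 0 < h^-1 by rewrite invr_gt0.
  have [n hn] := pow_small hq hi0; exists n.
  by rewrite -ler_pdivlMr // mul1r.
case: (ex_minnP ex) => -[|K] hK mK.
  by exists 0%N; split => //; rewrite expr0; lra.
exists K.+1; split => //; rewrite exprS -mulrA ler_pMr // leNgt; apply/negP => /ltW /mK.
by rewrite ltnn.
Qed.

(** Each step inserts into [dip (- d)], which multiplies the bounds near 0 by [1 - d]; with
    [q = 1 - d / 2] one has [q ^+ 3 < 1 - d < q]. Once [q ^+ K * h] lies in [[q, 1]], the lower
    bound has lost at most the factor [(2 * h) ^+ 3], whatever [d] is. *)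
Lemma good_down T0 l h d : 1 <= T0 -> 0 < d <= 1 / 8 -> 0 < l <= 1 / 2 -> 1 <= h -> good T0 l h ->
  good T0 (l / (2 * h) ^+ 3) (1 + 3 * d).
Proof.
move=> T01 /andP[d0 d8] /andP[l0 l2] h1 Gl.
pose q := 1 - d / 2; have q0 : 0 < q by rewrite /q; lra.
have q1 : q < 1 by rewrite /q; lra.
have q3 : q ^+ 3 < 1 - d.
  by rewrite /q; have := mulr_gt0 d0 d0; have := mulr_gt0 d0 (mulr_gt0 d0 d0); nra.
have K3 K : 0 < q ^+ K <= 1 by rewrite exprn_gt0 // exprn_ile1 // ltW.
have it K : good T0 (l * (q ^+ K) ^+ 3) (Num.max (1 + 3 * d) (q ^+ K * h)).
  elim: K => [|K IH].
    by apply: good_mono Gl; rewrite expr0 ?expr1n ?mulr1 // le_max mul1r lexx orbT.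
  have /andP[k0 k1] := K3 K.
  have k30 : 0 < l * (q ^+ K) ^+ 3 by rewrite mulr_gt0 // exprn_gt0.
  have k31 : l * (q ^+ K) ^+ 3 <= l * 1 by rewrite ler_pM2l // exprn_ile1 // ltW.
  have E : l * (q ^+ K.+1) ^+ 3 = l * (q ^+ K) ^+ 3 * q ^+ 3.
    by rewrite [q ^+ K.+1]exprS exprMn mulrCA mulrC.
  have c3 : 0 < q ^+ 3 by rewrite exprn_gt0.
  apply: (good_step (s := - d) T01 _ IH); rewrite ?normrN ?(gtr0_norm d0).
  - by lra.
  - by rewrite E mulr_gt0.
  - rewrite E; have : l * (q ^+ K) ^+ 3 * q ^+ 3 <= 1 / 2 * 1.
      by apply: ler_pM; rewrite ?(ltW c3) ?(ltW k30) //; lra.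
    lra.
  - by rewrite lt_max; apply/orP; left; lra.
  - by rewrite E mulrC ltr_pM2r.
  - rewrite lt_max; have [hm|hm] := leP (1 + 3 * d) (q ^+ K * h); apply/orP; [right|left].
      rewrite exprS -mulrA ltr_pM2r; first by rewrite /q; lra.
      by rewrite mulr_gt0 //; lra.
    by have := mulr_gt0 d0 d0; nra.
have [|K [hK1 hK2]] := least_pow (q := q) (h := h) _ h1; first by rewrite q0.
apply: good_mono (it K); last by rewrite ge_max lexx /=; lra.
rewrite ler_pM2l // -exprVn ler_pXn2r ?nnegrE ?invr_ge0 ?exprn_ge0 ?(ltW q0) //; last by lra.
rewrite invfM ler_pdivrMr; last by lra.
by rewrite /q in hK2 *; lra.
Qed.

(** The mirror image of [good_down], with [p = 1 + d / 2] and [p < 1 + d < p ^+ 3]. *)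
Lemma good_up T0 l h d : 1 <= T0 -> 0 < d <= 1 / 8 -> 0 < l <= 1 -> 2 <= h -> good T0 l h ->
  good T0 (1 - 3 * d) (h * (2 / l) ^+ 3).
Proof.
move=> T01 /andP[d0 d8] /andP[l0 l1] h1 Gl.
pose p := 1 + d / 2; have p1 : 1 < p by rewrite /p; lra.
have p3 : 1 + d < p ^+ 3.
  by rewrite /p; have := mulr_gt0 d0 d0; have := mulr_gt0 d0 (mulr_gt0 d0 d0); nra.
have K1 K : 1 <= p ^+ K by rewrite exprn_ege1 // ltW.
have it K : good T0 (Num.min (1 - 3 * d) (p ^+ K * l)) (h * (p ^+ K) ^+ 3).
  elim: K => [|K IH].
    by apply: good_mono Gl; rewrite ?expr0 ?expr1n ?mulr1 // mul1r ge_min lexx orbT.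
  have k0 : 0 < p ^+ K by apply: lt_le_trans (K1 K).
  have k3 : 1 <= (p ^+ K) ^+ 3 by rewrite exprn_ege1.
  have k4 : 0 < h * (p ^+ K) ^+ 3 by rewrite mulr_gt0 //; lra.
  have k5 : h * 1 <= h * (p ^+ K) ^+ 3 by rewrite ler_wpM2l //; lra.
  have E : h * (p ^+ K.+1) ^+ 3 = h * (p ^+ K) ^+ 3 * p ^+ 3.
    by rewrite [p ^+ K.+1]exprS exprMn mulrCA mulrC.
  have k6 : h * (p ^+ K) ^+ 3 * 1 <= h * (p ^+ K) ^+ 3 * p ^+ 3.
    by rewrite ler_wpM2l ?(ltW k4) //; lra.
  apply: (good_step (s := d) T01 _ IH); rewrite ?(gtr0_norm d0).
  - by lra.
  - by rewrite lt_min mulr_gt0 ?exprn_gt0 ?andbT //; lra.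
  - by rewrite gt_min; apply/orP; left; lra.
  - by rewrite E; lra.
  - rewrite gt_min; have [hm|hm] := leP (1 - 3 * d) (p ^+ K * l); apply/orP; [left|right].
      by have := mulr_gt0 d0 d0; nra.
    by rewrite exprS -mulrA ltr_pM2r ?mulr_gt0 // /p; lra.
  - by rewrite E mulrC ltr_pM2l.
have i0 : 0 < p^-1 < 1 by rewrite invr_gt0 invf_lt1 ?p1 ?andbT //; lra.
have [|K [hK1 hK2]] := least_pow (h := l^-1) i0; first by rewrite invf_ge1.
have k0 : 0 < p ^+ K by apply: lt_le_trans (K1 K).
have p0 : 0 < p by lra.
have E1 : 1 <= p ^+ K * l.
  by move: hK1; rewrite exprVn -invfM invf_le1 ?mulr_gt0.
have E2 : p ^+ K * l <= p.
  by move: hK2; rewrite exprVn -invfM lef_pV2 ?posrE ?mulr_gt0.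
apply: good_mono (it K); first by rewrite le_min lexx /=; lra.
rewrite ler_wpM2l //; first by lra.
rewrite ler_pXn2r ?nnegrE ?divr_ge0 ?(ltW k0) ?(ltW l0) // ler_pdivlMr //.
by rewrite /p in E2 *; lra.
Qed.

Lemma is_prof_mono A A' P : A <= A' -> is_prof A P -> is_prof A' P.
Proof.
move=> AA H x hx; have [h1 h2 h3 h4 h5] := H x hx.
have w0 : 0 < 1 + nrm x by rewrite ltr_pwDl.
split=> //; [apply: le_trans h3 _ | apply: le_trans h4 _ | apply: le_trans h5 _];
  by rewrite ler_wpM2r // invr_ge0 ?exprn_ge0 // ltW.
Qed.

Lemma profiles_exist T : 1 < T -> exists lo hi, [/\ 0 < lo, lo <= 1 & 1 <= hi] /\
  forall d, 0 < d <= 1 / 8 -> exists A Pm Pp, [/\ 0 < A, is_prof A Pm & is_prof A Pp] /\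
   [/\ pbound T lo (1 + 3 * d) Pm, pbound T (1 - 3 * d) hi Pp, overlap Pm & overlap Pp].
Proof.
move=> T1; pose T0 := (1 + T) / 2.
have T01 : 1 < T0 by rewrite /T0; lra.
have [P [A [l [h [A0 l0 HP BP OP]]]]] := pattern_exists T01.
pose l' := Num.min l (1 / 2); pose h' := Num.max h 2.
have Gl : good T0 l' h'.
  move=> T' TT; exists P, A => //; split => // x hx; have [b1 b2 b3] := BP x hx.
  split; [by rewrite ge_min b1 | by rewrite le_max b2 | apply: le_trans b3 _].
  by rewrite ler_wpM2r // ltW.
have l'0 : 0 < l' by rewrite lt_min l0; lra.
have l'2 : l' <= 1 / 2 by rewrite ge_min lexx orbT.
have h'2 : 2 <= h' by rewrite le_max lexx orbT.
clearbody l' h'.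
have hh : 1 <= (2 * h') ^+ 3 by rewrite exprn_ege1 //; lra.
have ll : 1 <= (2 / l') ^+ 3 by rewrite exprn_ege1 // ler_pdivlMr //; lra.
exists (l' / (2 * h') ^+ 3), (h' * (2 / l') ^+ 3); split.
  split; first by rewrite divr_gt0 //; lra.
    rewrite ler_pdivrMr; last by lra.
    by rewrite mul1r; lra.
  have : h' * 1 <= h' * (2 / l') ^+ 3 by rewrite ler_wpM2l //; lra.
  lra.
move=> d hd; have T0T : T0 < T by rewrite /T0; lra.
have [||Pm [Am Am0 [m1 m2 m3]]] := good_down (ltW T01) hd _ _ Gl T0T; [by rewrite l'0|lra|].
have [||Pp [Ap Ap0 [p1 p2 p3]]] := good_up (ltW T01) hd _ _ Gl T0T; [by rewrite l'0; lra|lra|].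
exists (Num.max Am Ap), Pm, Pp; split.
  split; first by rewrite lt_max Am0.
    by apply: is_prof_mono m1; rewrite le_max lexx.
  by apply: is_prof_mono p1; rewrite le_max lexx orbT.
by split.
Qed.

End Profiles.

(** * Harmonic sums and exponential growth *)

Section Counting.
Variable R : realType.
Local Notation C := (Cplx R).

Definition harm (M : nat) : R := \sum_(0 <= i < M) (i.+1%:R)^-1.

Lemma harm_mono M N : (M <= N)%N -> harm M <= harm N.
Proof.
move=> MN; rewrite /harm [leRHS](big_cat_nat (n := M)) //= lerDl.
by apply: sumr_ge0 => i _; rewrite invr_ge0.
Qed.

(** Each dyadic block of the harmonic sum contributes at most 1. *)
Lemma harm_pow p : harm (2 ^ p) <= p.+1%:R.
Proof.
elim: p => [|p IH]; first by rewrite /harm expn0 big_nat1 invr1.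
have h : (2 ^ p <= 2 ^ p.+1)%N by rewrite leq_exp2l.
rewrite /harm (big_cat_nat (n := (2 ^ p)%N)) //= -/(harm _) -[p.+2%:R]natr1; apply: lerD => //.
apply: le_trans (_ : \sum_(2 ^ p <= i < 2 ^ p.+1) ((2 ^ p)%:R : R)^-1 <= _).
  apply: ler_sum_nat => i /andP[hi _]; rewrite lef_pV2 ?posrE ?ltr0n ?expn_gt0 // ler_nat.
  exact: leqW.
rewrite sumr_const_nat expnS mul2n -addnn addnK -[leLHS]mulr_natl divff //.
Qed.

Lemma sum_dist j M : (j < M)%N ->
  \sum_(i <- iota 0 M | i != j) `|i%:R - j%:R : R|^-1 <= 2 * harm M.
Proof.
move=> jM; rewrite -[M in iota 0 M]subn0 -/(index_iota 0 M).
rewrite (big_cat_nat (n := j)) //=; last exact: ltnW.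
rewrite [X in _ + X]big_ltn_cond //= eqxx /=.
have h1 : \sum_(0 <= i < j | i != j) `|i%:R - j%:R : R|^-1 = harm j.
  rewrite big_nat_cond (eq_bigl (fun i => (0 <= i < j)%N)); last first.
    by move=> i /=; case: ltnP => // h; rewrite ltn_eqF.
  rewrite -big_nat big_nat_rev /=; apply: eq_big_nat => i /andP[_ hi].
  by rewrite add0n natrB // addrAC subrr add0r normrN ger0_norm.
have h2 : \sum_(j.+1 <= i < M | i != j) `|i%:R - j%:R : R|^-1 = harm (M - j.+1).
  rewrite big_nat_cond (eq_bigl (fun i => (j.+1 <= i < M)%N)); last first.
    by move=> i /=; case: (leqP j.+1 i) => //= h; rewrite gtn_eqF // andbT.
  rewrite -big_nat -[j.+1]add0n big_addn add0n; apply: eq_big_nat => i _.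
  by rewrite -addSnnS natrD addrK ger0_norm.
have m1 := harm_mono (ltnW jM); have m2 := harm_mono (leq_subr j.+1 M).
by rewrite h1 h2; lra.
Qed.

(** The term of order [k + 1] of the exponential series beats the power [k] of [n] by a factor of
    order [n]. *)
Lemma growth k p (a : R) : 0 < a -> forall n0, exists2 n, (n0 <= n)%N & hp n * (n + p)%:R ^+ k <= a.
Proof.
move=> a0 n0; have l0 : 0 < ln 2 :> R by rewrite ln_gt0 // ltr1n.
have [f f0 hf] : exists2 f : R, 0 < f & forall x : R, 0 <= x -> 1 + x ^+ k.+1 / f <= expR x.
  by exists (k.+1)`!%:R; [rewrite ltr0n fact_gt0 | move=> x; exact: expR_ge1Dxn].
set K : R := (1 + p%:R) ^+ k * f / ln 2 ^+ k.+1.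
have K0 : 0 <= K by rewrite divr_ge0 ?exprn_ge0 ?mulr_ge0 ?exprn_ge0 ?addr_ge0 // ltW.
pose n := (n0 + Num.bound (K / a)).+1.
have nn0 : (n0 <= n)%N by rewrite /n ltnW // ltnS leq_addr.
have n1 : 1 <= n%:R :> R by rewrite ler1n.
have nK : K / a <= n%:R.
  have := archi_boundP (divr_ge0 K0 (ltW a0)) => /ltW /le_trans; apply.
  by rewrite ler_nat /n leqW // leq_addl.
clearbody n; exists n => //.
have e2 : (2 : R) ^+ n = expR (n%:R * ln 2) by rewrite expRM_natl lnK // posrE.
have := hf (n%:R * ln 2); rewrite -e2 mulr_ge0 ?(ltW l0) // => /(_ isT) h.
have nl : (n%:R * ln 2) ^+ k.+1 <= f * 2 ^+ n.
  by rewrite -ler_pdivrMl // mulrC; apply: le_trans h; rewrite lerDr.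
have np : (n + p)%:R <= n%:R * (1 + p%:R) :> R.
  by rewrite natrD mulrDr mulr1 lerD2l ler_peMl.
have npk : (n + p)%:R ^+ k <= n%:R ^+ k * (1 + p%:R) ^+ k :> R.
  by rewrite -exprMn; apply: lerXn2r => //; rewrite nnegrE ?mulr_ge0 ?addr_ge0.
have t0 : 0 < (2 : R) ^+ n by rewrite exprn_gt0.
rewrite /hp exprVn mulrC ler_pdivrMr //; apply: le_trans npk _.
have lk : 0 < ln 2 ^+ k.+1 :> R by rewrite exprn_gt0.
have nn : 0 < n%:R :> R by lra.
have q1 : K * ln 2 ^+ k.+1 = (1 + p%:R) ^+ k * f by rewrite /K divfK // gt_eqF.
have q2 : n%:R ^+ k.+1 * ln 2 ^+ k.+1 <= f * 2 ^+ n by rewrite -exprMn.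
have q3 : K <= a * n%:R by rewrite -ler_pdivrMl // mulrC.
rewrite -(ler_pM2r (mulr_gt0 nn lk)).
have -> : n%:R ^+ k * (1 + p%:R) ^+ k * (n%:R * ln 2 ^+ k.+1) =
   (1 + p%:R) ^+ k * (n%:R ^+ k.+1 * ln 2 ^+ k.+1) :> R by rewrite [n%:R ^+ k.+1]exprS; ring.
have pk : 0 <= (1 + p%:R) ^+ k :> R by rewrite exprn_ge0 // addr_ge0.
apply: le_trans (ler_wpM2l pk q2) _.
have -> : (1 + p%:R) ^+ k * (f * 2 ^+ n) = K * ln 2 ^+ k.+1 * 2 ^+ n by rewrite q1 mulrA.
have := ler_wpM2r (mulr_ge0 (ltW lk) (ltW t0)) q3; lra.
Qed.

End Counting.

(** * Grids of insertion points *)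

Section Slots.
Variable R : realType.
Local Notation C := (Cplx R).
Variable G : geom R.
Variables (k n : nat).

(** The slots are the multiples of [hp n] in [[- (k + 1), k + 1]], numbered from the left; the slot
    of index [nslot] is 0. *)
Definition nslot : nat := (k.+1 * 2 ^ n)%N.
Definition slot (i : nat) : R := (i%:R - nslot%:R) * hp n.
Definition slots : seq nat := iota 0 (2 * nslot).+1.
(* Bounds the harmonic sum over the slots: copies of size smaller than the grid width by this factor
   hardly disturb each other. *)
Definition lgn : R := (n + k + 3)%:R.

Lemma hp_pow : (2 ^ n)%:R * hp n = 1 :> R.
Proof. by rewrite /hp natrX -exprMn divff // expr1n. Qed.

Lemma nslot_hp : nslot%:R * hp n = k.+1%:R :> R.
Proof. by rewrite /nslot natrM -mulrA hp_pow mulr1. Qed.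

Lemma slot_le i : i \in slots -> `|slot i| <= k.+1%:R.
Proof.
rewrite mem_iota add0n ltnS => /andP[_ hi].
rewrite -nslot_hp /slot normrM (ger0_norm (ltW (hp_gt0 R n))) ler_pM2r ?hp_gt0 //.
have : i%:R <= (2 * nslot)%:R :> R by rewrite ler_nat.
rewrite natrM => h; have := ler0n R i; rewrite ler_norml => h0; apply/andP; split; lra.
Qed.

Lemma slot_sub i j : slot i - slot j = (i%:R - j%:R) * hp n.
Proof. by rewrite /slot; ring. Qed.

Lemma slotP (t : R) (a : int) : t = a%:~R * hp n -> `|t| <= k.+1%:R ->
  exists2 i, i \in slots & t = slot i.
Proof.
move=> -> h.
have ha : `|a| <= nslot%:Z.
  rewrite -(ler_int R) -(ler_pM2r (hp_gt0 R n)) -[nslot%:~R]/(nslot%:R) nslot_hp.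
  by rewrite intr_norm; move: h; rewrite normrM (ger0_norm (ltW (hp_gt0 R n))).
move: ha; rewrite ler_norml => /andP[a1 a2].
have a3 : 0 <= a + nslot%:Z by rewrite -lerBlDr sub0r.
exists (absz (a + nslot%:Z)%R).
  by rewrite mem_iota add0n ltnS leq0n /= -lez_nat gez0_abs // mul2n -addnn PoszD lerD2r.
by rewrite /slot natr_absz ger0_norm // intrD -[nslot%:~R]/(nslot%:R) addrK.
Qed.

Lemma harm_slots : harm R (2 * nslot).+1 <= lgn.
Proof.
apply: le_trans (_ : harm R (2 ^ (n + k + 2)) <= _); last first.
  by apply: le_trans (harm_pow R _) _; rewrite /lgn ler_nat addn3 addn2.
apply: harm_mono; rewrite /nslot mulnCA -expnS -[(2 ^ (n + k + 2))%N]/(2 ^ (n + k + 2))%N.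
have -> : (n + k + 2 = k.+1 + n.+1)%N by rewrite addn2 addSn addnS addnC.
rewrite expnD; have h1 : (k.+1 < 2 ^ k.+1)%N by exact: ltn_expl.
have h2 : (0 < 2 ^ n.+1)%N by rewrite expn_gt0.
by rewrite -(ltn_pmul2r h2) in h1.
Qed.

Variables (c q e : R).
Hypotheses (c0 : 0 < c) (q0 : 0 < q) (eE : e = q * c * hp n / (4 * lgn)).
Hypothesis sepc : forall s t : R, `|s| <= k.+1%:R -> `|t| <= k.+1%:R ->
  c * `|s - t| <= nrm (gam G s - gam G t).

Let lgn0 : 0 < lgn. Proof. by rewrite ltr0n addn3. Qed.
Lemma eps_gt0 : 0 < e.
Proof. by rewrite eE divr_gt0 ?mulr_gt0 ?hp_gt0. Qed.

(** The weight of slot [i] is at most [e / (c / 2 * hp n)] over [|i - j|]. The reciprocals sum to at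
    most [2 * lgn], and [e] is chosen so that the product is exactly [q]. *)
Let sep_sum j (z : C) : j \in slots ->
  (forall i, i \in slots -> i != j -> c / 2 * hp n * `|i%:R - j%:R| <= nrm (z - gam G (slot i))) ->
  \sum_(i <- slots | i != j) wt G e slot i z <= q.
Proof.
move=> js H; have e0 := eps_gt0; have h0 := hp_gt0 R n.
pose f i : R := e / (c / 2 * hp n) * `|i%:R - j%:R|^-1.
apply: le_trans (_ : \sum_(i <- slots | i != j) f i <= _).
  rewrite big_seq_cond [leRHS]big_seq_cond; apply: ler_sum => i /andP[si ij].
  have d0 : 0 < `|i%:R - j%:R : R|.
    by rewrite normr_gt0 subr_eq0 eqr_nat.
  have m0 : 0 < c / 2 * hp n * `|i%:R - j%:R| by rewrite !mulr_gt0.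
  apply: le_trans (wt_far e0 m0 (H i si ij)) _.
  by rewrite /f invfM mulrA.
rewrite -mulr_sumr; have js' : (j < (2 * nslot).+1)%N by move: js; rewrite mem_iota add0n.
have := sum_dist R js'; have := harm_slots => h1 h2.
have K0 : 0 <= e / (c / 2 * hp n) by rewrite divr_ge0 ?mulr_ge0 ?(ltW c0) // ltW.
apply: le_trans (ler_wpM2l K0 h2) _.
apply: le_trans (_ : e / (c / 2 * hp n) * (2 * lgn) <= _); first by apply: ler_wpM2l => //; lra.
rewrite le_eqVlt; apply/orP; left; apply/eqP; rewrite eE.
by field; rewrite !gt_eqF // ltr0n addn3.
Qed.

(** Here the slot [j] is prescribed and [z] is close to it; in [spread_all] it is the slot closest
    to [z]. In both cases [z] is at least half as far from any other slot as the separation of slots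
    guarantees. *)
Lemma spread_iso j (z : C) : j \in slots -> nrm (z - gam G (slot j)) <= c / 2 * hp n ->
  \sum_(i <- slots | i != j) wt G e slot i z <= q.
Proof.
move=> js hz; apply: sep_sum => // i si ij; have h0 := hp_gt0 R n.
have := sepc (slot_le si) (slot_le js); rewrite slot_sub normrM (ger0_norm (ltW h0)) => h.
have d1 : 1 <= `|i%:R - j%:R : R|.
  have := ij; rewrite neq_ltn => /orP[l|l].
    by rewrite distrC ger0_norm -?natrB ?(ltnW l) // ler1n subn_gt0.
  by rewrite ger0_norm -?natrB ?(ltnW l) // ler1n subn_gt0.
have := nrm_tri (gam G (slot i)) z (gam G (slot j)).
have := nrm_tri z (gam G (slot i)) (gam G (slot j)); rewrite (nrmB (gam G (slot i)) z).
have ch : 0 <= c / 2 * hp n by rewrite mulr_ge0 ?divr_ge0 ?(ltW c0) // ltW.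
have := ler_wpM2l ch d1; lra.
Qed.

Lemma spread_all (z : C) : exists2 j, j \in slots & \sum_(i <- slots | i != j) wt G e slot i z <= q.
Proof.
have [j js jmin] : exists2 j, j \in slots & forall i, i \in slots ->
    nrm (z - gam G (slot j)) <= nrm (z - gam G (slot i)).
  have : slots != [::] by [].
  elim: slots => [//|a s IH] _; have [->|s0] := eqVneq s [::].
    by exists a => [|i]; rewrite inE // => /eqP ->.
  have [j js jm] := IH s0.
  have [h|h] := leP (nrm (z - gam G (slot a))) (nrm (z - gam G (slot j))).
    exists a; rewrite ?mem_head // => i; rewrite inE => /orP[/eqP -> //|/jm]; exact: le_trans.
  exists j; rewrite ?inE ?js ?orbT // => i; rewrite inE => /orP[/eqP ->|/jm //]; exact: ltW.
exists j => //; apply: sep_sum => // i si ij; have h0 := hp_gt0 R n.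
have := sepc (slot_le si) (slot_le js); rewrite slot_sub normrM (ger0_norm (ltW h0)) => h.
have := nrm_tri z (gam G (slot i)) (gam G (slot j)); rewrite (nrmB (gam G (slot i)) z).
have := jmin _ si; lra.
Qed.

End Slots.

(** * Cells: repeated values and expansion *)

Section Cells.
Variable R : realType.
Local Notation C := (Cplx R).
Implicit Types (z w x y : C) (P : prf R) (G : geom R).

(* Near the boundary point [gam t], every value is repeated inside the domain within
   distance [D], not only for [F] but for all functions close to it, in particular for the limit. *)
Definition repeats G (F : prf R) (t r tl D : R) := forall g g1 : C -> C,
  (forall z, cl G z -> nrm (g z - pv F z) <= tl) ->
  (forall z, tl <= W G z -> cd g z (g1 z) /\ nrm (g1 z - pv1 F z) <= tl) ->
  forall x, cl G x -> nrm (x - gam G t) <= 2 * r ->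
  exists z, [/\ 0 < W G z, nrm (z - gam G t) <= D & g z = g x].

Definition expands G (F : prf R) (t r m : R) := forall x y, cl G x -> cl G y ->
  nrm (x - gam G t) <= 2 * r -> nrm (y - gam G t) <= 2 * r ->
  m / 2 * nrm (x - y) <= nrm (pv F x - pv F y).

Lemma prof_lip A P x : is_prof A P -> 0 <= im x -> nrm (pv1 P x - pv1 P 0) <= A * nrm x.
Proof.
move=> HP hx; rewrite -[X in A * nrm X]subr0.
have H1 z : [set z | 0 <= im z] z -> cd (pv1 P) z (pv2 P z) by case/HP.
have H2 z : [set z | 0 <= im z] z -> nrm (pv2 P z) <= A.
  move=> hz; have [_ _ _ _ h] := HP z hz; apply: le_trans h _.
  have w0 : 1 <= 1 + nrm z by rewrite lerDl.
  have A0 : 0 <= A.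
    have [_ _ h _ _] := HP z hz; have := le_trans (nrm_ge0 _) h.
    by rewrite pmulr_lge0 // invr_gt0; lra.
  rewrite ler_pdivrMr ?exprn_gt0 //; last by lra.
  by rewrite ler_peMr // exprn_ege1.
have S0 : [set z : C | 0 <= im z] 0 by rewrite /mkset im0.
exact: (cd_lip0 (@cvx_half R 0) H1 H2 S0 hx).
Qed.

(** The four constants depend only on [P], [A], [m], [M] and are thus available before a grid is
    chosen. Repetition: [overlap_local] gives a disc around an inner point on which the derivative
    is nearly constant, and [cd_surj], applied to the nearby function [g], reaches all values on the
    cell. Expansion: on the cell the derivative is close to [c * (1 + pv1 P 0)], whose modulus is at
    least [m]. *)
Lemma profile_consts P (A m M : R) : 0 < m -> m <= M -> 0 <= A -> is_prof A P -> overlap P ->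
  exists th0 g K w : R, [/\ 0 < th0, 0 < g, 0 < K & 0 < w] /\
  forall G F (t th e dl tl D : R) c, 0 < th <= th0 -> 0 < e <= w -> K * e <= D -> 0 <= dl <= g ->
    0 < tl <= w * e -> smooth G F -> (forall z, cl G z -> nrm (pv1 F z) <= M) ->
    m <= nrm c <= M -> m <= nrm c * nrm (1 + pv1 P 0) ->
    (forall z, cl G z -> nrm (z - gam G t) <= K * e ->
       nrm (pv1 F z - c * (1 + pv1 P (zt G t e z))) <= dl) ->
    repeats G F t (th * e) tl D /\ expands G F t (th * e) m.
Proof.
move=> m0 mM A0 HP [b [d [rho [eta [[rho0 rhob d0 /andP[eta0 eta4]] O1 O2]]]]].
have M0 : 0 < M by lra.
pose eta' := (eta + 1 / 4) / 2; have ee : 0 < eta' - eta by rewrite /eta'; lra.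
have ee' : eta <= eta' by lra.
have eta'0 : 0 <= eta' by rewrite /eta'; lra.
have eta'4 : eta' <= 1 / 4 by rewrite /eta'; lra.
clearbody eta'.
have nd : 0 < nrm d by rewrite nrm_gt0.
have nb := nrm_ge0 b; have br : 0 < nrm b + rho by lra.
have ibr : 0 < im b - rho by rewrite subr_gt0.
have md : 0 < m * nrm d by rewrite mulr_gt0.
have A1 : 0 < A + 1 by lra.
(* [cd_surj] tolerates an error of one half, in units of [nrm (c * d) * (e * rho)]. One eighth each
   goes to the overlap of [F] ([eta' <= 1 / 4]), to the size of the cell ([th0]) and to the distance
   of [g] from [pv F] ([w]). The last entry of [th0] keeps the derivative of the profile nearly
   constant on the cell. *)
pose th0 := Num.min 1 (Num.min (m * nrm d * rho / (16 * M)) (m / (8 * M * (A + 1)))).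
pose g := Num.min ((eta' - eta) * (m * nrm d))
  (Num.min ((eta' - eta) * (m * nrm d) * rho / (2 * (nrm b + 1))) (m / 4)).
pose w := Num.min (Num.min 1 (im b - rho)) (Num.min (m * nrm d * rho / 16)
  (Num.min (m * nrm d / 4) ((im b - rho) / (nrm b + rho) ^+ 2))).
have th00 : 0 < th0.
  by rewrite !lt_min ltr01 !divr_gt0 ?mulr_gt0.
have g0 : 0 < g by rewrite !lt_min !divr_gt0 ?mulr_gt0 //; lra.
have w0 : 0 < w by rewrite !lt_min ltr01 ibr !divr_gt0 ?mulr_gt0 ?exprn_gt0.
have t1 : th0 <= 1 by rewrite ge_min lexx.
have t2 : th0 * (16 * M) <= m * nrm d * rho.
  by rewrite -ler_pdivlMr ?mulr_gt0 // !ge_min lexx !orbT.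
have t3 : th0 * (8 * M * (A + 1)) <= m.
  by rewrite -ler_pdivlMr ?mulr_gt0 // !ge_min lexx !orbT.
have g1' : g <= (eta' - eta) * (m * nrm d) by rewrite ge_min lexx.
have g2' : g * (2 * (nrm b + 1)) <= (eta' - eta) * (m * nrm d) * rho.
  by rewrite -ler_pdivlMr ?mulr_gt0 // ?ge_min ?lexx ?orbT //; lra.
have g3' : g <= m / 4 by rewrite !ge_min lexx !orbT.
have w1 : w <= 1 by rewrite !ge_min lexx.
have w2 : w <= im b - rho by rewrite !ge_min lexx !orbT.
have w3 : w <= m * nrm d * rho / 16 by rewrite !ge_min lexx !orbT.
have w4 : w <= m * nrm d / 4 by rewrite !ge_min lexx !orbT.
have w5 : w * (nrm b + rho) ^+ 2 <= im b - rho.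
  by rewrite -ler_pdivlMr ?exprn_gt0 // !ge_min lexx !orbT.
clearbody th0 g w.
exists th0, g, (nrm b + rho + 2), w; split; first by split=> //; lra.
move=> G F t th e dl tl D c /andP[th1 th2] /andP[e0 ew] KD /andP[dl0 dlg] /andP[tl0 tlw].
move=> SF F1 /andP[c1 c2] cP near.
have e1 : e <= 1 by lra.
have cd0 : c * d != 0 by rewrite -nrm_gt0 nrmM mulr_gt0 //; lra.
have mcd : m * nrm d <= nrm (c * d) by rewrite nrmM ler_pM2r.
have dg1 : dl <= (eta' - eta) * nrm (c * d).
  have := ler_wpM2l (ltW ee) mcd; lra.
have gl : cl G (gam G t) by rewrite /cl W_gam.
have HPd z : 0 <= im z -> cd (pv P) z (pv1 P z) by case/HP.
have Ke : (nrm b + rho) * e <= (nrm b + rho + 2) * e by rewrite ler_pM2r //; lra.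
have dg2 : dl * nrm b <= (eta' - eta) * nrm (c * d) * rho / 2.
  have h1 : dl * nrm b <= g * (nrm b + 1) by apply: ler_pM => //; lra.
  have := ler_wpM2r (ltW rho0) (ler_wpM2l (ltW ee) mcd); lra.
have eb : (nrm b + rho) ^+ 2 * e <= im b - rho.
  have := ler_wpM2l (exprn_ge0 2 (ltW br)) ew; lra.
have near' z : cl G z -> nrm (z - gam G t) <= (nrm b + rho) * e ->
    nrm (pv1 F z - c * (1 + pv1 P (zt G t e z))) <= dl.
  by move=> hz h; apply: near => //; apply: le_trans h Ke.
have [u1 u2] := overlap_local e0 dl0 SF rho0 rhob cd0 ee' near' HPd O1 O2 dg1 dg2 eb.
set z0 := gam G t + tau G t * rc e * b in u1 u2.
have te : th * e <= e by rewrite ler_piMl ?(ltW e0) //; lra.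
have lipF x y : cl G x -> cl G y -> nrm (pv F x - pv F y) <= M * nrm (x - y).
  move=> hx hy; have H1 z : [set z | 0 <= W G z] z -> cd (pv F) z (pv1 F z) by case/SF.
  exact: (cd_lip0 (W_cvx G) H1 F1 hy hx).
have tE : th * e * (16 * M) <= m * nrm d * rho * e.
  have M16 : 0 <= 16 * M by rewrite mulr_ge0 // ltW.
  have := ler_wpM2r (ltW e0) (le_trans (ler_wpM2r M16 th2) t2); lra.
have mcr : m * nrm d * rho * e <= nrm (c * d) * rho * e.
  by rewrite !ler_wpM2r // ltW.
split.
- move=> f f1 Hf Hf1 x hx hxr.
  have Wb z : nrm (z - z0) <= e * rho -> tl <= W G z.
    by move=> /u1[h _]; apply: le_trans h; apply: le_trans tlw _; rewrite mulrC ler_pM2l.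
  have er : 0 < e * rho by rewrite mulr_gt0.
  have HK z : nrm (z - z0) <= e * rho -> nrm (f1 z - c * d) <= nrm (c * d) / 2.
    move=> hz; have [_ h1] := Hf1 z (Wb z hz); have [_ h2] := u1 z hz.
    have := nrm_tri (pv1 F z) (f1 z) (c * d).
    have : eta' * nrm (c * d) <= 1 / 4 * nrm (c * d) by apply: ler_wpM2r.
    have : w * e <= w by rewrite ler_piMr // ltW.
    lra.
  have z00 : nrm (z0 - z0) <= e * rho by rewrite subrr nrm0 ltW.
  have cz0 : cl G z0 by apply: le_trans (Wb z0 z00); rewrite ltW.
  have [|z hz fz] := cd_surj (w := f x) er cd0 (fun z hz => (Hf1 z (Wb z hz)).1) HK.
    have n1 := Hf x hx; have n2 := Hf z0 cz0.
    have n3 := lipF x (gam G t) hx gl.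
    have n4 : M * nrm (x - gam G t) <= M * (2 * (th * e)) by rewrite ler_pM2l.
    have -> : f x - f z0 = (f x - pv F x) + ((pv F x - pv F (gam G t)) - (pv F z0 - pv F (gam G t)))
        - (f z0 - pv F z0) by ring.
    apply: le_trans (nrm_subD _ _) _.
    have n5 := nrmD (f x - pv F x) ((pv F x - pv F (gam G t)) - (pv F z0 - pv F (gam G t))).
    have n6 := nrm_subD (pv F x - pv F (gam G t)) (pv F z0 - pv F (gam G t)).
    have n7 : eta' * nrm (c * d) * (e * rho) / 2 <= 1 / 4 * (nrm (c * d) * (e * rho)) / 2.
      have p0 : 0 <= nrm (c * d) * (e * rho) by rewrite mulr_ge0 // ltW.
      by have := ler_wpM2r p0 eta'4; lra.
    have n8 : w * e <= m * nrm d * rho / 16 * e by rewrite ler_wpM2r // ltW.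
    lra.
  exists z; split => //; first by apply: lt_le_trans (Wb z hz).
  have -> : z - gam G t = (z - z0) + tau G t * rc e * b by rewrite /z0; ring.
  apply: le_trans (nrmD _ _) _; rewrite !nrmM tau1 nrm_rc mul1r (gtr0_norm e0).
  by apply: le_trans KD; lra.
- set c' := c * (1 + pv1 P 0).
  have nc' : m <= nrm c' by rewrite /c' nrmM.
  have cS := cvxI (W_cvx G) (@cvx_ball R (gam G t) (2 * (th * e))).
  move=> x y hx hy hxr hyr.
  have H1 z : ([set z | 0 <= W G z] `&` [set z | nrm (z - gam G t) <= 2 * (th * e)]) z ->
     cd (pv F) z (pv1 F z) by case=> /SF[].
  have H2 z : ([set z | 0 <= W G z] `&` [set z | nrm (z - gam G t) <= 2 * (th * e)]) z ->
     nrm (pv1 F z - c') <= nrm c' / 2.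
    move=> [hz hzr]; rewrite /= in hzr.
    have n1 : nrm (pv1 F z - c * (1 + pv1 P (zt G t e z))) <= dl.
      by apply: near => //; apply: le_trans hzr _; have := ltW br; have := mulr_ge0 (ltW br) (ltW e0); lra.
    have n2 := prof_lip HP (im_zt t e0 hz).
    have n3 : nrm (zt G t e z) <= 2 * th by rewrite nrm_zt // ler_pdivrMr //; lra.
    have n4 : nrm c * nrm (pv1 P (zt G t e z) - pv1 P 0) <= M * (A * (2 * th)).
      by apply: ler_pM => //; apply: le_trans n2 _; rewrite ler_wpM2l.
    have -> : pv1 F z - c' = (pv1 F z - c * (1 + pv1 P (zt G t e z))) + c * (pv1 P (zt G t e z) - pv1 P 0).
      by rewrite /c'; ring.
    apply: le_trans (nrmD _ _) _; rewrite nrmM.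
    have n5 : th * (8 * M * (A + 1)) <= m.
      by apply: le_trans t3; apply: ler_wpM2r => //; rewrite !mulr_ge0 // ltW.
    have := mulr_gt0 th1 M0; lra.
  have := cd_sep cS H1 H2 (conj hy hyr) (conj hx hxr).
  apply: le_trans; rewrite ler_wpM2r //; lra.
Qed.

End Cells.

(** * The scales of one stage *)

Section StageNumbers.
Variable R : realType.

(** Conditions that compare [e] with [hp n] restrict [q], the others are met by a large [n]. The
    power inequality governs the dimension: as [e] is smaller than [hp n] only by a factor of order
    [lgn], it reduces to [hp n * lgn ^+ k <= a], which [growth] provides. *)
Lemma stage_numbers (k : nat) (M A K th w dl r0 tol r eta kap c : R) :
  0 < M -> 0 < A -> 0 < K -> 0 < th -> 0 < w -> 0 < dl -> 0 < r0 -> 0 < tol -> 0 < r ->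
  0 < eta -> 0 < kap -> 0 < c <= 1 ->
  exists (q : R) (n : nat) (e : R), e = q * c * hp n / (4 * lgn R k n) /\
  [/\ [/\ 0 < q, q <= 1, M * A * q <= dl / 2, M * A * q <= tol / 4 & M * A * q <= tol ^+ 2 / 8],
      [/\ 0 < e, e <= w, K * e <= hp k, K * e <= r0 & M * A / r0 * e <= dl / 2],
      [/\ 2 * M * A * e <= tol / 2, 2 * M * A / tol * e <= tol / 4,
          2 * M * A / tol * e <= tol ^+ 2 / 8, th * e <= r / 2 & 2 * M * A * e <= eta * hp n],
      2 * M * (th * e) <= eta * hp n
    & [/\ 4 * hp n <= r, (4 * hp n / r) ^+ k.+1 <= (kap * (th * e)) ^+ k & K * e <= c / 2 * hp n]].
Proof.
move=> M0 A0 K0 th0 w0 dl0 r00 tol0 r0' eta0 kap0 /andP[c0 c1].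
have t20 : 0 < tol ^+ 2 by rewrite exprn_gt0.
have hk := hp_gt0 R k.
have [|q /andP[q0 q1] /(_ q)] := @small_all R [:: (M * A, dl / 2); (K, 1); (M * A, tol / 4);
   (M * A, tol ^+ 2 / 8); (2 * M * A, eta); (2 * M * th, eta)].
  by rewrite /= eta0 ltr01 !divr_gt0.
rewrite q0 lexx => /(_ isT) /and5P[/= Q1 Q2 Q3 Q4 /and3P[Q5 Q6 _]].
have [|e1 /andP[e10 e11] E] := @small_all R [:: (1, w); (K, hp k); (K, r0); (M * A / r0, dl / 2);
   (2 * M * A, tol / 2); (2 * M * A / tol, tol / 4); (2 * M * A / tol, tol ^+ 2 / 8); (th, r / 2)].
  by rewrite /= w0 hk r00 !divr_gt0.
have mn0 : 0 < Num.min e1 (r / 4) by rewrite lt_min e10 divr_gt0.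
have [n0 hn0] := hp_small mn0.
pose a := (kap * th * q * c / 4) ^+ k * (r / 4) ^+ k.+1.
have a0 : 0 < a by rewrite mulr_gt0 ?exprn_gt0 ?divr_gt0 ?mulr_gt0.
have [n n0n hg] := growth k (k + 3) a0 n0.
have hn : hp n <= Num.min e1 (r / 4) by apply: le_trans (hp_le _ n0n) hn0.
move: hn; rewrite le_min => /andP[hn1 hn2].
have h0 := hp_gt0 R n.
have lg : 1 <= lgn R k n by rewrite ler1n addn3.
have lE : lgn R k n = (n + (k + 3))%:R by rewrite /lgn addnA.
rewrite -lE in hg; set l := lgn R k n in lg hg *.
have l0 : 0 < l by lra.
set e := q * c * hp n / (4 * l).
have e0 : 0 < e by rewrite divr_gt0 ?mulr_gt0.
have eq : e <= q * c * hp n / 4.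
  rewrite /e invfM mulrA ler_piMr //; first by rewrite divr_ge0 // ?mulr_ge0 // ltW.
  by rewrite invf_le1.
have qh0 : 0 < q * hp n by rewrite mulr_gt0.
have qc : c * (q * hp n) <= 1 * (q * hp n) by apply: ler_wpM2r => //; exact: ltW.
have eq2 : e <= q * hp n by lra.
have eh : e <= e1.
  by apply: le_trans eq2 _; have := ler_wpM2r (ltW h0) q1; lra.
have Eq K' d : 0 <= K' -> K' * q <= d -> K' * e <= d * hp n.
  move=> K'0 hK; have := ler_wpM2l K'0 eq2; have := ler_wpM2r (ltW h0) hK; lra.
have h6 : 2 * M * th * e <= eta * hp n by apply: Eq => //; rewrite !mulr_ge0 // ltW.
have h7 : K * e <= c / 2 * hp n.
  have h1 := ler_wpM2l (ltW K0) eq.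
  have ch : 0 <= c * hp n by rewrite mulr_ge0 // ltW.
  have := ler_wpM2r ch Q2; lra.
have h8 : (4 * hp n / r) ^+ k.+1 <= (kap * (th * e)) ^+ k.
  rewrite -(ler_pM2r (exprn_gt0 k.+1 (divr_gt0 r0' (ltr0n R 4)))) -exprMn.
  have -> : 4 * hp n / r * (r / 4) = hp n by field; rewrite gt_eqF.
  rewrite -(ler_pM2r (exprn_gt0 k l0)) mulrAC -exprMn.
  have -> : kap * (th * e) * l = kap * th * q * c / 4 * hp n by rewrite /e; field; rewrite gt_eqF.
  rewrite exprMn exprS.
  have := ler_wpM2l (exprn_ge0 k (ltW h0)) hg; rewrite /a; lra.
exists q, n, e; split => //; move: (E e); rewrite e0 eh => /(_ isT) /=.
move=> /and5P[E1 E2 E3 E4 /and5P[E5 E6 E7 E8 _]].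
split; [by split | | | by rewrite mulrA | split => //; lra].
- by split => //; lra.
- by split => //; apply: Eq => //; rewrite !mulr_ge0 // ltW.
Qed.

End StageNumbers.

(** * One stage of the construction *)

Section Stage.
Variable R : realType.
Local Notation C := (Cplx R).
Implicit Types (z w x y : C) (F : prf R) (k : nat).

Variables (G : geom R) (T tau m M : R).

(** The slack in each of the three bounds is proportional to [hp k]: a stage may spend half of what
    is left, and in the limit the constants are [m], [M] and [tau]. *)
Definition stage_inv k F := [/\ smooth G F,
  forall z, cl G z -> [/\ m * (1 + hp k) <= nrm (pv1 F z), nrm (pv1 F z) <= M * (1 - hp k / 2)
    & W G z * nrm (pv2 F z) <= (T + (tau - T) * (1 - hp k)) * nrm (pv1 F z)]
  & exists2 B, 0 <= B & forall z, cl G z -> nrm (pv2 F z) <= B].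

End Stage.

Section StageStep.
Variable R : realType.
Local Notation C := (Cplx R).
Implicit Types (z w x y : C) (F : prf R) (k : nat).

(** [eta] keeps the change of the values, the new tolerance and the new cells below a fraction of
    the width [hp n] of the new grid, so that what is separated at this width stays separated in the
    limit. [kap] enters the relation between cells and grids from which the dimension is
    computed. *)
Lemma stage_step (G : geom R) (T tau lo hi m M : R) k F (tol r eta kap : R) :
  0 < m -> 2 * m <= lo -> lo <= 1 -> 1 <= hi -> 2 * hi <= M -> 1 <= T -> T < tau ->
  (forall d, 0 < d <= 1 / 8 -> exists A Pm Pp,
  [/\ 0 < A, is_prof A Pm & is_prof A Pp] /\
  [/\ pbound T lo (1 + 3 * d) Pm, pbound T (1 - 3 * d) hi Pp, overlap Pm & overlap Pp]) ->
  stage_inv G T tau m M k F -> 0 < tol -> 0 < r -> 0 < eta -> 0 < kap ->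
  exists (F' : prf R) (n : nat) (r' tol' : R), [/\ stage_inv G T tau m M k.+1 F', 0 < r' & 0 < tol'] /\
  [/\ forall z, cl G z -> nrm (pv F' z - pv F z) <= eta * hp n /\ nrm (pv F' z - pv F z) <= tol / 2,
      forall z, tol <= W G z -> nrm (pv1 F' z - pv1 F z) <= tol / 2 /\ nrm (pv2 F' z - pv2 F z) <= tol / 2,
      forall (t : R) (a : int), t = a%:~R * hp n -> `|t| <= k.+1%:R ->
        repeats G F' t r' tol' (hp k) /\ expands G F' t r' m
    & [/\ tol' <= tol / 2, tol' <= eta * hp n, r' <= r / 2 & 2 * M * r' <= eta * hp n] /\
      [/\ 4 * hp n <= r & (4 * hp n / r) ^+ k.+1 <= (kap * r') ^+ k]].
Proof.
move=> m0 mlo lo1 hi1 hiM T1 Ttau profs [SF F1 [B B0 F2B]] tol0 r0 eta0 kap0.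
have hk := hp_gt0 R k; have hk1 := hp_le1 R k.
(* The factor [3 d = hp k / 8] takes at most half of the slack that this stage may spend. *)
pose d := hp k / 24 : R.
have hd : 0 < d <= 1 / 8 by rewrite /d; apply/andP; split; move: hk hk1; clear; lra.
have [A [Pm [Pp [[A0 HPm HPp] [Bm Bp Om Op]]]]] := profs _ hd.
have M0 : 0 < M by move: hi1 hiM; clear; lra.
have mM : m <= M by move: hi1 hiM lo1 mlo m0; clear; lra.
have [thm [gm [Km [wm [[thm0 gm0 Km0 wm0] Cm]]]]] := profile_consts m0 mM (ltW A0) HPm Om.
have [thp [gp [Kp [wp [[thp0 gp0 Kp0 wp0] Cp]]]]] := profile_consts m0 mM (ltW A0) HPp Op.
pose th := Num.min thm thp; have th0 : 0 < th by rewrite lt_min thm0.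
pose g := Num.min gm gp; have g0 : 0 < g by rewrite lt_min gm0.
pose w := Num.min wm wp; have w0 : 0 < w by rewrite lt_min wm0.
pose K := Num.max Km Kp; have K0 : 0 < K by rewrite lt_max Km0.
have tau2 : 0 < 2 * (tau + 2) by move: T1 Ttau; clear; lra.
have tT : 0 < tau - T by rewrite subr_gt0; exact: Ttau.
(* The entry 1/8 keeps [dl] within the other half of the slack for the first derivative; the entry
   with [tau] makes [(tau + 2) * dl] at most [m] times the permitted increase of the constant. *)
pose dl := Num.min g (hp k * (m * Num.min (1 / 8) ((tau - T) / (2 * (tau + 2))))).
have dl0 : 0 < dl by rewrite lt_min g0 !mulr_gt0 // lt_min !divr_gt0.
have dlg : dl <= g by rewrite ge_min lexx.
have dl1 : dl <= hp k * m / 8.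
  rewrite ge_min; apply/orP; right.
  have h : Num.min (1 / 8) ((tau - T) / (2 * (tau + 2))) <= 1 / 8 by rewrite ge_min lexx.
  by move: (ler_wpM2l (ltW (mulr_gt0 hk m0)) h); clear; lra.
have dl2 : dl * (2 * (tau + 2)) <= hp k * m * (tau - T).
  rewrite -ler_pdivlMr // ge_min; apply/orP; right.
  have h : Num.min (1 / 8) ((tau - T) / (2 * (tau + 2))) <= (tau - T) / (2 * (tau + 2)).
    by rewrite ge_min lexx orbT.
  by move: (ler_wpM2l (ltW (mulr_gt0 hk m0)) h); clear; lra.
clearbody dl.
pose rr := dl / (2 * (B + 1)); have rr0 : 0 < rr by rewrite divr_gt0 // mulr_gt0 //; move: B0; clear; lra.
have Brr : B * rr <= dl / 2.
  have -> : B * rr = dl / 2 * (B / (B + 1)) by rewrite /rr; field; rewrite gt_eqF //; move: B0; clear; lra.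
  by rewrite ler_piMr ?divr_ge0 ?(ltW dl0) // ler_pdivrMr ?mul1r; move: B0; clear; lra.
clearbody rr.
have [c hc sepc] := gam_sep G k.+1%:R; case/andP: (hc) => c0 c1.
have [q [n [e [eE [[q0 q1 q2 q3 q4] [e0 ew eK eKr e1] [f1 f2 f3 f4 f5] f6 [n1 n2 n3]]]]]] :=
  stage_numbers k M0 A0 K0 th0 w0 dl0 rr0 tol0 r0 eta0 kap0 hc.
pose sl := slot R k n; pose s := slots k n.
(* A factor as small as [lo >= 2 m] does no harm where [nrm (cc _ _ _ i) >= 1], nor one as large as
   [hi <= M / 2] where it is below 1. In the opposite direction the factor differs from 1 by at most
   [3 d]. *)
pose PP i := if 1 <= nrm (cc G F sl i) then Pm else Pp.
pose F' := ins G F e sl PP s.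
have us : uniq s by exact: iota_uniq.
have PA i : is_prof A (PP i) by rewrite /PP; case: ifP.
have F1M z : cl G z -> nrm (pv1 F z) <= M.
  by move=> /F1[_ h _]; apply: le_trans h _; move: (mulr_gt0 M0 hk); clear; lra.
have spread z : exists2 j, j \in s & \sum_(i <- s | i != j) wt G e sl i z <= q.
  exact: (spread_all c0 q0 eE sepc).
have iso j z : j \in s -> nrm (z - gam G (sl j)) <= K * e ->
    \sum_(i <- s | i != j) wt G e sl i z <= q.
  by move=> js hz; apply: (spread_iso c0 q0 eE sepc js); apply: le_trans hz n3.
have M0' := ltW M0; have A0' := ltW A0.
have SF' : smooth G F' := ins_smooth sl e0 SF PA s.
have B' : exists2 B', 0 <= B' & forall z, cl G z -> nrm (pv2 F' z) <= B'.
  exact: (ins2_bound sl e0 M0' A0' B0 F1M F2B PA s).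
have near z j : j \in s -> cl G z -> nrm (z - gam G (sl j)) <= K * e ->
    nrm (pv1 F' z - cc G F sl j * (1 + pv1 (PP j) (zt G (sl j) e z))) <= dl.
  move=> js hz hr; have hr2 := le_trans hr eKr.
  have := ins_near1 e0 M0' A0' B0 SF F1M F2B PA us js hz (iso j z js hr) hr2.
  by rewrite -/F'; move: Brr q2; clear; lra.
have ccb i : m * (1 + hp k) <= nrm (cc G F sl i) /\ nrm (cc G F sl i) <= M * (1 - hp k / 2).
  have gl : cl G (gam G (sl i)) by rewrite /cl W_gam.
  by have [h1 h2 _] := F1 _ gl.
pose L := m * (1 + hp k) * (1 - 3 * d); pose H := M * (1 - hp k / 2) * (1 + 3 * d).
have Lm : m + dl <= L /\ m * (1 + hp k.+1) + dl <= L.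
  rewrite /L /d hpS; have hm := mulr_gt0 m0 hk; have hm2 := ler_wpM2l (ltW hm) hk1.
  by move: dl1 hm hm2 dl0; clear; split; lra.
have HM : H + dl <= M * (1 - hp k.+1 / 2).
  rewrite /H /d hpS; have hM := mulr_gt0 M0 hk; have hM2 := ler_wpM2l (ltW hM) hk1.
  have hm2 : hp k * m <= hp k * M by rewrite ler_pM2l.
  have hM3 := mulr_ge0 (ltW hM) (ltW hk).
  by move: dl1 hM hM2 hm2 hM3; clear; lra.
have Lk : L <= m * (1 + hp k).
  rewrite /L ler_piMr // ?mulr_ge0 ?addr_ge0 ?(ltW m0) ?(ltW hk) //.
  by case/andP: hd => hd0 _; move: hd0; clear; lra.
have Hk : M * (1 - hp k / 2) <= H.
  rewrite /H ler_peMr // ?mulr_ge0 ?(ltW M0) //; first by move: hk1; clear; lra.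
  by case/andP: hd => hd0 _; move: hd0; clear; lra.
have Llo : L <= lo.
  by apply: le_trans Lk _; move: mlo (ler_wpM2l (ltW m0) hk1); clear; lra.
have hiH : hi <= H.
  by apply: le_trans Hk; move: hiM (ler_wpM2l M0' hk1); clear; lra.
have d3 : 0 <= 1 - 3 * d by case/andP: hd => h1 h2; move: h2; clear; lra.
have d30 : 0 <= 1 + 3 * d by case/andP: hd => h1 h2; move: h1; clear; lra.
have Lpos : 0 <= L by rewrite /L mulr_ge0 // mulr_ge0 ?addr_ge0 // ltW.
have HMle : H <= M by move: HM dl0 (mulr_gt0 M0 (hp_gt0 R k.+1)); clear; lra.
have LE : L <= m * (1 + hp k) * (1 - 3 * d) by [].
have HE : M * (1 - hp k / 2) * (1 + 3 * d) <= H by [].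
clearbody L H d.
pose Tk := T + (tau - T) * (1 - hp k); pose T' := T + (tau - T) * (1 - hp k.+1).
have TTk : T <= Tk by rewrite lerDl mulr_ge0 ?(ltW tT) // subr_ge0.
have T'E : T' - Tk = (tau - T) * (hp k / 2) by rewrite /T' /Tk hpS; field.
have Tktau : Tk <= tau by rewrite /Tk; move: (mulr_gt0 tT hk); clear; lra.
have TkE : T + (tau - T) * (1 - hp k) = Tk by [].
have T'E2 : T + (tau - T) * (1 - hp k.+1) = T' by [].
clearbody Tk T'.
have PB i x : 0 <= im x -> [/\ L <= nrm (cc G F sl i) * nrm (1 + pv1 (PP i) x),
     nrm (cc G F sl i) * nrm (1 + pv1 (PP i) x) <= H
     & 2 * im x * nrm (pv2 (PP i) x) <= Tk * nrm (1 + pv1 (PP i) x)].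
  move=> hx; have [ca cb] := ccb i.
  suff [h1 h2 h3] : [/\ L <= nrm (cc G F sl i) * nrm (1 + pv1 (PP i) x),
     nrm (cc G F sl i) * nrm (1 + pv1 (PP i) x) <= H
     & 2 * im x * nrm (pv2 (PP i) x) <= T * nrm (1 + pv1 (PP i) x)].
    by split => //; apply: le_trans h3 _; apply: ler_wpM2r.
  rewrite /PP; case: ifPn => h1.
    have [b1 b2 b3] := Bm x hx; split => //.
      apply: le_trans Llo _; apply: le_trans b1 _; exact: ler_peMl.
    by apply: le_trans HE; apply: ler_pM.
  have [b1 b2 b3] := Bp x hx; split => //.
    apply: le_trans LE _; apply: ler_pM => //.
    by rewrite mulr_ge0 ?addr_ge0 // ltW.
  apply: le_trans hiH; apply: le_trans b2; apply: ler_piMl => //.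
  by rewrite ltW // ltNge.
have tau0 : 0 <= Tk by move: T1 TTk; clear; lra.
have nearq : B * rr + H * A * q <= dl.
  have : H * A * q <= M * A * q by rewrite !ler_wpM2r // ltW.
  by move: Brr q2; clear; lra.
have farq : H * A * (e / rr + q) <= dl.
  have er0 : 0 <= e / rr + q by rewrite addr_ge0 ?divr_ge0 // ltW.
  have : H * A * (e / rr + q) <= M * A * (e / rr + q) by apply: ler_wpM2r => //; apply: ler_wpM2r.
  by move: e1 q2; clear; lra.
have Ldl : L - dl >= m by case: Lm => h1 _; move: h1; clear; lra.
have gap : Tk * dl + 2 * dl <= (T' - Tk) * (L - dl).
  have h1 := ler_wpM2r (ltW dl0) Tktau.
  have h2 : 0 <= (tau - T) * (hp k / 2) by rewrite mulr_ge0 ?divr_ge0 // ltW.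
  have h3 := ler_wpM2l h2 Ldl; rewrite T'E.
  by move: h1 h3 dl2; clear; lra.
have TT' : Tk <= T'.
  by rewrite -subr_ge0 T'E mulr_ge0 ?divr_ge0 // ltW.
have H0 : 0 <= H.
  have [_ h _] := PB 0%N 0 (lexx _); apply: le_trans h; exact: mulr_ge0.
have F1LH z : cl G z -> [/\ L <= nrm (pv1 F z), nrm (pv1 F z) <= H & W G z * nrm (pv2 F z) <= Tk * nrm (pv1 F z)].
  by move=> /F1[h1 h2]; rewrite TkE => h3; split => //; [apply: le_trans Lk h1 | apply: le_trans h2 Hk].
have IN := ins_inv e0 A0' B0 H0 SF F1LH F2B PA PB us (fun z _ => spread z) rr0 nearq farq tau0 gap TT'.
have {}IN z : cl G z -> [/\ m * (1 + hp k.+1) <= nrm (pv1 F' z), nrm (pv1 F' z) <= M * (1 - hp k.+1 / 2)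
    & W G z * nrm (pv2 F' z) <= T' * nrm (pv1 F' z)].
  move=> hz; have [h1 h2 h3] := IN z hz; split => //.
    by apply: le_trans h1; case: Lm => _ h4; move: h4; clear; lra.
  by apply: le_trans h2 HM.
have F'M z : cl G z -> nrm (pv1 F' z) <= M.
  by move=> /IN[_ h _]; apply: le_trans h _; move: (mulr_gt0 M0 (hp_gt0 R k.+1)); clear; lra.
have he0 : 0 < eta * hp n by rewrite mulr_gt0 // hp_gt0.
pose tol' := Num.min (Num.min (tol / 2) (eta * hp n)) (w * e).
have tol'0 : 0 < tol' by rewrite lt_min (mulr_gt0 w0 e0) andbT lt_min he0 andbT divr_gt0.
have tol'1 : tol' <= tol / 2 by rewrite /tol' ge_min ge_min lexx.
have tol'2 : tol' <= eta * hp n by rewrite /tol' ge_min ge_min lexx orbT.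
have tol'3 : tol' <= w * e by rewrite /tol' ge_min lexx orbT.
clearbody tol'.
exists F', n, (th * e), tol'; split.
  by split; [split => //; rewrite T'E2 | rewrite mulr_gt0 |].
split; last by split; split.
- move=> z hz; have [j js hj] := spread z.
  have := ins_diff e0 M0' A0' F1M PA us js hz hj; rewrite -/F' => h.
  have : M * A * e * (1 + q) <= M * A * e * 2.
    by rewrite ler_wpM2l ?mulr_ge0 ?(ltW e0) //; move: q1; clear; lra.
  by move=> h2; move: h h2 f1 f5; clear; split; lra.
- move=> z hz; have cz : cl G z by apply: le_trans hz; rewrite ltW.
  have [j js hj] := spread z.
  have t2 : 0 < tol / 2 by rewrite divr_gt0.
  (* [W] is at most twice the distance to a boundary point, so every slot is far from [z]. The bound
     for [W] times the second derivative is then divided by [tol], which is why [tol ^+ 2] occurs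
     among the conditions. *)
  have hr : tol / 2 <= nrm (z - gam G (sl j)).
    have h := W_zt G (sl j) z e0; have h2 := im_nrm (zt G (sl j) e z); rewrite nrm_zt // in h2.
    have h3 : e * im (zt G (sl j) e z) <= e * (nrm (z - gam G (sl j)) / e) by rewrite ler_wpM2l // ltW.
    rewrite mulrCA divff ?gt_eqF // mulr1 in h3.
    by move: h h3 hz; clear; lra.
  have g1 := ins_far1 e0 M0' A0' F1M PA us js cz hj t2 hr.
  have g2 := ins_far2 e0 M0' A0' F1M PA us js cz hj t2 hr.
  rewrite -/F' in g1 g2.
  have E : M * A * (e / (tol / 2) + q) = 2 * M * A / tol * e + M * A * q by field; rewrite gt_eqF.
  split; first by rewrite E in g1; move: g1 f2 q3; clear; lra.
  have E2 : 2 * M * A * (e / (tol / 2) + q) = 2 * (2 * M * A / tol * e + M * A * q) by rewrite -E; ring.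
  rewrite E2 in g2; rewrite -(ler_pM2l tol0).
  have : tol * nrm (pv2 F' z - pv2 F z) <= W G z * nrm (pv2 F' z - pv2 F z) by rewrite ler_wpM2r.
  by move=> h; move: h g2 f3 q4; clear; rewrite expr2; lra.
- move=> t a /slotP ha /ha[j js ->]; rewrite -/sl in js *.
  have [ca cb] := ccb j.
  have cm : m <= nrm (cc G F sl j) <= M.
    apply/andP; split; last exact: le_trans cb (le_trans Hk HMle).
    by apply: le_trans (le_trans Lk ca); case: Lm => h1 _; move: h1 dl0; clear; lra.
  have c2 : m <= nrm (cc G F sl j) * nrm (1 + pv1 (PP j) 0).
    by have [h _ _] := PB j 0 (lexx _); apply: le_trans h; case: Lm => h1 _; move: h1 dl0; clear; lra.
  have nj z := near z j js.
  have pick P (th1 g1 K1 w1 : R) : PP j = P -> th <= th1 -> g <= g1 -> K1 <= K -> w <= w1 ->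
     [/\ 0 < th <= th1, 0 < e <= w1, K1 * e <= hp k & 0 <= dl <= g1] /\
     [/\ 0 < tol' <= w1 * e, m <= nrm (cc G F sl j) * nrm (1 + pv1 P 0)
       & forall z, cl G z -> nrm (z - gam G (sl j)) <= K1 * e ->
       nrm (pv1 F' z - cc G F sl j * (1 + pv1 P (zt G (sl j) e z))) <= dl].
    move=> <- t1 t2 t3 t4; rewrite th0 t1 e0 tol'0 c2 (ltW dl0) /=.
    have KK : K1 * e <= K * e by rewrite ler_pM2r.
    split; split => //; [exact: le_trans ew t4 | exact: le_trans KK eK | exact: le_trans dlg t2 | |].
      by apply: le_trans tol'3 _; rewrite ler_pM2r.
    by move=> z hz hr; apply: nj => //; apply: le_trans hr KK.
  have [th1 th2] : th <= thm /\ th <= thp by rewrite !ge_min !lexx orbT.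
  have [g1 g2] : g <= gm /\ g <= gp by rewrite !ge_min !lexx orbT.
  have [w1 w2] : w <= wm /\ w <= wp by rewrite !ge_min !lexx orbT.
  have [K1 K2] : Km <= K /\ Kp <= K by rewrite !le_max !lexx orbT.
  have [E|E] : PP j = Pm \/ PP j = Pp by rewrite /PP; case: ifP; [left|right].
    have [[p1 p2 p3 p4] [p5 p6 p7]] := pick Pm thm gm Km wm E th1 g1 K1 w1.
    exact: (Cm G F' (sl j) th e dl tol' (hp k) (cc G F sl j)).
  have [[p1 p2 p3 p4] [p5 p6 p7]] := pick Pp thp gp Kp wp E th2 g2 K2 w2.
  exact: (Cp G F' (sl j) th e dl tol' (hp k) (cc G F sl j)).
Qed.

End StageStep.

(** * The limit function *)

Section Fractal.
Variable R : realType.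
Local Notation C := (Cplx R).
Implicit Types (z w x y : C) (F : nat -> prf R).

(** At a point of height [w] the changes of the derivatives are controlled only from the stage at
    which the tolerance is below [w]. From then on the current tolerance bounds the distance to the
    limit, because the tolerances halve. *)
Lemma tail_limit (u : nat -> C) (tol : nat -> R) (w : R) :
  (forall k, 0 < tol k) -> (forall k, tol k.+1 <= tol k / 2) -> 0 < w ->
  (forall k, tol k <= w -> nrm (u k.+1 - u k) <= tol k / 2) ->
  exists l, forall k, tol k <= w -> nrm (u k - l) <= tol k.
Proof.
move=> t0 th w0 H.
have dec k i : tol (k + i)%N <= tol k * hp i.
  elim: i => [|i IH]; first by rewrite addn0 hp0 mulr1.
  by rewrite addnS hpS; apply: le_trans (th _) _; move: IH; clear; lra.
have decw k i : tol k <= w -> tol (k + i)%N <= w.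
  move=> h; apply: le_trans (dec k i) (le_trans _ h).
  by rewrite ler_piMr ?hp_le1 // ltW.
have tel k i : tol k <= w -> nrm (u (k + i)%N - u k) <= tol k * (1 - hp i).
  move=> h; elim: i => [|i IH]; first by rewrite addn0 subrr nrm0 hp0 subrr mulr0.
  rewrite addnS hpS; apply: le_trans (nrm_tri (u (k + i)%N) _ _) _.
  by have := H _ (decw k i h); have := dec k i; move: IH; clear; lra.
have [k0 hk0] : exists k0, tol k0 <= w.
  have [k hk] := hp_small (divr_gt0 w0 (t0 0%N)).
  exists k; have := dec 0%N k; rewrite add0n => h; apply: le_trans h _.
  by rewrite mulrC -ler_pdivlMr.
have [|l hl] := @clim R (fun i => u (k0 + i)%N) (tol k0 / 2).
  move=> i; rewrite addnS; apply: le_trans (H _ (decw k0 i hk0)) _.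
  by have := dec k0 i; clear; lra.
exists l => k hk; rewrite -subr_le0; apply: (@hp_lim R _ (2 * tol k0)) => j.
have h1 := tel k (k0 + j)%N hk.
have h2 := hl (k + j)%N; rewrite addnCA in h2.
have h3 : hp (k + j) <= hp j :> R by apply: hp_le; exact: leq_addl.
have h4 := nrm_tri (u (k + (k0 + j))%N) (u k) l; rewrite (nrmB (u k) (u _)) in h4.
have h5 := ler_wpM2l (ltW (t0 k0)) h3.
have h6 := mulr_gt0 (t0 k) (hp_gt0 R (k0 + j)).
by move: h1 h2 h4 h5 h6; clear; lra.
Qed.

(** What the rest of the proof uses of the stages. [n k.+1] and [r k.+1] are the grid exponent and
    the cell radius of step [k]. The loss term in [fr_sep] accounts for all later stages, so [f]
    expands distances in a cell down to the width of the next grid. The last inequality of [fr_r]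
    yields the dimension; [fr_id] keeps the preimages of a value in a bounded set. *)
Record fractal (G : geom R) (tau m M : R) (f f1 f2 : C -> C) (n : nat -> nat) (r cs : nat -> R) : Prop := Fractal {
  fr_m : [/\ 0 < m, m <= 1 & m <= M];
  fr_cd : forall z, 0 < W G z -> cd f z (f1 z) /\ cd f1 z (f2 z);
  fr_bd : forall z, 0 < W G z -> [/\ m <= nrm (f1 z), nrm (f1 z) <= M & W G z * nrm (f2 z) <= tau * nrm (f1 z)];
  fr_lip : forall x y, cl G x -> cl G y -> nrm (f x - f y) <= M * nrm (x - y);
  fr_id : forall z, cl G z -> nrm (f z - z) <= 1;
  fr_cs : forall k, 0 < cs k <= 1 /\ forall s t : R, `|s| <= k.+2%:R -> `|t| <= k.+2%:R ->
    cs k * `|s - t| <= nrm (gam G s - gam G t);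
  fr_cell : forall k (a : int) (t : R), t = a%:~R * hp (n k.+1) -> `|t| <= k.+1%:R ->
    forall x, cl G x -> nrm (x - gam G t) <= 2 * r k.+1 ->
    exists z, [/\ 0 < W G z, nrm (z - gam G t) <= hp k & f z = f x];
  fr_sep : forall k (a : int) (t : R), t = a%:~R * hp (n k.+1) -> `|t| <= k.+1%:R ->
    forall x y, cl G x -> cl G y -> nrm (x - gam G t) <= 2 * r k.+1 -> nrm (y - gam G t) <= 2 * r k.+1 ->
    m / 2 * nrm (x - y) - m * cs k.+1 / 5 * hp (n k.+2) <= nrm (f x - f y);
  fr_r : forall k, [/\ 0 < r k, r k <= 1, r k.+1 <= r k / 2, 2 * m * r k.+1 <= m * cs k / 20 * hp (n k.+1)
    & 4 * hp (n k.+1) <= r k /\ (4 * hp (n k.+1) / r k) ^+ k.+1 <= (m * cs k.+1 / 16 * r k.+1) ^+ k]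
}.

Lemma fractal_exists (G : geom R) (tau : R) : 1 < tau ->
  exists m M f f1 f2 n r cs, fractal G tau m M f f1 f2 n r cs.
Proof.
move=> tau1; pose T := (1 + tau) / 2.
have T1 : 1 < T by rewrite /T; lra.
have Ttau : T < tau by rewrite /T; lra.
clearbody T.
have [lo [hi [[lo0 lo1 hi1] profs]]] := profiles_exist T1.
pose m := lo / 2; pose M := 2 * hi.
have m0 : 0 < m by rewrite divr_gt0.
have mlo : 2 * m <= lo by rewrite /m; lra.
have mlo' : m * 2 = lo by rewrite /m; field.
have hiM : 2 * hi <= M by [].
have MM : M / 2 = hi by rewrite /M; field.
clearbody m M.
have mM : m <= M by move: mlo lo1 hi1 hiM m0; clear; lra.
have /choice[cs hcs] : forall k : nat, exists c : R, 0 < c <= 1 /\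
    forall s t : R, `|s| <= k.+2%:R -> `|t| <= k.+2%:R -> c * `|s - t| <= nrm (gam G s - gam G t).
  by move=> k; have [c c1 c2] := gam_sep G k.+2%:R; exists c.
(* A state consists of the function, the grid exponent, the cell radius and the tolerance that all
   later changes together must respect. *)
pose st := (prf R * nat * R * R)%type.
pose ok k (s : st) := [/\ stage_inv G T tau m M k s.1.1.1, 0 < s.1.2 & 0 < s.2].
pose rel k (s s' : st) := let: (F, _, r, tol) := s in let: (F', n, r', tol') := s' in
  [/\ forall z, cl G z -> nrm (pv F' z - pv F z) <= m * cs k / 20 * hp n /\ nrm (pv F' z - pv F z) <= tol / 2,
      forall z, tol <= W G z -> nrm (pv1 F' z - pv1 F z) <= tol / 2 /\ nrm (pv2 F' z - pv2 F z) <= tol / 2,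
      forall (t : R) (a : int), t = a%:~R * hp n -> `|t| <= k.+1%:R ->
        repeats G F' t r' tol' (hp k) /\ expands G F' t r' m
    & [/\ tol' <= tol / 2, tol' <= m * cs k / 20 * hp n, r' <= r / 2 & 2 * M * r' <= m * cs k / 20 * hp n] /\
      [/\ 4 * hp n <= r & (4 * hp n / r) ^+ k.+1 <= (m * cs k.+1 / 16 * r') ^+ k]].
have /choice[nxt hnxt] : forall ks : nat * st, exists s', ok ks.1 ks.2 -> ok ks.1.+1 s' /\ rel ks.1 ks.2 s'.
  move=> -[k [[[F n] r] tol]] /=; have [okk|nok] := pselect (ok k (F, n, r, tol)); last first.
    by exists (F, n, r, tol).
  have [/= h1 h2 h3] := okk.
  have [/andP[c0 c1] _] := hcs k.
  have e0 : 0 < m * cs k / 20 by rewrite divr_gt0 // mulr_gt0.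
  have [/andP[c0' c1'] _] := hcs k.+1.
  have k0 : 0 < m * cs k.+1 / 16 by rewrite divr_gt0 // mulr_gt0.
  have [F' [n' [r' [tol' [g1 g2]]]]] := stage_step m0 mlo lo1 hi1 hiM (ltW T1) Ttau profs h1 h3 h2 e0 k0.
  by exists (F', n', r', tol').
pose s0 : st := (Prf id (fun=> 1) (fun=> 0), 0%N, 1, 1).
have ok0 : ok 0%N s0.
  split=> //=; split.
  - by move=> z hz /=; split; [exact: cd_id | exact: cd_const].
  - move=> z hz /=; rewrite nrm1 nrm0 hp0.
    split; [by move: mlo' lo1; clear; lra | by move: MM hi1; clear; lra |].
    by rewrite mulr0 mulr1 subrr mulr0 addr0; move: T1; clear; lra.
  - by exists 0 => // z _; rewrite nrm0.
pose S := fix S k := if k is k'.+1 then nxt (k', S k') else s0.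
have okS k : ok k (S k) by elim: k => [//|k IH]; have [] := hnxt (k, S k) IH.
have relS k : rel k (S k) (S k.+1) by have [] := hnxt (k, S k) (okS k).
pose F k := (S k).1.1.1; pose n k := (S k).1.1.2; pose r k := (S k).1.2; pose tol k := (S k).2.
have {}relS k : rel k (F k, n k, r k, tol k) (F k.+1, n k.+1, r k.+1, tol k.+1).
  by have := relS k; rewrite /F /n /r /tol; case: (S k) => -[[? ?] ?] ?; case: (S k.+1) => -[[? ?] ?] ?.
have inv k : stage_inv G T tau m M k (F k) by have [] := okS k.
have r0 k : 0 < r k by have [] := okS k.
have t0 k : 0 < tol k by have [] := okS k.
have F0 z : pv (F 0%N) z = z by [].
have tol00 : tol 0%N = 1 by []. have r00 : r 0%N = 1 by [].
clearbody F n r tol; clear S okS ok0 hnxt nxt s0.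
have th k : tol k.+1 <= tol k / 2 by have [_ _ _ [[h _ _ _] _]] := relS k.
have rh k : r k.+1 <= r k / 2 by have [_ _ _ [[_ _ h _] _]] := relS k.
have tw k i : tol (k + i)%N <= tol k * hp i.
  elim: i => [|i IH]; first by rewrite addn0 hp0 mulr1.
  by rewrite addnS hpS; apply: le_trans (th _) _; move: IH; clear; lra.
have tle1 k : tol k <= 1.
  have := tw 0%N k; rewrite add0n tol00 mul1r => h; apply: le_trans h (hp_le1 _ _).
have r1 k : r k <= 1.
  elim: k => [|k IH]; first by rewrite r00.
  by apply: le_trans (rh k) _; move: IH; clear; lra.
have /choice[f hf] : forall z, exists l, cl G z -> forall k, nrm (pv (F k) z - l) <= tol k.
  move=> z; have [hz|nz] := pselect (cl G z); last by exists 0.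
  have [|l hl] := tail_limit (u := fun k => pv (F k) z) t0 th ltr01.
    by move=> k _; have [h _ _ _] := relS k; have [] := h z hz.
  by exists l => _ k; apply: hl.
have /choice[f1 hf1] : forall z, exists l, 0 < W G z -> forall k, tol k <= W G z -> nrm (pv1 (F k) z - l) <= tol k.
  move=> z; have [hz|nz] := pselect (0 < W G z); last by exists 0.
  have [|l hl] := tail_limit (u := fun k => pv1 (F k) z) t0 th hz.
    by move=> k hk; have [_ h _ _] := relS k; have [] := h z hk.
  by exists l => _ k; apply: hl.
have /choice[f2 hf2] : forall z, exists l, 0 < W G z -> forall k, tol k <= W G z -> nrm (pv2 (F k) z - l) <= tol k.
  move=> z; have [hz|nz] := pselect (0 < W G z); last by exists 0.
  have [|l hl] := tail_limit (u := fun k => pv2 (F k) z) t0 th hz.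
    by move=> k hk; have [_ h _ _] := relS k; have [] := h z hk.
  by exists l => _ k; apply: hl.
have small (w : R) : 0 < w -> exists k0, forall i, tol (k0 + i)%N <= w /\ tol (k0 + i)%N <= hp i.
  move=> w0; have [k0 hk0] := hp_small w0; exists k0 => i.
  have tk : tol k0 <= hp k0 by have := tw 0%N k0; rewrite add0n tol00 mul1r.
  have hi0 := hp_le1 R i; have hi00 := hp_gt0 R i; have ti := tw k0 i.
  split; apply: le_trans ti _; first by apply: le_trans (le_trans tk hk0); rewrite ler_piMr // ltW.
  by rewrite ler_piMl ?(ltW hi00).
have clW z : 0 < W G z -> cl G z by move/ltW.
have cdf z : 0 < W G z -> cd f z (f1 z) /\ cd f1 z (f2 z).
  move=> hz; have w2 : 0 < W G z / 2 by rewrite divr_gt0.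
  have [rho rho0 hrho] := W_cont G z w2.
  have Wn w : nrm (w - z) <= rho -> W G z / 2 <= W G w.
    by move=> /hrho; rewrite ler_norml => /andP[h _]; move: h; clear; lra.
  have Wp w : nrm (w - z) <= rho -> 0 < W G w by move=> /Wn; apply: lt_le_trans.
  have [k0 hk0] := small _ w2.
  have tk i w : nrm (w - z) <= rho -> tol (k0 + i)%N <= W G w.
    by move=> /Wn; apply: le_trans; have [] := hk0 i.
  have SF k := let: And3 h _ _ := inv k in h.
  split.
    apply: (@cd_limit R (fun i => pv (F (k0 + i)%N)) (fun i => pv1 (F (k0 + i)%N)) f f1 z rho 1 rho0) => i w hw.
    - by have [] := SF (k0 + i)%N w (clW _ (Wp w hw)).
    - by rewrite mul1r; apply: le_trans (hf w (clW _ (Wp w hw)) _) _; have [] := hk0 i.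
    - by rewrite mul1r; apply: le_trans (hf1 w (Wp w hw) _ (tk i w hw)) _; have [] := hk0 i.
  apply: (@cd_limit R (fun i => pv1 (F (k0 + i)%N)) (fun i => pv2 (F (k0 + i)%N)) f1 f2 z rho 1 rho0) => i w hw.
  - by have [] := SF (k0 + i)%N w (clW _ (Wp w hw)).
  - by rewrite mul1r; apply: le_trans (hf1 w (Wp w hw) _ (tk i w hw)) _; have [] := hk0 i.
  - by rewrite mul1r; apply: le_trans (hf2 w (Wp w hw) _ (tk i w hw)) _; have [] := hk0 i.
have bnd k z : cl G z -> [/\ m <= nrm (pv1 (F k) z), nrm (pv1 (F k) z) <= M
    & W G z * nrm (pv2 (F k) z) <= tau * nrm (pv1 (F k) z)].
  move=> hz; have [_ h _] := inv k; have [h1 h2 h3] := h z hz; have hk := hp_gt0 R k.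
  have M0 : 0 < M by apply: lt_le_trans mM.
  split.
  - by apply: le_trans h1; move: (mulr_gt0 m0 hk); clear; lra.
  - by apply: le_trans h2 _; move: (mulr_gt0 M0 hk); clear; lra.
  - apply: le_trans h3 _; apply: ler_wpM2r => //.
    have tT : 0 < tau - T by rewrite subr_gt0.
    by move: (mulr_gt0 tT hk); clear; lra.
have nrmBl z w : nrm z <= nrm w + nrm (z - w).
  by have := nrmD w (z - w); rewrite addrC subrK.
exists m, M, f, f1, f2, n, r, cs; split => //.
- by split => //; move: mlo' lo1 m0; clear; lra.
- move=> z hz; have [k0 hk0] := small _ hz; have cz := clW _ hz.
  have near1 i : nrm (pv1 (F (k0 + i)%N) z - f1 z) <= hp i.
    by have [a1 a2] := hk0 i; apply: le_trans (hf1 z hz _ a1) a2.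
  have near2 i : nrm (pv2 (F (k0 + i)%N) z - f2 z) <= hp i.
    by have [a1 a2] := hk0 i; apply: le_trans (hf2 z hz _ a1) a2.
  split.
  + rewrite -subr_le0; apply: (@hp_lim R _ 1) => i.
    have [b1 _ _] := bnd (k0 + i)%N z cz.
    by move: b1 (near1 i) (nrmBl (pv1 (F (k0 + i)%N) z) (f1 z)); clear; lra.
  + rewrite -subr_le0; apply: (@hp_lim R _ 1) => i.
    have [_ b1 _] := bnd (k0 + i)%N z cz.
    have := nrmBl (f1 z) (pv1 (F (k0 + i)%N) z); rewrite nrmB.
    by move: b1 (near1 i); clear; lra.
  + rewrite -subr_le0; apply: (@hp_lim R _ (W G z + tau)) => i.
    have [_ _ b1] := bnd (k0 + i)%N z cz.
    have := nrmBl (f2 z) (pv2 (F (k0 + i)%N) z); rewrite nrmB => d2.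
    have d3 := ler_wpM2l (ltW hz) (le_trans d2 (lerD (lexx _) (near2 i))).
    have tau0 : 0 <= tau by move: tau1; clear; lra.
    have d4 := ler_wpM2l tau0 (le_trans (nrmBl (pv1 (F (k0 + i)%N) z) (f1 z)) (lerD (lexx _) (near1 i))).
    by move: b1 d3 d4; clear; lra.
- move=> x y hx hy; rewrite -subr_le0; apply: (@hp_lim R _ 2) => i.
  have H1 z : [set z | 0 <= W G z] z -> cd (pv (F i)) z (pv1 (F i) z).
    by move=> hz; have [h _ _] := inv i; have [] := h z hz.
  have H2 z : [set z | 0 <= W G z] z -> nrm (pv1 (F i) z) <= M by move=> hz; have [] := bnd i z hz.
  have h1 := cd_lip0 (W_cvx G) H1 H2 hy hx.
  have ti : tol i <= hp i by have := tw 0%N i; rewrite add0n tol00 mul1r.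
  have h2 := hf x hx i; have h3 := hf y hy i.
  have e1 : f x - f y = (pv (F i) x - pv (F i) y) - ((pv (F i) x - f x) - (pv (F i) y - f y)) by ring.
  have h4 := nrm_subD (pv (F i) x - pv (F i) y) ((pv (F i) x - f x) - (pv (F i) y - f y)).
  have h5 := nrm_subD (pv (F i) x - f x) (pv (F i) y - f y).
  by rewrite e1; move: h1 ti h2 h3 h4 h5; clear; lra.
- by move=> z hz; have := hf z hz 0%N; rewrite F0 tol00 nrmB.
- move=> k a t tE tk x hx hxr; have [_ _ h _] := relS k; have [h5 _] := h t a tE tk.
  apply: (h5 f f1) => // [z hz|z hz]; first by rewrite nrmB; exact: hf.
  have hz0 : 0 < W G z by apply: lt_le_trans hz.
  by split; [case: (cdf z hz0) | rewrite nrmB; exact: hf1].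
- move=> k a t tE tk x y hx hy hxr hyr; have [_ _ h _] := relS k; have [_ h6] := h t a tE tk.
  have q1 := h6 x y hx hy hxr hyr.
  have [e1 _ _ [[_ e2 _ _] _]] := relS k.+1.
  (* One share for the step that creates the next grid, and one for all steps after it. Used for [x]
     and for [y] this makes four shares of 1/20, the 1/5 in [fr_sep]. *)
  have close z : cl G z -> nrm (pv (F k.+1) z - f z) <= 2 * (m * cs k.+1 / 20 * hp (n k.+2)).
    move=> hz; have [a1 _] := e1 z hz; have a2 := hf z hz k.+2.
    have a3 := nrm_tri (pv (F k.+2) z) (pv (F k.+1) z) (f z); rewrite nrmB in a1.
    by move: a1 a2 a3 e2; clear; lra.
  have q2 := close x hx; have q3 := close y hy.
  have E : pv (F k.+1) x - pv (F k.+1) y = (f x - f y) + ((pv (F k.+1) x - f x) - (pv (F k.+1) y - f y)) by ring.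
  rewrite E in q1.
  have q4 := nrmD (f x - f y) ((pv (F k.+1) x - f x) - (pv (F k.+1) y - f y)).
  have q5 := nrm_subD (pv (F k.+1) x - f x) (pv (F k.+1) y - f y).
  by move: q1 q2 q3 q4 q5; clear; lra.
- move=> k; have [_ _ _ [[_ _ _ h1] [h2 h3]]] := relS k; split => //.
  by apply: le_trans h1; rewrite ler_pM2r // ler_pM2l.
Qed.

End Fractal.

(** * Digits in varying bases *)

Section MixedRadix.
Variable R : realType.
Implicit Types (N : nat -> nat) (u v : R).

(** The Cantor series of [u] with bases [N 0], [N 1] and so on: [orb] is the rescaled remainder in
    front of the digit [dig] of the same index. *)
Fixpoint orb N u i : R := if i is l.+1 then
  (N l)%:R * orb N u l - (Num.truncn ((N l)%:R * orb N u l))%:R else u.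
Definition dig N u i : nat := Num.truncn ((N i)%:R * orb N u i).

Lemma orbS N u i : orb N u i.+1 = (N i)%:R * orb N u i - (dig N u i)%:R. Proof. by []. Qed.

Lemma orb_itv N u i : 0 <= u < 1 -> 0 <= orb N u i < 1.
Proof.
move=> hu; elim: i => [//|i /andP[h0 h1]].
have := truncn_itv (mulr_ge0 (ler0n R (N i)) h0); rewrite orbS -/(dig N u i).
by rewrite -natr1 subr_ge0 ltrBlDl => /andP[-> ->].
Qed.

Lemma dig_lt N u i : 0 <= u < 1 -> (0 < N i)%N -> (dig N u i < N i)%N.
Proof.
move=> /orb_itv-/(_ N i)/andP[h0 h1] N0; rewrite truncn_lt_nat ?mulr_ge0 //.
by rewrite -[ltRHS]mulr1 ltr_pM2l ?ltr0n.
Qed.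

(** At the first differing digit the remainders add at most 1 to a digit difference that is at least
    1, whence the factor 2. Of the product of all earlier bases the last estimate keeps only the
    base just before, which suffices for the dimension. *)
Lemma dig_sep N u v : (forall i, (2 <= N i)%N) -> 0 <= u < 1 -> 0 <= v < 1 -> u != v ->
  exists i, [/\ forall l, (l < i)%N -> dig N u l = dig N v l, dig N u i != dig N v i,
    `|u - v| <= 2 * `|(dig N u i)%:R - (dig N v i)%:R| / (N i)%:R
  & forall l, i = l.+1 -> `|u - v| <= 2 * (`|(dig N u i)%:R - (dig N v i)%:R| / (N i)%:R) / (N l)%:R].
Proof.
move=> N2 hu hv uv.
have N0 i : 0 < (N i)%:R :> R by rewrite ltr0n (leq_trans _ (N2 i)).
have agree i : (forall l, (l < i)%N -> dig N u l = dig N v l) ->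
    `|u - v| <= `|orb N u i - orb N v i| * hp i /\
    forall l, i = l.+1 -> `|u - v| <= `|orb N u i - orb N v i| / (N l)%:R.
  elim: i => [|i IH] H; first by rewrite hp0 mulr1.
  have [h1 _] := IH (fun l hl => H l (ltnW hl)).
  have E : `|orb N u i.+1 - orb N v i.+1| = (N i)%:R * `|orb N u i - orb N v i|.
    by rewrite !orbS (H i (ltnSn _)) opprB addrA subrK -mulrBr normrM ger0_norm // ltW.
  have E2 : `|orb N u i - orb N v i| = `|orb N u i.+1 - orb N v i.+1| / (N i)%:R.
    by rewrite E mulrAC mulfV ?mul1r // gt_eqF.
  split.
    apply: le_trans h1 _; rewrite E2 hpS -mulrA; apply: ler_wpM2l => //.
    rewrite mulrC; apply: ler_wpM2l; first exact/ltW/hp_gt0.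
    by rewrite lef_pV2 ?posrE // ler_nat.
  move=> l [<-]; rewrite -E2; apply: le_trans h1 _.
  by rewrite ler_piMr // hp_le1.
have ex : exists i, (fun i => dig N u i != dig N v i) i.
  apply: contrapT => /forallNP all; move/negP: uv; apply; apply/eqP.
  have al i l : (l < i)%N -> dig N u l = dig N v l by move=> _; apply/eqP; apply: contrapT => /negP /all.
  apply/eqP; rewrite -subr_eq0 -normr_le0; apply: (@hp_lim R _ 1) => i.
  have [h _] := agree i (al i); apply: le_trans h _; rewrite ler_wpM2r ?(ltW (hp_gt0 _ _)) //.
  have /andP[a0 a1] := orb_itv N i hu; have /andP[b0 b1] := orb_itv N i hv.
  by rewrite ler_norml; apply/andP; split; lra.
case: (ex_minnP ex) => i hi mi; exists i.
have al l : (l < i)%N -> dig N u l = dig N v l.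
  by move=> li; apply/eqP; apply: contraT => /mi; rewrite leqNgt li.
have [h1 h2] := agree i al.
have D : `|orb N u i - orb N v i| <= 2 * (`|(dig N u i)%:R - (dig N v i)%:R| / (N i)%:R).
  rewrite mulrA ler_pdivlMr //.
  have -> : `|orb N u i - orb N v i| * (N i)%:R = `|(orb N u i.+1 - orb N v i.+1) + ((dig N u i)%:R - (dig N v i)%:R)|.
    by rewrite -{1}(ger0_norm (ltW (N0 i))) -normrM !orbS; congr `|_|; ring.
  apply: le_trans (ler_normD _ _) _.
  have /andP[a0 a1] := orb_itv N i.+1 hu; have /andP[b0 b1] := orb_itv N i.+1 hv.
  have : `|orb N u i.+1 - orb N v i.+1| <= 1 by rewrite ler_norml; apply/andP; split; lra.
  suff : 1 <= `|(dig N u i)%:R - (dig N v i)%:R : R| by lra.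
  move: hi; rewrite neq_ltn => /orP[l|l].
    by rewrite distrC ger0_norm -?natrB ?(ltnW l) // ler1n subn_gt0.
  by rewrite ger0_norm -?natrB ?(ltnW l) // ler1n subn_gt0.
split => //.
  by rewrite -mulrA; apply: le_trans h1 _; apply: le_trans D; rewrite ler_piMr // hp_le1.
by move=> l il; apply: le_trans (h2 l il) _; rewrite ler_pM2r ?invr_gt0.
Qed.

End MixedRadix.

(** * A Cantor set of boundary points with infinitely repeated values *)

Section CantorMap.
Variable R : realType.
Local Notation C := (Cplx R).

(** The digits of [u] in the bases [N i] select, in each cell, a point of the next grid, and [X u]
    is the limit of these points. If the digits of [u] and [v] first differ at [i], with relative
    difference [y], the images are at least [Q i * y] apart, while [u] and [v] differ by at most
    [2 y / N (i - 1)]. The two are compared by [y <= y ^ s] and by [1 / N (i - 1) <= Q i ^ s], which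
    is the power inequality in [fr_r]; the case [i = 0] determines [C0]. *)
Lemma cantor_map (G : geom R) tau m M f f1 f2 n r cs (j : nat) (a0 : int) (s : R) :
  fractal G tau m M f f1 f2 n r cs -> `|a0%:~R * hp (n j.+1)| <= j.+1%:R :> R ->
  0 < s -> s <= j%:R / j.+1%:R ->
  exists X : R -> C, exists2 C0 : R, 0 < C0 &
   (forall u, 0 <= u < 1 -> [/\ W G (X u) = 0, nrm (X u - gam G (a0%:~R * hp (n j.+1))) <= 2 * r j.+1
      & forall e : R, 0 < e -> exists z, [/\ 0 < W G z, nrm (z - X u) < e & f z = f (X u)]]) /\
   forall u v, 0 <= u < 1 -> 0 <= v < 1 -> `|u - v| <= C0 * nrm (f (X u) - f (X v)) `^ s.
Proof.
move=> H ha0 s0 sj.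
have [m0 m1 mM] := fr_m H.
pose rr i := r (j + i).+1; pose sg i : R := hp (n (j + i).+2).
(* The chosen grid points fill a parameter length of at most [rr i / 2]. As [gam] is 2-Lipschitz and
   the radii halve, a step moves the boundary point by at most [rr i], and all further steps
   together by at most [2 * rr i]. *)
pose N i := Num.truncn (rr i / (2 * sg i)).
have rr0 i : 0 < rr i by have [] := fr_r H (j + i).+1.
have rr1 i : rr i <= 1 by have [] := fr_r H (j + i).+1.
have rrS i : rr i.+1 <= rr i / 2 by rewrite /rr addnS; have [] := fr_r H (j + i).+1.
have sg0 i : 0 < sg i by exact: hp_gt0.
have sgr i : 4 * sg i <= rr i by have [_ _ _ _ []] := fr_r H (j + i).+1.
have csp k : 0 < cs k <= 1 by have [] := fr_cs H k.
have rsg i : 40 * rr i.+1 <= cs (j + i).+1 * sg i.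
  have [_ _ _ h _] := fr_r H (j + i).+1; rewrite /rr addnS -/(sg i) in h *.
  by rewrite -(ler_pM2l m0); move: h; rewrite /sg; clear; lra.
have sgS i : (n (j + i).+1 <= n (j + i).+2)%N.
  have [_ _ _ h _] := fr_r H (j + i); have [_ _ _ _ [h2 _]] := fr_r H (j + i).+1.
  have /andP[c0 c1] := csp (j + i)%N.
  rewrite leqNgt; apply/negP => /ltnW /(hp_le R) h3.
  have h4 : hp (n (j + i).+1) <= hp (n (j + i).+2) :> R by [].
  have h5 := hp_gt0 R (n (j + i).+2); have h6 := hp_gt0 R (n (j + i).+1).
  have h7 : m * (2 * r (j + i).+1) <= m * (cs (j + i)%N / 20 * hp (n (j + i).+1)) by move: h; clear; lra.
  rewrite ler_pM2l // in h7.
  have h8 := ler_wpM2r (ltW h6) c1.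
  by move: h2 h4 h5 h6 h7 h8; clear; lra.
have x2 i : 2 <= rr i / (2 * sg i).
  by rewrite ler_pdivlMr ?mulr_gt0 //; move: (sgr i); clear; lra.
have N2 i : (2 <= N i)%N.
  by rewrite truncn_ge_nat //; apply: le_trans (x2 i).
have N0 i : 0 < (N i)%:R :> R by rewrite ltr0n (leq_trans _ (N2 i)).
have Nup i : (N i)%:R * sg i <= rr i / 2.
  have : (N i)%:R <= rr i / (2 * sg i) by rewrite truncn_le; apply: le_trans (x2 i).
  by rewrite ler_pdivlMr ?mulr_gt0 //; clear; lra.
have Nlo i : rr i <= 4 * ((N i)%:R * sg i).
  have h : rr i / (2 * sg i) < (N i).+1%:R by exact: truncnS_gt.
  have h2 : 1 <= (N i)%:R :> R by rewrite ler1n (leq_trans _ (N2 i)).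
  rewrite ltr_pdivrMr ?mulr_gt0 // -natr1 in h.
  by have h3 := ler_wpM2r (ltW (sg0 i)) h2; move: h h3; clear; lra.
pose t := fix t (u : R) i := if i is l.+1 then t u l + (dig N u l)%:R * sg l else a0%:~R * hp (n j.+1).
have tS u i : t u i.+1 = t u i + (dig N u i)%:R * sg i by [].
have dsg (u : R) i : 0 <= u < 1 -> (dig N u i)%:R * sg i <= rr i / 2.
  move=> hu; apply: le_trans (Nup i); rewrite ler_pM2r // ler_nat ltnW //.
  by apply: dig_lt => //; exact: leq_trans (N2 i).
have dsg0 (u : R) i : 0 <= (dig N u i)%:R * sg i by rewrite mulr_ge0 // ltW.
(* The dyadic grids are nested, by [sgS], so the sum stays on the finer grid. *)
have tint u i : exists a : int, t u i = a%:~R * hp (n (j + i).+1).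
  elim: i => [|i [a IH]]; first by exists a0; rewrite addn0.
  exists (a * 2 ^+ (n (j + i).+2 - n (j + i).+1) + (dig N u i)%:Z).
  rewrite tS IH addnS intrD mulrDl; congr (_ + _ * _).
  have -> : hp (n (j + i).+1) = 2 ^+ (n (j + i).+2 - n (j + i).+1) * hp (n (j + i).+2) :> R.
    rewrite -{2}(subnKC (sgS i)) hpD mulrCA /hp -exprMn divff // expr1n mulr1 //.
  by rewrite mulrA intrM rmorphXn.
have tle u i : 0 <= u < 1 -> `|t u i| <= (j + i).+1%:R.
  move=> hu; elim: i => [|i IH]; first by rewrite addn0.
  rewrite tS addnS -[(j + i).+2%:R]natr1; apply: le_trans (ler_normD _ _) _; apply: lerD => //.
  by rewrite (ger0_norm (dsg0 u i)); apply: le_trans (dsg u i hu) _; move: (rr1 i); clear; lra.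
have gS u i : 0 <= u < 1 -> nrm (gam G (t u i.+1) - gam G (t u i)) <= rr i.
  move=> hu; apply: le_trans (gam_lip G _ _) _; rewrite tS addrAC subrr add0r (ger0_norm (dsg0 u i)).
  by move: (dsg u i hu); clear; lra.
have /choice[X hX] : forall u, exists x, 0 <= u < 1 -> forall i, nrm (gam G (t u i) - x) <= 2 * rr i.
  move=> u; have [hu|nu] := boolP (0 <= u < 1); last by exists 0.
  have [||||l hl] := @tail_limit R (fun i => gam G (t u i)) (fun i => 2 * rr i) (2 * rr 0%N).
  - by move=> k; rewrite mulr_gt0.
  - by move=> k; move: (rrS k); clear; lra.
  - by rewrite mulr_gt0.
  - by move=> k _; apply: le_trans (gS u k hu) _; clear; lra.
  exists l => _ i; apply: hl; elim: i => [//|i IH]; apply: le_trans IH.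
  by move: (rrS i) (rr0 i); clear; lra.
have rhp i : rr i <= hp i.
  elim: i => [|i IH]; first by rewrite hp0.
  by apply: le_trans (rrS i) _; rewrite hpS; move: IH; clear; lra.
have WX u : 0 <= u < 1 -> W G (X u) = 0.
  move=> hu; apply/eqP; rewrite -normr_le0 leNgt; apply/negP => w0.
  have w2 : 0 < `|W G (X u)| / 2 by rewrite divr_gt0.
  have [e e0 he] := W_cont G (X u) w2.
  have [i hi] := hp_small (divr_gt0 e0 (ltr0n R 2)).
  have := he (gam G (t u i)); rewrite W_gam sub0r normrN.
  have h1 := hX u hu i; have h2 := rhp i.
  have h3 : nrm (gam G (t u i) - X u) <= e by move: h1 h2 hi; clear; lra.
  by move=> /(_ h3); move: w0; clear; lra.
have clX u : 0 <= u < 1 -> cl G (X u) by move=> /WX h; rewrite /cl h.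
have same (u v : R) i : (forall l, (l < i)%N -> dig N u l = dig N v l) -> t u i = t v i.
  elim: i => [//|i IH] h; rewrite !tS (h i (ltnSn _)) IH // => l hl; apply: h; exact: ltnW.
pose Q i : R := m * cs (j + i).+1 / 16 * rr i.
have Q0 i : 0 < Q i by have /andP[c0 _] := csp (j + i).+1; rewrite mulr_gt0 // divr_gt0 // mulr_gt0.
have Q1 i : Q i <= 1.
  have /andP[c0 c1] := csp (j + i).+1.
  have h1 : m * cs (j + i).+1 <= 1 * 1 by apply: ler_pM => //; exact: ltW.
  have h2 : Q i <= 1 * 1.
    by apply: ler_pM => //; [rewrite divr_ge0 // mulr_ge0 // ltW | exact: ltW | move: h1; clear; lra].
  by move: h2; clear; lra.
(* The distance of two image points is governed by the first digit in which they differ. *)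
have sep (u v : R) i : 0 <= u < 1 -> 0 <= v < 1 -> (forall l, (l < i)%N -> dig N u l = dig N v l) ->
    dig N u i != dig N v i ->
    Q i * (`|(dig N u i)%:R - (dig N v i)%:R| / (N i)%:R) <= nrm (f (X u) - f (X v)).
  move=> hu hv al di; have tE := same u v i al.
  set y := `|(dig N u i)%:R - (dig N v i)%:R|.
  have y1 : 1 <= y.
    rewrite /y; move: di; rewrite neq_ltn => /orP[l|l].
      by rewrite distrC ger0_norm -?natrB ?(ltnW l) // ler1n subn_gt0.
    by rewrite ger0_norm -?natrB ?(ltnW l) // ler1n subn_gt0.
  have [a ta] := tint u i.
  have hxu : nrm (X u - gam G (t u i)) <= 2 * r (j + i).+1 by rewrite nrmB; exact: hX.
  have hxv : nrm (X v - gam G (t u i)) <= 2 * r (j + i).+1 by rewrite nrmB tE; exact: hX.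
  have q1 := fr_sep H ta (tle u i hu) (clX u hu) (clX v hv) hxu hxv.
  have [/andP[c0 c1] hc] := fr_cs H (j + i).+1.
  set c := cs (j + i).+1 in c0 c1 hc q1.
  have bu : `|t u i.+1| <= (j + i).+3%:R.
    by apply: le_trans (tle u i.+1 hu) _; rewrite ler_nat addnS.
  have bv : `|t v i.+1| <= (j + i).+3%:R.
    by apply: le_trans (tle v i.+1 hv) _; rewrite ler_nat addnS.
  have q2 := hc _ _ bu bv.
  have q3 : `|t u i.+1 - t v i.+1| = y * sg i.
    rewrite !tS tE opprD addrACA subrr add0r -mulrBl normrM (gtr0_norm (sg0 i)) //.
  rewrite q3 in q2.
  have q4 := hX u hu i.+1; have q5 := hX v hv i.+1.
  have q6 : nrm (gam G (t u i.+1) - gam G (t v i.+1)) <=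
      nrm (gam G (t u i.+1) - X u) + (nrm (X u - X v) + nrm (gam G (t v i.+1) - X v)).
    apply: le_trans (nrm_tri (X u) _ _) _; rewrite lerD2l.
    by apply: le_trans (nrm_tri (X v) _ _) _; rewrite (nrmB (X v)).
  have q7 := rsg i; rewrite -/c in q7.
  have q8 : c * sg i <= c * (y * sg i) by rewrite ler_pM2l // ler_peMl // ltW.
  rewrite -/(sg i) in q1.
  have q9 : m * (c * (y * sg i) / 4) <= nrm (f (X u) - f (X v)).
    have q10 : c * (y * sg i) / 4 <= nrm (X u - X v) / 2 - c / 5 * sg i.
      by move: q2 q4 q5 q6 q7 q8; clear; lra.
    by apply: le_trans (ler_wpM2l (ltW m0) q10) _; move: q1; clear; lra.
  apply: le_trans q9; rewrite /Q -/c.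
  have -> : m * c / 16 * rr i * (y / (N i)%:R) = m * (c * (y * (rr i / (N i)%:R)) / 16) by ring.
  rewrite ler_pM2l //.
  have : rr i / (N i)%:R <= 4 * sg i.
    by rewrite ler_pdivrMr //; move: (Nlo i); clear; lra.
  move=> q11; have := ler_wpM2l (mulr_ge0 (ltW c0) (le_trans ler01 y1)) q11; clear; lra.
have yN (u v : R) i : 0 <= u < 1 -> 0 <= v < 1 ->
    0 <= `|(dig N u i)%:R - (dig N v i)%:R : R| / (N i)%:R <= 1.
  move=> hu hv; rewrite divr_ge0 //= ?(ltW (N0 i)) // ler_pdivrMr // mul1r.
  have du : (dig N u i)%:R <= (N i)%:R :> R.
    by rewrite ler_nat ltnW //; apply: dig_lt => //; exact: leq_trans (N2 i).
  have dv : (dig N v i)%:R <= (N i)%:R :> R.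
    by rewrite ler_nat ltnW //; apply: dig_lt => //; exact: leq_trans (N2 i).
  by rewrite ler_norml; have := ler0n R (dig N u i); have := ler0n R (dig N v i);
    move: du dv; clear => *; apply/andP; split; lra.
have s1 : s <= 1.
  by apply: le_trans sj _; rewrite ler_pdivrMr ?ltr0n // mul1r ler_nat.
have ps (x : R) : 0 <= x <= 1 -> x <= x `^ s.
  move=> /andP[x0 x1]; move: x0; rewrite le_eqVlt => /orP[/eqP <-|x0]; first exact: powR_ge0.
  by rewrite -{1}[x]powRr1 ?(ltW x0) //; apply: ger_powR => //; rewrite x0.
have mono (x y : R) : 0 <= x -> x <= y -> x `^ s <= y `^ s.
  by move=> x0 xy; apply: ge0_ler_powR => //; rewrite ?nnegrE ?(ltW s0) //; exact: le_trans xy.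
exists X, (2 * (Q 0%N `^ s)^-1); first by rewrite mulr_gt0 // invr_gt0 powR_gt0.
split.
  move=> u hu; split; first exact: WX.
    by have := hX u hu 0%N; rewrite nrmB /rr addn0.
  move=> e e0; have [i hi] := hp_small (divr_gt0 e0 (ltr0n R 6)).
  have [a ta] := tint u i.
  have hx : nrm (X u - gam G (t u i)) <= 2 * r (j + i).+1 by rewrite nrmB; exact: hX.
  have [z [z1 z2 z3]] := fr_cell H ta (tle u i hu) (clX u hu) hx.
  exists z; split => //.
  have h1 : hp (j + i) <= hp i :> R by apply: hp_le; exact: leq_addl.
  have h2 := nrm_tri (gam G (t u i)) z (X u); have h3 := hX u hu i; have h4 := rhp i.
  by move: hi z2 h1 h2 h3 h4 e0; clear; lra.
move=> u v hu hv; have [->|uv] := eqVneq u v.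
  by rewrite subrr normr0 mulr_ge0 ?powR_ge0 // mulr_ge0 // invr_ge0 powR_ge0.
have [i [al di e1 e2]] := dig_sep N2 hu hv uv.
have hs := sep u v i hu hv al di; have hy := yN u v i hu hv.
have core k (y : R) : 0 <= y <= 1 -> Q k * y <= nrm (f (X u) - f (X v)) ->
    Q k `^ s * y <= nrm (f (X u) - f (X v)) `^ s.
  move=> hy1 h; have [y0 y1] := andP hy1.
  have : (Q k * y) `^ s <= nrm (f (X u) - f (X v)) `^ s.
    by apply: mono => //; rewrite mulr_ge0 // ltW.
  rewrite powRM ?(ltW (Q0 k)) //; apply: le_trans.
  by rewrite ler_wpM2l ?powR_ge0 // ps.
have P0 := core i _ hy hs; clear core.
case: i => [|l] in al di e1 e2 hs hy P0 *.
  apply: le_trans e1 _; rewrite -[leLHS]mulrA -[leRHS]mulrA ler_pM2l //.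
  by rewrite -ler_pdivrMl ?invr_gt0 ?powR_gt0 // invrK.
have e3 := e2 l erefl.
set y := `|(dig N u l.+1)%:R - (dig N v l.+1)%:R| / (N l.+1)%:R in hs hy e1 e3 P0.
have [y0 y1] := andP hy.
(* The earlier scale contributes the missing power. *)
have vQ : (N l)%:R^-1 <= Q l.+1 `^ s.
  have v1 : (N l)%:R^-1 <= 4 * sg l / rr l.
    rewrite -invf_div lef_pV2 ?posrE ?divr_gt0 ?mulr_gt0 //.
    by rewrite ler_pdivrMr ?mulr_gt0 //; move: (Nlo l); clear; lra.
  apply: le_trans v1 _.
  have [_ _ _ _ [_ h]] := fr_r H (j + l).+1.
  pose K := (j + l).+1; rewrite -/K in h.
  have QE : m * cs K.+1 / 16 * r K.+1 = Q l.+1 by rewrite /Q /rr /K addnS.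
  have KE : 4 * hp (n K.+1) / r K = 4 * sg l / rr l by [].
  rewrite QE KE in h.
  pose x := K%:R / K.+1%:R : R.
  have sx : s <= x.
    apply: le_trans sj _; rewrite /x ler_pdivlMr ?ltr0n // mulrAC ler_pdivrMr ?ltr0n //.
    rewrite -!natrM ler_nat (mulnS j K) (mulnS K j) (mulnC K) leq_add2r /K.
    by rewrite leqW // leq_addr.
  apply: le_trans (_ : Q l.+1 `^ x <= _); last first.
    by apply: ger_powR => //; rewrite Q0 Q1.
  have z0 : 0 <= 4 * sg l / rr l by rewrite divr_ge0 ?mulr_ge0 // ltW.
  rewrite -(@ler_pXn2r _ K.+1) ?nnegrE ?powR_ge0 //.
  apply: le_trans h _.
  rewrite -[X in _ <= X]powR_mulrn ?powR_ge0 // -powRrM /x divfK ?pnatr_eq0 //.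
  by rewrite powR_mulrn // ltW.
have Q0s : 1 <= (Q 0%N `^ s)^-1.
  rewrite invf_ge1 ?powR_gt0 //.
  apply: le_trans (mono _ _ (ltW (Q0 0%N)) (Q1 0%N)) _; by rewrite powR1.
have ny := powR_ge0 (nrm (f (X u) - f (X v))) s.
have h5 : y / (N l)%:R <= nrm (f (X u) - f (X v)) `^ s.
  by apply: le_trans P0; rewrite mulrC ler_wpM2r.
have h6 := ler_wpM2r ny Q0s.
by move: e3 h5 h6; clear; lra.
Qed.

End CantorMap.

(** * Bounds for Hausdorff measures *)

Section Hausdorff.
Variable R : realType.
Local Notation C := (Cplx R).
Implicit Types (A X : set C) (s d : R).

Lemma re_norm (z : C) : complex.Re `|z| = nrm z.
Proof. by rewrite normE. Qed.

Lemma diam_ge0 A : (0 <= diam A)%E.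
Proof. by rewrite /diam le_max lexx. Qed.

Lemma diam_le A d : 0 <= d -> (forall x y, A x -> A y -> nrm (x - y) <= d) -> (diam A <= d%:E)%E.
Proof.
move=> d0 H; rewrite /diam ge_max lee_fin d0 /=; apply: ge_ereal_sup => _ [[x y] [/= hx hy] <-].
by rewrite lee_fin; apply: le_trans (H x y hx hy); rewrite -re_norm; exact: lexx.
Qed.

Lemma diam_ge A x y : A x -> A y -> ((nrm (x - y))%:E <= diam A)%E.
Proof.
move=> hx hy; rewrite /diam le_max; apply/orP; right.
by apply: ereal_sup_ubound; exists (x, y) => //; rewrite -re_norm.
Qed.

Lemma diam_set0 : diam (set0 : set C) = 0%E.
Proof. by apply/le_anti; rewrite diam_ge0 andbT; apply: diam_le. Qed.

(** A covering of [X] by sets [U n] pulls back under [phi] to a covering of [[0, 1)] by intervals of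
    length [2 * K * diam (U n) ^ s]. Their total length is at least 1 by the subadditivity of
    Lebesgue measure, which bounds the sum for the covering from below. *)
Lemma hausdorff_neq0 X (phi : R -> C) (K s : R) : 0 < s -> 0 < K ->
  (forall u, 0 <= u < 1 -> X (phi u)) ->
  (forall u v, 0 <= u < 1 -> 0 <= v < 1 -> `|u - v| <= K * nrm (phi u - phi v) `^ s) ->
  hausdorff_measure s X != 0%E.
Proof.
move=> s0 K0 HX HK.
suff h : (((2 * K)^-1)%:E <= hausdorff_premeasure s 1 X)%E.
  rewrite gt_eqF //; apply: (@lt_le_trans _ _ ((2 * K)^-1)%:E).
    by rewrite lte_fin invr_gt0 mulr_gt0.
  by apply: le_trans h _; apply: ereal_sup_ubound; exists 1 => //=; exact: ltr01.
apply: le_ereal_inf_tmp => _ [U [XU Ud] <-].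
pose D n := fine (diam (U n)).
have DE n : diam (U n) = (D n)%:E.
  rewrite fineK // ge0_fin_numE ?diam_ge0 //; apply: le_lt_trans (Ud n) _; exact: ltry.
have D0 n : 0 <= D n by rewrite -lee_fin -DE diam_ge0.
pose L n : R := K * D n `^ s.
have L0 n : 0 <= L n by rewrite mulr_ge0 ?powR_ge0 // ltW.
pose u n : R := xget 0 [set v | 0 <= v < 1 /\ U n (phi v)].
have cover : [set` `[0, 1[%R] `<=` \bigcup_n [set` `[u n - L n, u n + L n]%R].
  move=> v /=; rewrite in_itv /= => hv.
  have [n _ hn] := XU _ (HX v hv); exists n => //=.
  have [hu1 hu2] : 0 <= u n < 1 /\ U n (phi (u n)).
    exact: (@xgetPex _ 0 [set v | 0 <= v < 1 /\ U n (phi v)] (ex_intro _ v (conj hv hn))).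
  rewrite in_itv /= -ler_distlC distrC; apply: le_trans (HK _ _ hv hu1) _.
  rewrite ler_wpM2l ?(ltW K0) //; apply: ge0_ler_powR; rewrite ?nnegrE ?(ltW s0) //.
  by rewrite -lee_fin -DE; exact: diam_ge.
have m1 n : measurable [set` `[u n - L n, u n + L n]%R] by exact: measurable_itv.
have m2 : measurable [set` `[0 : R, 1[%R] by exact: measurable_itv.
have h : (1 <= \sum_(n <oo) lebesgue_measure [set` `[u n - L n, u n + L n]%R])%E.
  have <- : lebesgue_measure [set` `[0 : R, 1[%R] = 1%E.
    by rewrite lebesgue_measure_itv /= lte_fin ltr01 oppr0 adde0.
  exact: (measure_sigma_subadditive (@lebesgue_measure R) m1 m2 cover).
have E n : lebesgue_measure [set` `[u n - L n, u n + L n]%R] = ((2 * K)%:E * diam (U n) `^ s)%E.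
  rewrite lebesgue_measure_itv /= lte_fin DE poweR_EFin -EFinM.
  have -> : 2 * K * D n `^ s = (u n + L n) - (u n - L n) by rewrite /L; ring.
  case: ltP => hL; first by rewrite EFinD EFinN.
  by have := L0 n => hn; congr EFin; lra.
have K2 : 0 < 2 * K by rewrite mulr_gt0.
have : (1 <= (2 * K)%:E * \sum_(n <oo) diam (U n) `^ s)%E.
  rewrite -nneseriesZl; last by move=> i _; exact: poweR_ge0.
  by apply: le_trans h _; apply: lee_nneseries => // n _; rewrite E.
move=> h1; rewrite -(@lee_pmul2l _ (2 * K)%:E) ?lte_fin //.
by rewrite -EFinM divff ?gt_eqF.
Qed.

Lemma series_le (a : nat -> \bar R) (B : R) (M : nat) : 0 <= B ->
  (forall n, 0 <= a n)%E -> (forall n, a n <= B%:E)%E -> (forall n, (M <= n)%N -> a n = 0%E) ->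
  (\sum_(n <oo) a n <= (M%:R * B)%:E)%E.
Proof.
move=> B0 a0 aB aM; apply: lime_le; first by apply: is_cvg_nneseries.
apply: nearW => n.
have : (\sum_(0 <= i < n) a i <= ((minn n M)%:R * B)%:E)%E.
  elim: n => [|n IH]; first by rewrite big_nil min0n mul0r.
  rewrite big_nat_recr //=; have [nM|Mn] := ltnP n M.
    have -> : minn n.+1 M = n.+1 by apply/minn_idPl.
    have nE : minn n M = n by apply/minn_idPl; exact: ltnW.
    rewrite nE in IH; rewrite -natr1 mulrDl mul1r EFinD; exact: leeD.
  rewrite aM // adde0; have -> : minn n.+1 M = M by apply/minn_idPr; rewrite leqW.
  by have E : minn n M = M by [apply/minn_idPr]; rewrite E in IH.
by move=> h; apply: le_trans h _; rewrite lee_fin ler_wpM2r // ler_nat geq_minr.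
Qed.

(** [X] lies on two Lipschitz arcs, one for each boolean. Cutting both into [N] pieces of diameter
    of order [1 / N] gives a sum of order [N ^ (1 - s)]. *)
Lemma hausdorff_eq0 X (g : bool -> R -> C) (T K s : R) : 0 <= T -> 0 < K -> 1 < s ->
  (forall b t t', `|t| <= T -> `|t'| <= T -> nrm (g b t - g b t') <= K * `|t - t'|) ->
  (forall x, X x -> exists b, exists2 t, `|t| <= T & x = g b t) ->
  hausdorff_measure s X = 0%E.
Proof.
move=> T0 K0 s1 HK HX; have s0 : 0 < s by lra.
apply/le_anti/andP; split; last first.
  apply: le_trans (ereal_sup_ubound _); last by exists 1 => //=; exact: ltr01.
  apply: le_ereal_inf_tmp => _ [U _ <-]; apply: nneseries_ge0 => n _ _; exact: poweR_ge0.
apply: ge_ereal_sup => _ [d d0 <-]; rewrite /= in d0.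
apply/lee_addgt0Pr => e e0; rewrite add0e.
pose Q := 2 * K * (T + 1); have Q0 : 0 < Q by rewrite !mulr_gt0 //; lra.
(* The total is at most [2 N (Q / N) ^ s = 2 Q ^ s N ^ (1 - s)]. *)
have [N N0 [N1 N2]] : exists2 N : nat, (0 < N)%N & Q / N%:R <= d /\ 2 * N%:R * (Q / N%:R) `^ s <= e.
  pose B := 2 * Q `^ s / e; have B0 : 0 < B by rewrite !divr_gt0 ?mulr_gt0 // powR_gt0.
  pose N := (Num.bound (Q / d) + Num.bound (B `^ (s - 1)^-1)).+1.
  have Nd : Q / d <= N%:R.
    apply: le_trans (ltW (archi_boundP (divr_ge0 (ltW Q0) (ltW d0)))) _.
    by rewrite ler_nat leqW // leq_addr.
  have NB : B `^ (s - 1)^-1 <= N%:R.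
    apply: le_trans (ltW (archi_boundP (powR_ge0 _ _))) _.
    by rewrite ler_nat leqW // leq_addl.
  have Npos : 0 < N%:R :> R by rewrite ltr0n.
  exists N => //; clearbody N; split.
    by rewrite ler_pdivrMr // mulrC -ler_pdivrMr.
  have NB2 : B <= N%:R `^ (s - 1).
    have sp : 0 < s - 1 by lra.
    rewrite -[B](powRr1 (ltW B0)) -[X in B `^ X](@mulVf _ (s - 1)) ?gt_eqF // powRrM.
    by apply: ge0_ler_powR; rewrite ?nnegrE ?powR_ge0 ?(ltW sp) // ltW.
  rewrite powRM ?invr_ge0 ?(ltW Q0) ?(ltW Npos) //.
  have Ns : N%:R^-1 `^ s = (N%:R `^ (s - 1) * N%:R)^-1 :> R.
    rewrite -[X in _ * X](powRr1 (ltW Npos)) -powRD ?subrK; last first.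
      by rewrite gt_eqF //= implybT.
    apply: (mulfI (x := N%:R `^ s)); first by rewrite gt_eqF // powR_gt0.
    rewrite -powRM ?invr_ge0 ?(ltW Npos) // divff ?gt_eqF // powR1 divff //.
    by rewrite gt_eqF // powR_gt0.
  rewrite Ns.
  have P0 : 0 < N%:R `^ (s - 1) by rewrite powR_gt0.
  have -> : 2 * N%:R * (Q `^ s * (N%:R `^ (s - 1) * N%:R)^-1) = 2 * Q `^ s / N%:R `^ (s - 1).
    by field; rewrite !gt_eqF.
  by rewrite ler_pdivrMr // [e * _]mulrC -ler_pdivrMr.
have Npos : 0 < N%:R :> R by rewrite ltr0n.
pose h := (T + 1) / N%:R; have h0 : 0 < 2 * h by rewrite mulr_gt0 // divr_gt0 //; lra.
(* The indices below [N] belong to the pieces of [g true], the next [N] to those of [g false]. *)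
pose V n : set C := if (n < N.*2)%N then
  [set x | exists2 t, `|t| <= T & x = g (n < N)%N t /\
     (let i := (if n < N then n else n - N)%N in - T + 2 * h * i%:R <= t <= - T + 2 * h * i.+1%:R)] else set0.
have dV n : (diam (V n) <= (Q / N%:R)%:E)%E.
  have Qd : 0 <= Q / N%:R by rewrite divr_ge0 // ltW.
  rewrite /V; case: ifP => _; last by rewrite diam_set0 lee_fin.
  apply: diam_le => // x y [t ht [-> /andP[t1 t2]]] [t' ht' [-> /andP[t3 t4]]].
  apply: le_trans (HK _ _ _ ht ht') _.
  have -> : Q / N%:R = K * (2 * h) by rewrite /Q /h; ring.
  rewrite ler_pM2l //; move: t1 t2 t3 t4; set i := (if _ then _ else _); rewrite -natr1.
  by rewrite ler_norml => *; apply/andP; split; lra.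
apply: le_trans (_ : _ <= (N.*2%:R * (Q / N%:R) `^ s)%:E)%E _; last first.
  by rewrite lee_fin -mul2n natrM.
apply: ge_ereal_inf; exists (\sum_(n <oo) diam (V n) `^ s)%E.
  exists V => //; split; last by move=> n; apply: le_trans (dV n) _; rewrite lee_fin.
  move=> x /HX[b [t ht ->]].
  pose i := Num.truncn ((t + T) / (2 * h)).
  have tT : 0 <= t + T by move: ht; rewrite ler_norml => /andP[]; lra.
  have q0 : 0 <= (t + T) / (2 * h) by rewrite divr_ge0 // ltW.
  have /andP[i1 i2] := truncn_itv q0; rewrite -/i in i1 i2.
  rewrite ler_pdivlMr // in i1; rewrite ltr_pdivrMr // in i2.
  have iN : (i < N)%N.
    rewrite -(ltr_nat R) -(ltr_pM2r h0).
    apply: le_lt_trans i1 _; have -> : N%:R * (2 * h) = 2 * (T + 1) by rewrite /h; field; rewrite gt_eqF.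
    by move: ht; rewrite ler_norml => /andP[]; lra.
  have bound : - T + 2 * h * i%:R <= t <= - T + 2 * h * i.+1%:R by apply/andP; split; lra.
  exists (if b then i else i + N)%N => //; rewrite /V.
  case: b => /=.
    by rewrite -addnn ltn_addr // iN; exists t.
  by rewrite -addnn ltn_add2r iN ltnNge leq_addl /= addnK; exists t.
have QN0 : 0 <= Q / N%:R by rewrite divr_ge0 // ltW.
apply: series_le; first exact: powR_ge0.
- by move=> n; exact: poweR_ge0.
- move=> n; rewrite -poweR_EFin; apply: gt0_ler_poweR; rewrite ?(ltW s0) //.
  + by rewrite in_itv /= diam_ge0 leey.
  + by rewrite in_itv /= lee_fin QN0 leey.
- move=> n hn; rewrite /V ltnNge hn /= diam_set0.
  by rewrite poweR_EFin powR0 // gt_eqF.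
Qed.

Lemma dim_eq1 X : (forall s, 0 < s -> s < 1 -> hausdorff_measure s X != 0%E) ->
  (forall s, 1 < s -> hausdorff_measure s X = 0%E) -> hausdorff_dim X = 1%E.
Proof.
move=> lo up; apply/le_anti/andP; split.
  apply/lee_addgt0Pr => e e0; apply: ereal_inf_lbound; exists (1 + e); last by rewrite EFinD.
  by split; [lra | apply: up; lra].
apply: le_ereal_inf_tmp => _ [s [s0 hs] <-]; rewrite lee_fin leNgt; apply/negP => s1.
by move/eqP: (lo s s0 s1); apply.
Qed.

End Hausdorff.

(** * From estimates to the topology of the plane *)

Section TopologyBridge.
Variable R : realType.
Local Notation C := (Cplx R).
Implicit Types (z w p q : C) (A S D : set C) (f g : C -> C).

Lemma rc_gt0P z : 0 < z -> exists2 r : R, 0 < r & z = rc r.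
Proof.
move=> z0; have E := ger0_norm (ltW z0); rewrite normE in E.
by exists (nrm z) => //; rewrite nrm_gt0 gt_eqF.
Qed.

Lemma norm_ltE z (r : R) : (`|z| < rc r) = (nrm z < r).
Proof. by rewrite normE ltcR. Qed.

Lemma nbhs_nrmP z A : nbhs z A <-> exists2 r : R, 0 < r & forall w, nrm (w - z) < r -> A w.
Proof.
split.
  move=> /nbhs_ballP[e /= e0 he]; have [r r0 E] := rc_gt0P e0; exists r => // w hw; apply: he.
  by rewrite -ball_normE /= E norm_ltE nrmB.
move=> [r r0 hr]; apply/nbhs_ballP; exists (rc r) => /=; first by rewrite -rc0 ltcR.
by move=> w; rewrite -ball_normE /= norm_ltE nrmB => /hr.
Qed.

Lemma cvg_nrmP (T : Type) (F : set_system T) (FF : Filter F) (f : T -> C) (l : C) :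
  (forall e : R, 0 < e -> F [set t | nrm (f t - l) < e]) -> f @ F --> l.
Proof.
move=> H A /nbhs_nrmP[r r0 hr]; apply: filterS (H r r0) => t /=; exact: hr.
Qed.

Lemma cd_derive1 f z d : cd f z d -> derivable f z 1 /\ f^`()%classic z = d.
Proof.
move=> H.
have h : (fun h : C => h^-1 *: (f (h *: (1 : C) + z) - f z)) @ 0^' --> d.
  apply: cvg_nrmP => e e0.
  have [r r0 hr] := H (e / 2) (divr_gt0 e0 (ltr0Sn R 1)).
  apply/nbhs_nrmP; exists r => // h; rewrite subr0 => hr1 h0 /=.
  have hn : 0 < nrm h by rewrite nrm_gt0.
  have -> : h^-1 *: (f (h *: (1 : C) + z) - f z) - d = (f (z + h) - f z - d * h) / h.
    have -> : h *: (1 : C) + z = z + h by rewrite /GRing.scale /= mulr1 addrC.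
    by rewrite /GRing.scale /=; field.
  rewrite nrm_div ltr_pdivrMr //; apply: le_lt_trans (hr h hr1) _.
  by rewrite ltr_pM2r //; lra.
split; first by apply/cvg_ex; exists d.
by rewrite derive1E; apply: cvg_lim h; exact: norm_hausdorff.
Qed.

Lemma cd_near f g z d (r : R) : 0 < r -> (forall w, nrm (w - z) < r -> f w = g w) -> cd f z d -> cd g z d.
Proof.
move=> r0 E H e /H[s s0 hs]; exists (Num.min r s); first by rewrite lt_min r0.
move=> h; rewrite lt_min => /andP[h1 h2].
rewrite -!E ?subrr ?nrm0 //; first exact: hs.
by rewrite addrC addKr.
Qed.

(** The Bolzano-Weierstrass theorem, applied to the real and then to the imaginary parts of an
    injective sequence in [S]. *)
Lemma infinite_accumulation S (B : R) : infinite_set S -> (forall z, S z -> nrm z <= B) ->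
  exists q, forall e : R, 0 < e -> exists z, [/\ S z, z != q & nrm (z - q) < e].
Proof.
move=> /infiniteP /pcard_leP[x0] SB.
pose x (n : nat) : C := x0 n.
have xS n : S (x n) by exact: (@funS _ _ _ _ x0).
have xI : injective x by move=> n k E; apply: (@inj _ _ _ x0); rewrite ?inE.
clearbody x.
have bd (u : nat -> R) : (forall n, `|u n| <= B) -> bounded_fun u.
  by move=> uB; exists B; split; [exact: num_real | move=> K BK n _; apply: le_trans (uB n) (ltW BK)].
have inc (h : nat -> nat) : increasing_seq h -> forall n, (n <= h n)%N.
  move=> hi; elim=> // n IH; apply: leq_ltn_trans IH _.
  by rewrite ltnNge; have := hi n.+1 n; rewrite leEnat => ->; rewrite ltnn.
have ev (u : nat -> R) l : u @ \oo --> l -> forall e : R, 0 < e -> exists N, forall n, (N <= n)%N -> `|l - u n| < e.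
  by move=> /cvgrPdist_lt H e /H[N _ hN]; exists N => n /hN.
have [h1 i1 /cvg_ex[a ha]] : exists2 h, increasing_seq h & cvgn ((fun n => re (x n)) \o h).
  by apply: bolzano_weierstrass; apply: bd => n; apply: le_trans (re_le _) (SB _ (xS n)).
have [h2 i2 /cvg_ex[b hb]] : exists2 h, increasing_seq h & cvgn ((fun n => im (x (h1 n))) \o h).
  by apply: bolzano_weierstrass; apply: bd => n; apply: le_trans (im_le _) (SB _ (xS _)).
pose q : C := Complex a b.
have near (e : R) : 0 < e -> exists N, forall n, (N <= n)%N -> nrm (x (h1 (h2 n)) - q) < e.
  move=> e0; have e2 : 0 < e / 2 by lra.
  have [N1 H1] := ev _ _ ha _ e2; have [N2 H2] := ev _ _ hb _ e2.
  exists (maxn N1 N2) => n; rewrite geq_max => /andP[n1 n2].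
  have := H1 (h2 n) (leq_trans n1 (inc _ i2 n)); have := H2 n n2 => /= A1 A2.
  apply: le_lt_trans (nrm_reim _) _; rewrite !reimE.
  have -> : re q = a by []. have -> : im q = b by [].
  by rewrite distrC [X in _ + X]distrC; lra.
exists q => e /near[N hN].
(* Of two consecutive terms, which are different, at most one can be [q]. *)
have neq : x (h1 (h2 N)) <> x (h1 (h2 N.+1)).
  move=> /xI E; have : (h1 (h2 N.+1) <= h1 (h2 N))%O by rewrite E.
  by rewrite i1; have := i2 N.+1 N; rewrite leEnat => ->; rewrite ltnn.
have [E | n0] := eqVneq (x (h1 (h2 N))) q; last by exists (x (h1 (h2 N))); split; rewrite ?hN.
exists (x (h1 (h2 N.+1))); split; rewrite ?hN //.
by apply/eqP => E'; apply: neq; rewrite E E'.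
Qed.

Lemma infinite_near A p : (forall e : R, 0 < e -> exists z, [/\ A z, z != p & nrm (z - p) < e]) -> infinite_set A.
Proof.
move=> H /finite_seqP[s E].
have [e e0 he] : exists2 e : R, 0 < e & forall z, z \in s -> z != p -> e <= nrm (z - p).
  elim: s {E} => [|y s [e e0 he]]; first by exists 1.
  exists (if y == p then e else Num.min e (nrm (y - p))).
    by case: eqVneq => // yp; rewrite lt_min e0 nrm_gt0 subr_eq0.
  move=> z; rewrite inE => /orP[/eqP ->|zs] zp.
    by rewrite (negbTE zp) ge_min lexx orbT.
  by case: ifP => _; rewrite ?ge_min he.
have [z [Az zp]] := H e e0; rewrite ltNge he //.
by move: Az; rewrite E.
Qed.

End TopologyBridge.

(** * The limit function in the terms of the theorem *)

Section Bridge.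
Variable R : realType.
Local Notation C := (Cplx R).
Implicit Types (z w p q : C) (D : set C) (G : geom R).

Section Fractal.
Variables (G : geom R) (tau m M : R) (f f1 f2 : C -> C) (n : nat -> nat) (r cs : nat -> R) (D : set C).
Hypothesis H : fractal G tau m M f f1 f2 n r cs.
Hypothesis DE : forall z, D z <-> 0 < W G z.

Lemma fractal_open z : D z -> exists2 e : R, 0 < e & forall w, nrm (w - z) < e -> D w.
Proof.
move=> /DE z0; have [e e0 he] := W_cont G z (divr_gt0 z0 (ltr0Sn R 1)).
exists e => // w /ltW /he; rewrite ler_distl => /andP[h1 h2].
by apply/DE; move: z0 h1; lra.
Qed.

Lemma fractal_derive1 z : D z -> derivable f z 1 /\ f^`()%classic z = f1 z.
Proof. by move=> /DE /(fr_cd H)[h _]; exact: cd_derive1. Qed.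

Lemma fractal_derive2 z : D z -> f^`(2)%classic z = f2 z.
Proof.
move=> Dz; have [e e0 he] := fractal_open Dz.
rewrite derive1nS derive1n1; apply: (cd_derive1 _).2.
have [_ h] := fr_cd H ((DE z).1 Dz); apply: cd_near e0 _ h => w /he Dw.
by rewrite (fractal_derive1 Dw).2.
Qed.

Lemma fractal_boundary p : boundary D p -> W G p = 0.
Proof.
move=> [cp np].
have near (e : R) : 0 < e -> exists z, D z /\ nrm (z - p) < e.
  move=> e0; have [z [Dz hz]] : D `&` [set z | nrm (z - p) < e] !=set0.
    by apply: cp; apply/nbhs_nrmP; exists e.
  by exists z.
apply/le_anti/andP; split.
  rewrite leNgt; apply/negP => p0; apply: np; apply/nbhs_nrmP.
  by apply: fractal_open; apply/DE.
rewrite leNgt; apply/negP => p0.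
have p1 : 0 < - W G p / 2 by rewrite divr_gt0 // oppr_gt0.
have [e e0 he] := W_cont G p p1; have [z [/DE Dz /ltW /he]] := near e e0.
rewrite ler_distl => /andP[_]; move: Dz p0; lra.
Qed.

Lemma fractal_lip_near p (e : R) : cl G p -> 0 < e ->
  exists2 d : R, 0 < d & forall z, cl G z -> nrm (z - p) < d -> nrm (f z - f p) < e.
Proof.
move=> cp e0; have [m0 _ mM] := fr_m H; have M0 : 0 < M by apply: lt_le_trans m0 mM.
exists (e / M); first by rewrite divr_gt0.
move=> z cz; rewrite ltr_pdivlMr // mulrC => hz.
exact: le_lt_trans (fr_lip H cz cp) hz.
Qed.

(** The constructed [f] is already continuous on the closed domain, so the limit defining the
    extension is its own value. *)
Lemma fractal_extend p : boundary D p -> extend D f p = f p.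
Proof.
move=> bp; have Wp := fractal_boundary bp; have [cp _] := bp.
have cl_p : cl G p by rewrite /cl Wp.
have PF : ProperFilter (within D (nbhs p)) by exact: within_nbhs_proper.
apply: cvg_lim; first exact: norm_hausdorff.
apply: cvg_nrmP => e /(fractal_lip_near cl_p)[d d0 hd].
by apply/nbhs_nrmP; exists d => // z hz /DE Dz; apply: hd => //; exact: ltW.
Qed.

Lemma fractal_bound z : D z -> W G z * nrm (f^`(2)%classic z / f^`()%classic z) <= tau.
Proof.
move=> Dz; rewrite (fractal_derive1 Dz).2 fractal_derive2 //.
have [m0 _ _] := fr_m H; have [h1 _ h2] := fr_bd H ((DE z).1 Dz).
by rewrite nrm_div mulrA ler_pdivrMr // (lt_le_trans m0).
Qed.

Lemma fractal_annulus : f^`()%classic @` D `<=` annulus (m / 2) (2 * M).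
Proof.
move=> _ [z Dz <-]; rewrite (fractal_derive1 Dz).2 /annulus /=.
have [m0 _ mM] := fr_m H; have [h1 h2 _] := fr_bd H ((DE z).1 Dz).
by rewrite normE -!rcE !ltcR; apply/andP; split; lra.
Qed.

(** Near [p] there is a cell around a grid point [gam G (a0%:~R * hp (n J.+1))] whose image lies in
    the given disc. The points [X u] of its Cantor set are limits of inner points with the same
    value, so [f (X u)] is taken infinitely often, and the Hölder estimate of [cantor_map] feeds
    [hausdorff_neq0]. *)
Lemma fractal_dim_ge z0 (d s : R) : 0 < d -> (exists2 p, boundary D p & z0 = f p) -> 0 < s -> s < 1 ->
  hausdorff_measure s (disc z0 d `&` infinite_valence D f) != 0%E.
Proof.
move=> d0 [p /fractal_boundary Wp ->] s0 s1.
have [m0 _ mM] := fr_m H; have M0 : 0 < M by apply: lt_le_trans m0 mM.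
have cp : cl G p by rewrite /cl Wp.
have [e e0 he] := fractal_lip_near cp d0.
have [t ht] := gam_dense Wp (divr_gt0 e0 (ltr0Sn R 1)).
have rh j : r j <= hp j.
  elim: j => [|j IH]; first by rewrite hp0; have [] := fr_r H 0.
  by rewrite hpS; have [_ _ h _ _] := fr_r H j; apply: le_trans h _; rewrite ler_pM2r ?invr_gt0.
have [J1 hJ1] := hp_small (divr_gt0 e0 (ltr0Sn R 7)).
(* [J] is so large that the cell is close to [p], that the parameter range of its grid contains [t]
   with room to spare, and that [s <= J / (J + 1)]. *)
pose J := (J1 + Num.bound (`|t| + 1) + Num.bound (s / (1 - s))).+1.
have JJ1 : (J1 <= J)%N by rewrite leqW // -addnA leq_addr.
have Jt : `|t| + 1 <= J%:R.
  apply: le_trans (ltW (archi_boundP _)) _; first by have := normr_ge0 t; lra.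
  by rewrite ler_nat leqW // -addnA addnCA leq_addr.
have Js : s <= J%:R / J.+1%:R.
  have : s / (1 - s) <= J%:R.
    apply: le_trans (ltW (archi_boundP _)) _; first by rewrite divr_ge0 //; lra.
    by rewrite ler_nat leqW // leq_addl.
  rewrite ler_pdivrMr; last by lra.
  by rewrite ler_pdivlMr ?ltr0Sn // -natr1; lra.
clearbody J.
have [r0 _ _ _ [hr _]] := fr_r H J.
have rJ : r J <= e / 8.
  by apply: le_trans (rh J) (le_trans (hp_le _ JJ1) hJ1).
set g : R := hp (n J.+1) in hr *; have g0 : 0 < g by exact: hp_gt0.
pose a0 : int := Num.floor (t / g).
have /andP[a1 a2] := mem_rg1_floor (t / g); rewrite -/a0 in a1 a2.
rewrite ler_pdivlMr // in a1; rewrite ltr_pdivrMr // mulrDl mul1r in a2.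
have gs : 0 <= t - a0%:~R * g <= g by apply/andP; split; lra.
have g1 : g <= 1 by have [_ h _ _ _] := fr_r H J; lra.
have ga : `|a0%:~R * g| <= J.+1%:R.
  have := ler_norm t; have := ler_norm (- t); rewrite normrN -natr1 ler_norml.
  by move: gs Jt g1 => /andP[] => *; apply/andP; split; lra.
have [X [C0 C00 [HX HC]]] := cantor_map H ga s0 Js.
apply: (@hausdorff_neq0 _ _ (fun u => f (X u)) C0 s) => // u hu.
have [WX X1 X2] := HX u hu.
have cX : cl G (X u) by rewrite /cl WX.
split.
  rewrite /disc /= norm_ltE; apply: he => //.
  apply: le_lt_trans (nrm_tri (gam G (a0%:~R * g)) _ _) _.
  apply: le_lt_trans (lerD (le_refl _) (nrm_tri (gam G t) _ _)) _.
  have := gam_lip G (a0%:~R * g) t; rewrite distrC ger0_norm; last by case/andP: gs.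
  have [_ _ h _ _] := fr_r H J.
  by move: X1 ht rJ hr h gs r0 => A1 A2 A3 A4 A5 /andP[A6 A7] A8 A9; lra.
have acc (b : R) : 0 < b -> exists z, [/\ (D `&` f @^-1` [set f (X u)]) z, z != X u & nrm (z - X u) < b].
  move=> /X2[z [z1 z2 z3]]; exists z; split => //.
    by split; [apply/DE | ].
  by apply/eqP => E; rewrite E WX ltxx in z1.
split; last exact: infinite_near acc.
by have [z [[z1 z2] _ _]] := acc 1 ltr01; exists z.
Qed.

(** The preimages of [w] are bounded because [f] moves points by at most 1, so they accumulate at
    some [q] of the closed domain. An inner [q] is impossible: the derivative there is not 0, so the
    value [f q] is isolated. Hence [q] lies on the boundary, and [f q = w] by continuity. *)
Lemma fractal_infinite_valence w : infinite_valence D f w ->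
  exists2 q, W G q = 0 & nrm q <= nrm w + 1 /\ f q = w.
Proof.
move=> [_ inf].
have [m0 _ mM] := fr_m H; have M0 : 0 < M by apply: lt_le_trans m0 mM.
have bd z : (D `&` f @^-1` [set w]) z -> nrm z <= nrm w + 1.
  move=> [/DE Dz /= E]; have := fr_id H (ltW Dz : cl G z).
  by rewrite E; have := nrm_lowB z w; rewrite nrmB; lra.
have [q hq] := infinite_accumulation inf bd.
have cq : cl G q.
  rewrite /cl leNgt; apply/negP => q0.
  have q1 : 0 < - W G q / 2 by rewrite divr_gt0 // oppr_gt0.
  have [e e0 he] := W_cont G q q1; have [z [[/DE Dz _] _ /ltW /he]] := hq e e0.
  by rewrite ler_distl => /andP[_]; move: Dz q0; lra.
have fq : f q = w.
  apply/eqP; rewrite -subr_eq0 -nrm_eq0; apply/eqP/le_anti; rewrite nrm_ge0 andbT.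
  apply/ler_addgt0Pr => e /(fractal_lip_near cq)[d /hq[z [[/DE Dz E] _ hz]] hd].
  by rewrite add0r nrmB -E; apply/ltW/hd => //; exact: ltW.
have Wq : W G q = 0.
  apply/le_anti; rewrite cq andbT leNgt; apply/negP => q0.
  have [h _] := fr_cd H q0; have [h1 _ _] := fr_bd H q0.
  have [d d0 hd] := h (m / 2) (divr_gt0 m0 (ltr0Sn R 1)).
  have [z [[_ E] zq hz]] := hq d d0.
  have := hd (z - q) hz; rewrite [q + _]addrC subrK E fq subrr sub0r nrmN nrmM.
  have zq0 : 0 < nrm (z - q) by rewrite nrm_gt0 subr_eq0.
  rewrite ler_pM2r //; move: h1 m0; lra.
exists q => //; split => //; apply/ler_addgt0Pr => e /hq[z [/bd z1 _ z2]].
by have := nrm_lowB q (q - z); rewrite subKr nrmB in z2 *; lra.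
Qed.

(** Values in a disc come from boundary points in a bounded set, hence from a bounded range of
    parameters; there [f (gam t)] and [f (- gam t)] are two Lipschitz arcs. *)
Lemma fractal_dim_le z0 (d s : R) : 1 < s ->
  hausdorff_measure s (disc z0 d `&` infinite_valence D f) = 0%E.
Proof.
move=> s1.
have [m0 _ mM] := fr_m H; have M0 : 0 < M by apply: lt_le_trans m0 mM.
have [T T0 hT] := gam_cover G (nrm z0 + d + 1).
pose g (b : bool) t := if b then f (gam G t) else f (- gam G t).
apply: (@hausdorff_eq0 _ _ g T (2 * M) s) => //; first by rewrite mulr_gt0.
  move=> b t t' _ _; rewrite mulrAC.
  have E : nrm (g b t - g b t') <= M * nrm (gam G t - gam G t').
    case: b; rewrite /g; first by apply: (fr_lip H); rewrite /cl W_gam.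
    apply: le_trans (fr_lip H _ _) _; rewrite /cl ?W_gamN //.
    by rewrite -opprD nrmN.
  apply: le_trans E _; rewrite mulrC ler_pM2r //; exact: gam_lip.
move=> w [] /=; rewrite /disc /= norm_ltE => hw /fractal_infinite_valence[q Wq [q1 q2]].
have q3 : nrm q <= nrm z0 + d + 1.
  by have := nrmD (w - z0) z0; rewrite subrK; lra.
by have [t ht [E|E]] := hT q Wq q3; [exists true | exists false]; exists t; rewrite // /g -E.
Qed.

End Fractal.

Lemma fractal_function G (tau : R) D : 1 < tau -> (forall z, D z <-> 0 < W G z) ->
  exists f : C -> C,
    [/\ analytic_on D f,
        forall z, D z -> W G z * nrm (f^`(2)%classic z / f^`()%classic z) <= tau,
        exists m M : R, [/\ 0 < m, m < M & f^`()%classic @` D `<=` annulus m M] &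
        forall (r : R) z0, 0 < r -> (extend D f @` boundary D) z0 ->
          hausdorff_dim (disc z0 r `&` infinite_valence D f) = 1%E].
Proof.
move=> tau1 DE; have [m [M [f [f1 [f2 [n [r [cs H]]]]]]]] := fractal_exists G tau1.
have [m0 _ mM] := fr_m H.
exists f; split.
- by move=> z /(fractal_derive1 H DE)[].
- by move=> z; exact: fractal_bound H DE z.
- by exists (m / 2), (2 * M); split; [lra | lra | exact: fractal_annulus H DE].
- move=> d z0 d0 [p bp Ep]; apply: dim_eq1 => s s0; last exact: fractal_dim_le H DE _ _ _ s0.
  move=> s1; apply: (fractal_dim_ge H DE) => //; exists p => //.
  by rewrite -Ep (fractal_extend H DE).
Qed.

End Bridge.

Theorem theoremC (R : realType) (D : set (Cplx R))
    (hD : D = unit_disc R \/ D = upper_half_plane R)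
    (tau : R) (htau : 1 < tau) :
  exists f : Cplx R -> Cplx R,
    [/\ analytic_on D f,
        D = unit_disc R -> forall z, D z ->
          `|f^`(2)%classic z / f^`()%classic z| <= tau%:C / (1 - `|z| ^+ 2),
        D = upper_half_plane R -> forall z, D z ->
          `|f^`(2)%classic z / f^`()%classic z| <= tau%:C / (2 * 'Im z),
        exists m M : R, [/\ 0 < m, m < M & f^`()%classic @` D `<=` annulus m M] &
        forall (r : R) (z0 : Cplx R), 0 < r ->
          (extend D f @` boundary D) z0 ->
          hausdorff_dim (disc z0 r `&` infinite_valence D f) = 1%E].
Proof.
have unitE z : unit_disc R z <-> 0 < 1 - nrm z ^+ 2.
  rewrite /unit_disc /disc /= subr0 norm_ltE subr_gt0.
  by rewrite expr_lt1 ?nrm_ge0.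
have halfE z : upper_half_plane R z <-> 0 < 2 * im z.
  rewrite /upper_half_plane /= -complexIm -(rc0 R) ltcR.
  by split; rewrite pmulr_rgt0.
(* The point [i] tells the two domains apart, so in each case the inequality for the other domain
   holds vacuously. *)
have neq : unit_disc R <> upper_half_plane R.
  move=> E; have /unitE : unit_disc R (ii R) by rewrite E; apply/halfE; rewrite im_ii; lra.
  by rewrite nrm_ii expr1n subrr ltxx.
case: hD => ->.
  have [G GE] := disc_geom_exists R.
  have DE z : unit_disc R z <-> 0 < W G z by rewrite GE.
  have [f [an bd ann dim]] := fractal_function htau DE.
  exists f; split => // _ z Dz; have := bd z Dz; rewrite GE => h.
  rewrite !normE -!rcE -(rc1 R) expr2 -rcM -rcB -rcV -rcM lecR -expr2.
  by rewrite ler_pdivlMr 1?mulrC //; apply/unitE.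
have [G [GE _]] := half_geom_exists R.
have DE z : upper_half_plane R z <-> 0 < W G z by rewrite GE.
have [f [an bd ann dim]] := fractal_function htau DE.
exists f; split => // [E|_ z Dz]; first by case: neq.
have := bd z Dz; rewrite GE => h.
rewrite -complexIm normE -!rcE; have -> : (2 : Cplx R) = rc 2 by rewrite rcD.
rewrite -rcM -rcV -rcM lecR.
by rewrite ler_pdivlMr; [rewrite mulrC | exact: (halfE z).1 Dz].
Qed.
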